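(* Consider the linear panel data model with fixed effects described in the context, and let Assumptions A1–A3 hold. Suppose moreover that the limit $\Upsilon := \lim_{n,m\to\infty} \Upsilon_{n,m}$ exists, where $\Upsilon_{n,m} := \Sigma_{n,m}^{-1}\Omega_{n,m}\Sigma_{n,m}^{-1}$. Then $$ \sqrt{nm}\,\Big(\hat\beta - \beta - \tfrac{1}{m}\Sigma_{n,m}^{-1} b_{n,m}\Big) \xrightarrow{L} N(0,\Upsilon), $$ where $$ b_{n,m} := -\frac{1}{n}\sum_{i=1}^n \sum_{\tau=1}^{m-1}\frac{m-\tau}{m}\Big(\mathbb{E}(z_{it}\varepsilon_{i,t+\tau}) + \mathbb{E}(z_{i,t+\tau}\varepsilon_{it})\Big). $$
   Context: Panel data $(y_{it},x_{it})$, $i=1,\dots,n$, $t=1,\dots,m$, with $x_{it}\in\mathbb{R}^K$, generated by $y_{it}=\alpha_i + x_{it}'\beta+\varepsilon_{it}$ with $\mathbb{E}(\varepsilon_{it})=0$ and $\mathbb{E}(x_{it}\varepsilon_{it})=0$; the intercepts $\alpha_1,\dots,\alpha_n$ are unknown fixed parameters. Regressors need not be strictly exogenous: $\mathbb{E}(x_{it}\varepsilon_{i,t+\tau})$ and $\mathbb{E}(x_{i,t+\tau}\varepsilon_{it})$ may be nonzero for $\tau\neq 0$. Let $z_{it}:=x_{it}-\mathbb{E}(x_{it})$, $\bar y_i := \frac1m\sum_t y_{it}$, $\bar x_i:=\frac1m\sum_t x_{it}$. The within-group estimator is $\hat\beta := \big(\sum_{i,t}(x_{it}-\bar x_i)(x_{it}-\bar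 x_i)'\big)^{-1}\sum_{i,t}(x_{it}-\bar x_i)(y_{it}-\bar y_i)$. Define $\Sigma_{n,m}:=\frac{1}{nm}\sum_{i,t}\mathbb{E}(z_{it}z_{it}')$ and $\Omega_{n,m}:=\frac{1}{nm}\sum_{i=1}^n\sum_{t=1}^m\Big(\mathbb{E}(z_{it}z_{it}'\varepsilon_{it}^2)+\sum_{\tau=1}^{m-1}\frac{m-\tau}{m}\mathbb{E}\big((z_{it}z_{i,t+\tau}'+z_{i,t+\tau}z_{it}')\varepsilon_{it}\varepsilon_{i,t+\tau}\big)\Big)$ (the variance of $\frac{1}{\sqrt{nm}}\sum_{i,t}z_{it}\varepsilon_{it}$). Assumption A1: (i) $x_{it},\varepsilon_{it}$ have moments of order $2r$ bounded uniformly in $i,t$, for some $r>2$; (ii) $x_{it}\varepsilon_{it}$ has moments of order $3r$ bounded uniformly in $i,t$; (iii) the variables are independent across $i$; (iv) for each $i$ the process $\{(x_{it},\varepsilon_{it})\}_t$ is stationary and strong mixing with mixing coefficients $a_i(h):=\sup_t\sup_{A\in\mathcal{A}_{it},B\in\mathcal{B}_{i,t+h}}|\mathbb{P}(A\cap B)-\mathbb{P}(A)\mathbb{P}(B)|$ satisfying $\sup_{1\le i\le n}a_i(h)=O(h^{-s})$ for some $s>4r/(r-2)$, where $\mathcal{A}_{it}$ and $\mathcal{B}_{it}$ are the sigma-algebras generated by $(x_{it},\varepsilon_{it}),(x_{i,t-1},\varepsilon_{i,t-1}),\dots$ and $(x_{it},\varepsilon_{it}),(x_{i,t+1},\varepsilon_{i,t+1}),\dots$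 respectively. Assumption A2: $\Sigma_{n,m}$ and $\Omega_{n,m}$ are uniformly (in $n,m$) positive definite. Assumption A3: $n,m\to\infty$ with $n/m\to c\in[0,\infty)$. *)

(* Defs.v *)
From HB Require Import structures.
From mathcomp Require Import all_boot all_order all_algebra.
From mathcomp Require Import all_classical all_reals all_analysis.
Set Implicit Arguments.
Unset Strict Implicit.
Unset Printing Implicit Defensive.
Import Order.TTheory GRing.Theory Num.Theory.
Import numFieldNormedType.Exports.

Local Open Scope classical_set_scope.
Local Open Scope ring_scope.

(* Conventions: individuals i = 1..n are represented by i = 0..n-1 and
   periods t = 1..m by t = 0..m-1.  Regressors are column vectors 'cV_K.
   The panel is an infinite array (x_{it}, eps_{it})_{i,t : nat} of random
   variables on one probability space; the sample of size (n,m) is the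
   sub-array i < n, t < m. *)

Section Panel.
Context {d : measure_display} {T : measurableType d} {R : realType}.
Variable (P : probability T R).

(* real-valued expectation (finite under the moment assumptions) *)
Definition Ex (X : T -> R) : R := fine ('E_P[X])%E.

Definition Evec (K : nat) (X : T -> 'cV[R]_K) : 'cV[R]_K :=
  \col_k Ex (fun w => X w k 0).

Definition Emat (K : nat) (M : T -> 'M[R]_K) : 'M[R]_K :=
  \matrix_(a, b) Ex (fun w => M w a b).

Variables (K : nat) (x : nat -> nat -> T -> 'cV[R]_K) (eps : nat -> nat -> T -> R).

Definition zc (i t : nat) (w : T) : 'cV[R]_K := x i t w - Evec (x i t).

Definition Sigma_nm (n m : nat) : 'M[R]_K :=
  ((n * m)%:R)^-1 *: \sum_(i < n) \sum_(t < m)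
     Emat (fun w => zc i t w *m (zc i t w)^T).

Definition Omega_nm (n m : nat) : 'M[R]_K :=
  ((n * m)%:R)^-1 *: \sum_(i < n) \sum_(t < m)
    ( Emat (fun w => (eps i t w ^+ 2) *: (zc i t w *m (zc i t w)^T))
    + \sum_(1 <= tau < m) (((m - tau)%:R / m%:R) *:
        Emat (fun w => (eps i t w * eps i (t + tau) w) *:
               (zc i t w *m (zc i (t + tau) w)^T
                + zc i (t + tau) w *m (zc i t w)^T)))).

Definition Upsilon_nm (n m : nat) : 'M[R]_K :=
  invmx (Sigma_nm n m) *m Omega_nm n m *m invmx (Sigma_nm n m).

(* b_{n,m}; by stationarity E(z_{it} eps_{i,t+tau}) does not depend on t,
   we evaluate it at the first period t = 0 (i.e. period 1). *)
Definition b_nm (n m : nat) : 'cV[R]_K :=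
  - ((n%:R)^-1 *: \sum_(i < n) \sum_(1 <= tau < m)
       (((m - tau)%:R / m%:R) *:
         (Evec (fun w => eps i tau w *: zc i 0 w)
          + Evec (fun w => eps i 0 w *: zc i tau w)))).

Definition yv (alpha : nat -> R) (beta : 'cV[R]_K) (i t : nat) (w : T) : R :=
  alpha i + ((x i t w)^T *m beta) 0 0 + eps i t w.

Definition xbar (m i : nat) (w : T) : 'cV[R]_K :=
  (m%:R)^-1 *: \sum_(t < m) x i t w.

Definition ybar alpha beta (m i : nat) (w : T) : R :=
  (m%:R)^-1 * \sum_(t < m) yv alpha beta i t w.

Definition betahat alpha beta (n m : nat) (w : T) : 'cV[R]_K :=
  invmx (\sum_(i < n) \sum_(t < m)
           ((x i t w - xbar m i w) *m (x i t w - xbar m i w)^T))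
  *m (\sum_(i < n) \sum_(t < m)
           ((yv alpha beta i t w - ybar alpha beta m i w) *: (x i t w - xbar m i w))).

Definition stat_nm alpha beta (n m : nat) (w : T) : 'cV[R]_K :=
  Num.sqrt ((n * m)%:R) *:
    (betahat alpha beta n m w - beta
     - (m%:R)^-1 *: (invmx (Sigma_nm n m) *m b_nm n m)).

Definition coordfuns (i t : nat) : set (T -> R) :=
  [set f | (exists k : 'I_K, f = fun w => x i t w k 0) \/ f = eps i t].

Definition gen_sigma (F : set (T -> R)) : set (set T) :=
  <<s [set A | exists f B, F f /\ measurable B /\ A = f @^-1` B] >>.

Definition sig_times (i : nat) (S : set nat) : set (set T) :=
  gen_sigma (\bigcup_(t in S) coordfuns i t).

Definition indep_across_i : Prop :=
  forall (s : seq nat) (A : nat -> set T), uniq s ->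
    (forall i, i \in s -> sig_times i setT (A i)) ->
    fine (P (\bigcap_(i in [set i | i \in s]) A i)) =
    \prod_(i <- s) fine (P (A i)).

Definition cyl (i t len : nat) (Bx : nat -> 'I_K -> set R) (Be : nat -> set R)
  : set T :=
  \bigcap_(j in [set j | (j < len)%N])
     [set w | (forall k, Bx j k (x i (t + j) w k 0)) /\ Be j (eps i (t + j) w)].

Definition stationary_i (i : nat) : Prop :=
  forall (len t : nat) (Bx : nat -> 'I_K -> set R) (Be : nat -> set R),
    (forall j k, measurable (Bx j k)) -> (forall j, measurable (Be j)) ->
    P (cyl i t len Bx Be) = P (cyl i 0 len Bx Be).

Definition strong_mixing_rate (s : R) : Prop :=
  exists C : R, forall (i t h : nat), (0 < h)%N ->
    forall A B, sig_times i [set u | (u <= t)%N] A ->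
                sig_times i [set u | (t + h <= u)%N] B ->
    `| fine (P (A `&` B)) - fine (P A) * fine (P B) | <= C * (h%:R `^ (- s)).

End Panel.

Section Gauss.
Context {R : realType}.

Fixpoint iter_int (K k : nat) (g : 'cV[R]_K -> R) (v : 'cV[R]_K) : R :=
  match k with
  | 0 => g v
  | k'.+1 => Rintegral (@lebesgue_measure R) setT
      (fun u : R => iter_int k' g (\col_j (if (j : nat) == k' then u else v j 0)))
  end.

(* density of N(0, U) on R^K (U positive definite) *)
Definition gauss_density (K : nat) (U : 'M[R]_K) (y : 'cV[R]_K) : R :=
  expR (- ((y^T *m invmx U *m y) 0 0) / 2)
  / Num.sqrt ((2 * pi) ^+ K * \det U).

Definition normal_expect (K : nat) (U : 'M[R]_K) (f : 'cV[R]_K -> R) : R :=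
  iter_int K (fun y => f y * gauss_density U y) 0.

Definition conv_law_normal {d} {T : measurableType d} (P : probability T R)
  (K : nat) (S : nat -> T -> 'cV[R]_K) (U : 'M[R]_K) : Prop :=
  forall f : 'cV[R]_K -> R, continuous f -> (exists M, forall v, `|f v| <= M) ->
    (fun k => Ex P (f \o S k)) @ \oo --> normal_expect U f.

End Gauss.

(* Main.v *)
(** With z = x - E x, the estimation error satisfies
      sqrt(nm) (betahat - beta) = D^-1 (V + kappa b + rho),   kappa = sqrt(n/m),
    where V = (nm)^(-1/2) sum z eps, D is the normalized within-group design matrix, b = b_{n,m}, and rho collects
    the centred products zbar_i epsbar_i. Mixing and the moment bounds make fourth moments of partial sums over t of
    z, eps and z eps of order m^2; together with independence across i this gives E rho^2 = O(1/m) and D - Sigma -> 0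
    in probability, so the statistic is asymptotically Sigma^-1 V. A swapping argument across individuals,
    carried out on the functions cos(th + a.y), shows E cos(th + a.Sigma^-1 V) -> exp(- a U a^T / 2) cos th.
    These functions determine convergence in law: Bernstein polynomials in the variables (1 + sin(pi y_j / 2L)) / 2
    approximate a bounded continuous function by trigonometric polynomials uniformly on boxes. *)

Require Import Defs.
From HB Require Import structures.
From mathcomp Require Import all_boot all_order all_algebra.
From mathcomp Require Import all_classical all_reals all_analysis.
From mathcomp Require Import ring lra zify measurable_realfun.
Set Implicit Arguments.
Unset Strict Implicit.
Unset Printing Implicit Defensive.
Import Order.TTheory GRing.Theory Num.Theory.
Import numFieldNormedType.Exports.
Local Open Scope classical_set_scope.
Local Open Scope ring_scope.

(** * Expectations *)

(** The sample sizes grow jointly and only [Upsilon_nm] is assumed to converge, not [Sigma_nm] and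
    [Omega_nm] separately. Hence the estimates carry explicit rates in n and m with constants
    uniform over individuals, and the central limit estimate is uniform over bounded coefficient
    vectors v, so that it applies with v = a Sigma^-1, which varies with the sample size. The
    condition s > 4r/(r-2) is consumed by the fourth moments: splitting one factor from the three
    others uses the moment exponents 2r and 2r/3, which turns the mixing rate h^-s into
    h^(-s(r-2)/r), at least as good as h^-4. This is the square of h^-2, so each of the two outer
    gaps among four sorted times receives a summable weight. A bound on n/m keeps kappa b bounded;
    it is multiplied by D^-1 - Sigma^-1, which merely tends to 0 in probability. The functions
    cos(th + a.y) play the role of characteristic functions: a phase shift by pi/2 produces the
    sines, so one real family is closed under the addition formula. *)

Section Expectation.
Context {d : measure_display} {T : measurableType d} {R : realType}.
Variable P : probability T R.
Implicit Types X Y : T -> R.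

Definition ig X := P.-integrable setT (EFin \o X).

Lemma ExE X : Ex P X = \int[P]_w X w.
Proof. by rewrite /Ex unlock. Qed.

Lemma ig_meas X : ig X -> measurable_fun setT X.
Proof. by move=> /measurable_int /measurable_EFinP. Qed.

Lemma ig_cst c : ig (fun=> c).
Proof. exact: finite_measure_integrable_cst. Qed.

Lemma igD X Y : ig X -> ig Y -> ig (fun w => X w + Y w).
Proof. by move=> iX iY; exact: (integrableD measurableT iX iY). Qed.

Lemma igN X : ig X -> ig (fun w => - X w).
Proof. by move=> iX; exact: (integrableN iX). Qed.

Lemma igB X Y : ig X -> ig Y -> ig (fun w => X w - Y w).
Proof. by move=> iX iY; apply: igD => //; apply: igN. Qed.

Lemma igZ k X : ig X -> ig (fun w => k * X w).
Proof. by move=> iX; exact: (integrableZl measurableT k iX). Qed.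

Lemma igZr k X : ig X -> ig (fun w => X w * k).
Proof. by move=> iX; under eq_fun do rewrite mulrC; exact: igZ. Qed.

Lemma ig_sum I (s : seq I) (Q : pred I) (X : I -> T -> R) :
  (forall i, Q i -> ig (X i)) -> ig (fun w => \sum_(i <- s | Q i) X i w).
Proof.
move=> iX; have := integrable_sum measurableT s iX.
by rewrite /ig /comp; under [X in _ -> P.-integrable _ X]eq_fun do rewrite -sumEFin.
Qed.

Lemma ig_norm X : ig X -> ig (fun w => `|X w|).
Proof. by move=> iX; apply: integrable_norm. Qed.

Lemma ig_le X Y : measurable_fun setT X -> ig Y -> (forall w, `|X w| <= Y w) ->
  ig X.
Proof.
move=> mX iY XY; apply: le_integrable iY => //; first exact/measurable_EFinP.
by move=> w _; rewrite /= lee_fin (le_trans (XY w))// ler_norm.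
Qed.

Lemma ig_bd X M : measurable_fun setT X -> (forall w, `|X w| <= M) -> ig X.
Proof. by move=> mX XM; apply: ig_le XM => //; exact: ig_cst. Qed.

(** [Ex] applies [fine], which sends an infinite expectation to 0, so a bound on [Ex] alone proves
    nothing about integrability. The moment assumptions bound ['E_P[_]] itself; this converts them
    into integrability together with a bound on [Ex]. *)
Lemma ig_fin X C : measurable_fun setT X -> (forall w, 0 <= X w) ->
  ('E_P[X] <= C%:E)%E -> ig X /\ Ex P X <= C.
Proof.
move=> mX X0; rewrite unlock => XC.
have iX : ig X.
  apply/integrableP; split; first exact/measurable_EFinP.
  apply: le_lt_trans (ltry C); apply: le_trans XC.
  by under eq_integral do rewrite /= ger0_norm //.
split=> //; rewrite ExE -lee_fin /Rintegral fineK //.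
exact: integrable_fin_num.
Qed.

Lemma Ex_cst c : Ex P (fun=> c) = c.
Proof. by rewrite /Ex expectation_cst. Qed.

Lemma ExD X Y : ig X -> ig Y -> Ex P (fun w => X w + Y w) = Ex P X + Ex P Y.
Proof. by move=> iX iY; rewrite !ExE RintegralD. Qed.

Lemma ExB X Y : ig X -> ig Y -> Ex P (fun w => X w - Y w) = Ex P X - Ex P Y.
Proof. by move=> iX iY; rewrite !ExE RintegralB. Qed.

Lemma ExZ k X : ig X -> Ex P (fun w => k * X w) = k * Ex P X.
Proof. by move=> iX; rewrite !ExE RintegralZl. Qed.

Lemma ExZr k X : ig X -> Ex P (fun w => X w * k) = Ex P X * k.
Proof. by move=> iX; rewrite !ExE RintegralZr. Qed.

Lemma Ex_sum I (s : seq I) (Q : pred I) (X : I -> T -> R) :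
  (forall i, Q i -> ig (X i)) ->
  Ex P (fun w => \sum_(i <- s | Q i) X i w) = \sum_(i <- s | Q i) Ex P (X i).
Proof.
move=> iX; elim: s => [|i s IH].
  by rewrite big_nil -[RHS](Ex_cst 0); congr (Ex P _); apply/funext => w; rewrite big_nil.
rewrite big_cons; case: ifPn => Qi.
  rewrite -IH -ExD//; [|exact: iX|exact: ig_sum].
  by congr (Ex P _); apply/funext => w; rewrite big_cons Qi.
by rewrite -IH; congr (Ex P _); apply/funext => w; rewrite big_cons (negbTE Qi).
Qed.

Lemma Ex_le X Y : ig X -> ig Y -> (forall w, X w <= Y w) -> Ex P X <= Ex P Y.
Proof. by move=> iX iY XY; rewrite !ExE le_Rintegral. Qed.

Lemma Ex_ge0 X : (forall w, 0 <= X w) -> 0 <= Ex P X.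
Proof. by move=> X0; rewrite ExE Rintegral_ge0. Qed.

Lemma Ex_norm X : ig X -> `|Ex P X| <= Ex P (fun w => `|X w|).
Proof. by move=> iX; rewrite !ExE le_normr_Rintegral. Qed.

Lemma Ex_norm_le X Y : ig X -> ig Y -> (forall w, `|X w| <= Y w) ->
  `|Ex P X| <= Ex P Y.
Proof.
move=> iX iY XY; apply: (le_trans (Ex_norm iX)); apply: Ex_le => //.
exact: ig_norm.
Qed.

Lemma Ex_bd X M : measurable_fun setT X -> (forall w, `|X w| <= M) ->
  `|Ex P X| <= M.
Proof.
move=> mX XM; rewrite -[M]Ex_cst; apply: Ex_norm_le => //; last exact: ig_cst.
exact: ig_bd XM.
Qed.

Lemma Ex_dct (X : nat -> T -> R) X0 Y : (forall n, measurable_fun setT (X n)) ->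
  ig Y -> (forall n w, `|X n w| <= Y w) ->
  (forall w, X n w @[n --> \oo] --> X0 w) ->
  measurable_fun setT X0 -> Ex P (X n) @[n --> \oo] --> Ex P X0.
Proof.
move=> mX iY XY cX mX0.
have iX n : ig (X n) by apply: ig_le (XY n).
have XY0 w : `|X0 w| <= Y w.
  have h : `|X n w| @[n --> \oo] --> `|X0 w| by apply: cvg_norm; exact: cX.
  rewrite -(cvg_lim _ h)//; apply: limr_le; first by apply/cvg_ex; eexists; exact: h.
  by apply: nearW => n; exact: XY.
have iX0 : ig X0 by apply: ig_le XY0.
under eq_fun do rewrite ExE.
rewrite ExE; apply: fine_cvg; rewrite fineK; last exact: integrable_fin_num.
apply: (@dominated_cvg _ _ _ P setT measurableT (fun n w => (X n w)%:E) _ (EFin \o Y)) => //=.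
- by move=> n; exact/measurable_EFinP.
- by move=> w _; apply: cvg_EFin; [exact: nearW | exact: cX].
- by move=> n w _; rewrite lee_fin XY.
Qed.

Definition prb (A : set T) : R := fine (P A).

Lemma Ex_indic (A : set T) : measurable A -> Ex P (\1_A) = prb A.
Proof. by move=> mA; rewrite /Ex expectation_indic. Qed.

Lemma ig_indic (A : set T) : measurable A -> ig (\1_A).
Proof. by move=> mA; exact: integrable_indic. Qed.

Lemma prb_ge0 A : 0 <= prb A.
Proof. exact: fine_ge0. Qed.

Lemma prb_le A B : measurable A -> measurable B -> A `<=` B -> prb A <= prb B.
Proof.
move=> mA mB AB; rewrite fine_le// ?fin_num_measure//.
by rewrite le_measure// inE.
Qed.

Lemma prb_U A B : measurable A -> measurable B -> prb (A `|` B) <= prb A + prb B.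
Proof.
move=> mA mB; rewrite -fineD ?fin_num_measure// fine_le ?fin_num_measure//.
- exact: measurableU.
- by rewrite fin_numD !fin_num_measure.
- by rewrite measureU2.
Qed.

Lemma markov_prb X a : 0 < a -> ig X -> (forall w, 0 <= X w) ->
  prb [set w | a <= X w] <= Ex P X / a.
Proof.
move=> a0 iX X0.
have mA : measurable [set w | a <= X w].
  rewrite -[X in measurable X]setTI; apply: measurable_fun_le => //.
  exact: ig_meas iX.
rewrite ler_pdivlMr// mulrC -Ex_indic// -ExZ; last exact: ig_indic.
apply: Ex_le => // [|w]; first by apply: igZ; exact: ig_indic.
by rewrite indicE; case: (boolP (w \in _)) => [|_]; rewrite ?mulr1 ?mulr0 ?inE.
Qed.

End Expectation.

(** * Covariances under mixing of super-level sets *)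

Section Clip.
Context {R : realType}.
Implicit Types (A x y : R).

Definition clip A x := Num.max (- A) (Num.min x A).

Lemma clip_bd A x : 0 <= A -> `|clip A x| <= A.
Proof.
move=> A0; rewrite /clip ler_norml; apply/andP; split; first by rewrite le_max lexx.
by rewrite ge_max ge_min lexx orbT andbT; lra.
Qed.

Lemma clip_id A x : `|x| <= A -> clip A x = x.
Proof.
by rewrite ler_norml /clip => /andP[h1 h2]; rewrite min_l// max_r.
Qed.

Lemma clip_norm A x : 0 <= A -> `|clip A x| <= `|x|.
Proof.
move=> A0; have [xA|xA] := leP `|x| A; first by rewrite clip_id.
by apply: le_trans (ltW xA); exact: clip_bd.
Qed.

Lemma clip_sub A x : 0 <= A -> `|x - clip A x| <= `|x|.
Proof.
move=> A0; have [xA|xA] := leP `|x| A; first by rewrite clip_id// subrr normr0.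
have [x0|x0] := leP 0 x.
  rewrite ger0_norm // in xA; rewrite /clip min_r; last exact: ltW.
  rewrite max_r; last lra.
  rewrite !ger0_norm; lra.
rewrite ltr0_norm // in xA; rewrite /clip min_l; last lra.
rewrite max_l; last lra.
rewrite !ler0_norm; lra.
Qed.

(** Clipping multiplies by a factor in [0, 1], so the difference equals (1 - s t) x y with s and t
    in [0, 1]. The triangle inequality would cost a factor 2. *)
Lemma clipM_sub A (B : R) x y : 0 <= A -> 0 <= B ->
  `|x * y - clip A x * clip B y| <= `|x| * `|y|.
Proof.
move=> A0 B0.
have aux C z : 0 <= C -> exists2 s, 0 <= s <= 1 & clip C z = s * z.
  move=> C0; have [zC|zC] := leP `|z| C.
    by exists 1; rewrite ?ler01 ?lexx// mul1r clip_id.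
  have z0 : z != 0 by apply: contraTneq zC => ->; rewrite normr0 -leNgt.
  exists (C / `|z|).
    rewrite divr_ge0//= ler_pdivrMr ?normr_gt0// mul1r; exact: ltW.
  have [z1|z1] := leP 0 z.
    rewrite ger0_norm // in zC *; rewrite /clip min_r; last exact: ltW.
    rewrite max_r; last lra.
    by rewrite divfK.
  rewrite ltr0_norm // in zC *; rewrite /clip min_l; last lra.
  rewrite max_l; last lra.
  by field.
have [s /andP[s0 s1] ->] := aux A x A0; have [t /andP[t0 t1] ->] := aux B y B0.
rewrite (_ : x * y - _ = (1 - s * t) * (x * y)); last by ring.
rewrite normrM [`|x * y|]normrM ler_piMl ?mulr_ge0// ger0_norm.
  by rewrite gerBl mulr_ge0.
by rewrite subr_ge0 mulr_ile1.
Qed.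

(** The sum counts the integers j in [0, N) with j < y: it is [y] clipped to [0, N] and rounded
    up. *)
Lemma sum_step (N : nat) y :
  Num.max 0 (Num.min y N%:R) <= \sum_(j < N) ((j%:R < y)%R)%:R <= Num.max 0 (Num.min y N%:R) + 1.
Proof.
elim: N => [|N /andP[IH1 IH2]].
  rewrite big_ord0; apply/andP; split; first by rewrite ge_max lexx ge_min lexx orbT.
  by apply: addr_ge0 => //; rewrite le_max lexx.
rewrite big_ord_recr/=.
have [yN|yN] := leP y N%:R.
  rewrite addr0.
  have yN1 : y <= N.+1%:R by rewrite (le_trans yN)// ler_nat.
  by move: IH1 IH2; rewrite !min_l// => -> ->.
have -> : \sum_(j < N) ((j%:R < y)%R)%:R = N%:R :> R.
  rewrite (eq_bigr (fun=> 1)) ?sumr_const ?card_ord// => j _.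
  by rewrite (lt_trans _ yN)// ltr_nat.
rewrite -natr1 /= mulr1n.
have N0 : 0 <= N%:R :> R by [].
case: (leP y (N%:R + 1)) => h; rewrite max_r; try lra; apply/andP; split; lra.
Qed.

(* A staircase approximation of [clip A] which is an affine combination of indicators of super-level sets. *)
Definition disc A (N : nat) x :=
  - A + (2 * A / N%:R) * \sum_(j < N) (((- A + 2 * A / N%:R * j%:R < x)%R)%:R : R).

Lemma disc_clip A N x : 0 < A -> (0 < N)%N ->
  `|disc A N x| <= A /\ `|disc A N x - clip A x| <= 2 * A / N%:R.
Proof.
move=> A0 N0; have N1 : 0 < N%:R :> R by rewrite ltr0n.
set e := 2 * A / N%:R; have e0 : 0 < e by rewrite /e divr_gt0 ?mulr_gt0.
have eN : e * N%:R = 2 * A by rewrite /e; field; lra.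
(* Height of [x] above [- A] in units of the step [e]. Clipping [x] to [-A, A] is clipping [y] to
   [0, N], and the staircase rounds the result up. *)
pose y := (x + A) / e.
have -> : disc A N x = - A + e * \sum_(j < N) ((j%:R < y)%R)%:R.
  congr (_ + _ * _); apply: eq_bigr => j _; congr (nat_of_bool _)%:R.
  by rewrite /y ltr_pdivlMr// [in RHS]mulrC -/e; apply/idP/idP; lra.
have h0 : 0 <= \sum_(j < N) ((j%:R < y)%R)%:R :> R by apply: sumr_ge0.
have hN : \sum_(j < N) ((j%:R < y)%R)%:R <= N%:R :> R.
  rewrite (le_trans (ler_sum _ (G := fun=> 1) _))//.
    by move=> j _; case: (_ < _).
  by rewrite sumr_const card_ord.
have /andP[] := sum_step N y.
set S := \sum_(j < N) _ in h0 hN *; move=> h1 h2.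
have c : clip A x = - A + e * Num.max 0 (Num.min y N%:R).
  rewrite maxr_pMr ?ltW// mulr0 minr_pMr ?ltW// eN /y mulrC divfK ?gt_eqF//.
  rewrite /clip; case: (leP x A) => h3; case: (leP (x + A) (2 * A)) => h4; try lra.
    by case: (leP (-A) x) => h5; case: (leP 0 (x + A)) => h6; lra.
  rewrite !max_r; lra.
have eS0 : 0 <= e * S by rewrite mulr_ge0// ltW.
have eSN : e * S <= 2 * A by rewrite -eN ler_wpM2l// ltW.
split; first by rewrite ler_norml; apply/andP; split; lra.
rewrite c.
have := ler_wpM2l (ltW e0) h1; have := ler_wpM2l (ltW e0) h2.
rewrite mulrDr mulr1 => h3 h4.
rewrite ler_norml; apply/andP; split; lra.
Qed.

End Clip.

(** * A Young-type inequality for real powers *)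

Section PowR.
Context {R : realType}.
Implicit Types (a b p q : R).

Lemma powR_ge1 a p : 1 <= a -> 1 <= p -> a <= a `^ p.
Proof.
by move=> a1 p1; rewrite -{1}[a]powRr1 ?(le_trans ler01)// ler_powR.
Qed.

(** The condition p + q <= p q says 1/p + 1/q <= 1. Outside the unit square no constants are needed:
    if both numbers exceed 1, either a <= b^(q-1), so a b <= b^q, or b <= a^(1/(q-1)), so a b <=
    a^(q/(q-1)) <= a^p. *)
Lemma young_off p q a b : 1 < p -> 1 < q -> p + q <= p * q -> 0 <= a -> 0 <= b ->
  1 < a \/ 1 < b -> a * b <= a `^ p + b `^ q.
Proof.
move=> p1 q1 pq a0 b0 ab.
have ap := powR_ge0 a p; have bq := powR_ge0 b q.
have [a1|a1] := leP a 1.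
  have b1 : 1 < b by case: ab => //; rewrite ltNge a1.
  have := powR_ge1 (ltW b1) (ltW q1).
  have : a * b <= 1 * b by rewrite ler_wpM2r.
  lra.
have [b1|b1] := leP b 1.
  have := powR_ge1 (ltW a1) (ltW p1).
  have : a * b <= a * 1 by rewrite ler_wpM2l.
  lra.
have [h|h] := leP a (b `^ (q - 1)).
  have : a * b <= b `^ q.
    rewrite (_ : b `^ q = b `^ (q - 1) * b); first by rewrite ler_wpM2r.
    by rewrite -{3}[b]powRr1// -powRD ?subrK// (gt_eqF (lt_trans ltr01 b1)) implybT.
  lra.
have : a * b <= a `^ p.
  have q10 : 0 < q - 1 by lra.
  have bE : b = (b `^ (q - 1)) `^ (q - 1)^-1.
    by rewrite -powRrM divff ?gt_eqF// powRr1.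
  have hb : b <= a `^ (q - 1)^-1.
    rewrite {1}bE ge0_ler_powR ?invr_ge0 ?nnegrE ?powR_ge0//; [exact: ltW|exact: ltW].
  apply: (@le_trans _ _ (a * a `^ (q - 1)^-1)).
    by rewrite ler_wpM2l.
  rewrite -{1}[a]powRr1// -powRD ?(gt_eqF (lt_trans ltr01 a1)) ?implybT//.
  apply: ler_powR; first exact: ltW.
  rewrite -(ler_pM2r q10) mulrDl mulVf ?gt_eqF// mul1r.
  nra.
lra.
Qed.

End PowR.

(** * Covariances of clipped variables and independence *)

Section Covariance.
Context {d : measure_display} {T : measurableType d} {R : realType}.
Variable P : probability T R.
Implicit Types X Y : T -> R.

Definition levset X a := [set w | a < X w].

(* Covariances only see the mixing coefficients through super-level sets; [al = 0] means independence. *)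
Definition level_mix X Y (al : R) := forall a b,
  `|prb P (levset X a `&` levset Y b) - prb P (levset X a) * prb P (levset Y b)| <= al.

Lemma levset_meas X a : measurable_fun setT X -> measurable (levset X a).
Proof.
move=> mX; rewrite -[levset _ _]setTI.
rewrite (_ : levset X a = X @^-1` `]a, +oo[); first by apply: mX => //.
by apply/seteqP; split=> w /=; rewrite in_itv/= andbT.
Qed.

Lemma clip_meas A X : measurable_fun setT X -> measurable_fun setT (fun w => clip A (X w)).
Proof.
move=> mX.
exact: (measurable_maxr (measurable_cst _) (measurable_minr mX (measurable_cst _))).
Qed.

Lemma disc_indic A N X : (fun w => disc A N (X w)) =
  fun w => - A + (2 * A / N%:R) * \sum_(j < N) \1_(levset X (- A + 2 * A / N%:R * j%:R)) w.
Proof.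
apply/funext => w; rewrite /disc; congr (_ + _ * _); apply: eq_bigr => j _.
rewrite indicE; congr (nat_of_bool _)%:R.
by apply/idP/idP => [h|]; rewrite ?inE// => /set_mem.
Qed.

Lemma ig_sum_indic N (F : 'I_N -> set T) : (forall j, measurable (F j)) ->
  ig P (fun w => \sum_(j < N) (\1_(F j) w : R)).
Proof. by move=> mF; apply: ig_sum => j _; exact: ig_indic. Qed.

(** Additive constants drop out of a covariance, which leaves e f times a sum over N^2 pairs of
    levels, each at most [al]. Since e = 2 A / N and f = 2 B / N, the bound 4 A B [al] does not
    depend on N. *)
Lemma cov_disc X Y al (A B : R) N : measurable_fun setT X -> measurable_fun setT Y ->
  level_mix X Y al -> 0 < A -> 0 < B -> (0 < N)%N ->
  `|Ex P (fun w => disc A N (X w) * disc B N (Y w))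
    - Ex P (fun w => disc A N (X w)) * Ex P (fun w => disc B N (Y w))| <= 4 * A * B * al.
Proof.
move=> mX mY XYal A0 B0 N0.
have N1 : 0 < N%:R :> R by rewrite ltr0n.
rewrite (disc_indic A N X) (disc_indic B N Y).
rewrite (_ : (fun w => disc A N (X w) * _) = fun w =>
  (- A + (2 * A / N%:R) * \sum_(j < N) \1_(levset X (- A + 2 * A / N%:R * j%:R)) w) *
  (- B + (2 * B / N%:R) * \sum_(j < N) \1_(levset Y (- B + 2 * B / N%:R * j%:R)) w)); last first.
  by apply/funext => w; congr (_ * _); [have /(congr1 (@^~ w)) := disc_indic A N X|
    have /(congr1 (@^~ w)) := disc_indic B N Y].
set e := 2 * A / N%:R; set f := 2 * B / N%:R.
have e0 : 0 < e by rewrite divr_gt0 ?mulr_gt0.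
have f0 : 0 < f by rewrite divr_gt0 ?mulr_gt0.
pose F (j : 'I_N) := levset X (- A + e * j%:R).
pose G (j : 'I_N) := levset Y (- B + f * j%:R).
have mF j : measurable (F j) by exact: levset_meas.
have mG j : measurable (G j) by exact: levset_meas.
pose S w := \sum_(j < N) (\1_(F j) w : R).
pose U w := \sum_(j < N) (\1_(G j) w : R).
have iS : ig P S by exact: ig_sum_indic.
have iU : ig P U by exact: ig_sum_indic.
have SUE w : S w * U w = \sum_(j < N) \sum_(k < N) \1_(F j `&` G k) w.
  rewrite mulr_suml; apply: eq_bigr => j _; rewrite mulr_sumr; apply: eq_bigr => k _.
  by rewrite indicI.
have iSU : ig P (fun w => S w * U w).
  under eq_fun do rewrite SUE.
  by apply: ig_sum => j _; apply: ig_sum_indic => k; exact: measurableI.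
have ESU : Ex P (fun w => S w * U w) = \sum_(j < N) \sum_(k < N) prb P (F j `&` G k).
  under eq_fun do rewrite SUE.
  rewrite Ex_sum => [|j _]; last by apply: ig_sum_indic => k; exact: measurableI.
  apply: eq_bigr => j _; rewrite Ex_sum => [|k _]; last exact/ig_indic/measurableI.
  by apply: eq_bigr => k _; rewrite Ex_indic//; exact: measurableI.
have ES : Ex P S = \sum_(j < N) prb P (F j).
  by rewrite Ex_sum => [|j _]; [apply: eq_bigr => j _; rewrite Ex_indic|exact: ig_indic].
have EU : Ex P U = \sum_(j < N) prb P (G j).
  by rewrite Ex_sum => [|j _]; [apply: eq_bigr => j _; rewrite Ex_indic|exact: ig_indic].
have -> : Ex P (fun w => (- A + e * S w) * (- B + f * U w)) =
  A * B - A * f * Ex P U - B * e * Ex P S + e * f * Ex P (fun w => S w * U w).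
  rewrite (_ : (fun w => (- A + e * S w) * (- B + f * U w)) = fun w =>
     ((A * B - A * f * U w) - B * e * S w) + e * f * (S w * U w)).
    rewrite ExD ?ExB ?ExZ ?Ex_cst//; try exact: ig_cst; try exact: igZ.
    - by apply: igB; [exact: ig_cst|exact: igZ].
    - by apply: igB; [apply: igB; [exact: ig_cst|exact: igZ]|exact: igZ].
  by apply/funext => w; ring.
have -> : Ex P (fun w => - A + e * S w) = - A + e * Ex P S.
  by rewrite ExD ?ExZ ?Ex_cst//; [exact: ig_cst|exact: igZ].
have -> : Ex P (fun w => - B + f * U w) = - B + f * Ex P U.
  by rewrite ExD ?ExZ ?Ex_cst//; [exact: ig_cst|exact: igZ].
rewrite (_ : _ - _ = e * f * (Ex P (fun w => S w * U w) - Ex P S * Ex P U)); last by ring.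
rewrite ESU ES EU mulr_suml -sumrB normrM ger0_norm; last by rewrite mulr_ge0// ltW.
have -> : 4 * A * B * al = e * f * (\sum_(j < N) \sum_(k < N) al).
  rewrite !sumr_const !card_ord -[_ *+ N *+ N]mulr_natr -[_ *+ N]mulr_natr /e /f.
  by field; lra.
apply: ler_wpM2l; first by rewrite mulr_ge0// ltW.
apply: le_trans (ler_norm_sum _ _ _) _; apply: ler_sum => j _.
rewrite mulr_sumr -sumrB.
apply: le_trans (ler_norm_sum _ _ _) _; apply: ler_sum => k _.
exact: XYal.
Qed.

Lemma disc_meas A N X : measurable_fun setT X ->
  measurable_fun setT (fun w => disc A N (X w)).
Proof.
move=> mX; rewrite disc_indic.
apply: (@ig_meas _ _ _ P); apply: igD; first exact: ig_cst.
by apply: igZ; apply: ig_sum_indic => j; exact: levset_meas.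
Qed.

Lemma cov_clip X Y al (A B : R) : measurable_fun setT X -> measurable_fun setT Y ->
  level_mix X Y al -> 0 < A -> 0 < B ->
  `|Ex P (fun w => clip A (X w) * clip B (Y w))
    - Ex P (fun w => clip A (X w)) * Ex P (fun w => clip B (Y w))| <= 4 * A * B * al.
Proof.
move=> mX mY XYal A0 B0.
(* Replacing the staircases by the clipped functions costs A f + e B = 4 A B / N in the mean of the
   product and the same in the product of the means, hence 8 A B / N; then N is arbitrary. *)
have key (N : nat) : (0 < N)%N ->
  `|Ex P (fun w => clip A (X w) * clip B (Y w))
    - Ex P (fun w => clip A (X w)) * Ex P (fun w => clip B (Y w))| <=
  4 * A * B * al + 8 * A * B * N%:R^-1.
  move=> N0; have N1 : 0 < N%:R :> R by rewrite ltr0n.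
  have := cov_disc mX mY XYal A0 B0 N0.
  set D := fun w => disc A N (X w); set D' := fun w => disc B N (Y w).
  set C := fun w => clip A (X w); set C' := fun w => clip B (Y w).
  have mD : measurable_fun setT D by exact: disc_meas.
  have mD' : measurable_fun setT D' by exact: disc_meas.
  have mC : measurable_fun setT C by exact: clip_meas.
  have mC' : measurable_fun setT C' by exact: clip_meas.
  have bD w : `|D w| <= A by have [] := disc_clip (X w) A0 N0.
  have bD' w : `|D' w| <= B by have [] := disc_clip (Y w) B0 N0.
  have bC w : `|C w| <= A by exact/clip_bd/ltW.
  have bC' w : `|C' w| <= B by exact/clip_bd/ltW.
  set e := 2 * A * N%:R^-1; set f := 2 * B * N%:R^-1.
  have e0 : 0 < e by rewrite divr_gt0 ?mulr_gt0.
  have f0 : 0 < f by rewrite divr_gt0 ?mulr_gt0.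
  have dD w : `|D w - C w| <= e by have [] := disc_clip (X w) A0 N0.
  have dD' w : `|D' w - C' w| <= f by have [] := disc_clip (Y w) B0 N0.
  have prodbd u v u' v' : `|u| <= A -> `|v'| <= B -> `|u - u'| <= e -> `|v - v'| <= f ->
    `|u * v - u' * v'| <= A * f + e * B.
    move=> hu hv huu hvv; rewrite (_ : _ - _ = u * (v - v') + (u - u') * v'); last by ring.
    apply: le_trans (ler_normD _ _) _; rewrite !normrM; apply: lerD; exact: ler_pM.
  have iDD : ig P (fun w => D w * D' w).
    apply: (@ig_bd _ _ _ _ _ (A * B)); first exact: measurable_funM.
    by move=> w; rewrite normrM ler_pM.
  have iCC : ig P (fun w => C w * C' w).
    apply: (@ig_bd _ _ _ _ _ (A * B)); first exact: measurable_funM.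
    by move=> w; rewrite normrM ler_pM.
  have h1 : `|Ex P (fun w => D w * D' w) - Ex P (fun w => C w * C' w)| <= A * f + e * B.
    rewrite -ExB//; apply: Ex_bd => [|w]; last exact: prodbd.
    by apply: measurable_funB; exact: measurable_funM.
  have h2 : `|Ex P D * Ex P D' - Ex P C * Ex P C'| <= A * f + e * B.
    apply: prodbd; [exact: Ex_bd|exact: Ex_bd| |].
      rewrite -ExB; [|exact: ig_bd bD|exact: ig_bd bC].
      by apply: Ex_bd => //; exact: measurable_funB.
    rewrite -ExB; [|exact: ig_bd bD'|exact: ig_bd bC'].
    by apply: Ex_bd => //; exact: measurable_funB.
  have E8 : 8 * A * B * N%:R^-1 = (A * f + e * B) + (A * f + e * B).
    by rewrite /e /f; field; lra.
  rewrite E8; clearbody e f.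
  move: h1 h2; rewrite !ler_norml => /andP[h1 h1'] /andP[h2 h2'] /andP[h3 h3'].
  apply/andP; split; lra.
apply/ler_addgt0Pr => eps eps0.
have [N hN] : exists N : nat, 8 * A * B * N.+1%:R^-1 <= eps.
  have [N _ hN] := near_infty_natSinv_lt (PosNum (divr_gt0 eps0 (mulr_gt0 (mulr_gt0 (ltr0Sn R 7) A0) B0))).
  exists N; have := hN N (leqnn _); rewrite /= ltr_pdivlMr ?mulr_gt0// => h.
  by rewrite mulrC; exact: ltW.
by apply: le_trans (key N.+1 _) _; rewrite // lerD2l.
Qed.

Lemma indep_bd X Y (A B : R) : measurable_fun setT X -> measurable_fun setT Y ->
  level_mix X Y 0 -> (forall w, `|X w| <= A) -> (forall w, `|Y w| <= B) ->
  Ex P (fun w => X w * Y w) = Ex P X * Ex P Y.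
Proof.
move=> mX mY XY XA YB.
(* [cov_clip] wants positive levels, and any level above the bound makes clipping the identity. *)
have A1 : 0 < Num.max A 1 by rewrite lt_max ltr01 orbT.
have B1 : 0 < Num.max B 1 by rewrite lt_max ltr01 orbT.
have := cov_clip mX mY XY A1 B1; rewrite mulr0 normr_le0 subr_eq0 => /eqP.
under eq_fun => w do rewrite !clip_id ?le_max ?XA ?YB//.
move=> ->; congr (Ex P _ * Ex P _); apply/funext => w.
  by rewrite clip_id// le_max XA.
by rewrite clip_id// le_max YB.
Qed.

(** At [al = 0] the clipped variables factor exactly for every level; dominated convergence removes
    the clipping, with 1 + X^2, 1 + Y^2 and X^2 + Y^2 as dominating functions. *)
Lemma indep_L2 X Y : measurable_fun setT X -> measurable_fun setT Y ->
  level_mix X Y 0 -> ig P (fun w => X w ^+ 2) -> ig P (fun w => Y w ^+ 2) ->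
  Ex P (fun w => X w * Y w) = Ex P X * Ex P Y.
Proof.
move=> mX mY XY iX iY.
have cv (x : R) : clip n.+1%:R x @[n --> \oo] --> x.
  apply: cvg_near_cst; near=> n; rewrite clip_id//.
  near: n; exists (Num.truncn `|x|) => // n /= hn.
  by apply: le_trans (ltW (truncnS_gt _)) _; rewrite ler_nat ltnS.
have sqb (Z : T -> R) w : `|Z w| <= 1 + Z w ^+ 2.
  have := sqr_ge0 (`|Z w| - 1); rewrite sqrrB real_normK ?num_real//; have := normr_ge0 (Z w); lra.
have i1 (Z : T -> R) : ig P (fun w => Z w ^+ 2) -> ig P (fun w => 1 + Z w ^+ 2).
  by move=> iZ; apply: igD => //; exact: ig_cst.
have cE (Z : T -> R) : measurable_fun setT Z -> ig P (fun w => Z w ^+ 2) ->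
    Ex P (fun w => clip n.+1%:R (Z w)) @[n --> \oo] --> Ex P Z.
  move=> mZ iZ; apply: (@Ex_dct _ _ _ _ _ _ _ _ (i1 _ iZ)) => //.
  - by move=> n; exact: clip_meas.
  - by move=> n w; apply: le_trans (sqb Z w); exact: clip_norm.
have c1 : Ex P (fun w => clip n.+1%:R (X w) * clip n.+1%:R (Y w)) @[n --> \oo] -->
    Ex P (fun w => X w * Y w).
  apply: (@Ex_dct _ _ _ _ _ _ _ _ (igD iX iY)) => //.
  - by move=> n; apply: measurable_funM; exact: clip_meas.
  - move=> n w; rewrite normrM.
    apply: (@le_trans _ _ (`|X w| * `|Y w|)); first by rewrite ler_pM ?clip_norm.
    have := sqr_ge0 (`|X w| - `|Y w|); rewrite sqrrB !real_normK ?num_real//.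
    have : 0 <= `|X w| * `|Y w| by rewrite mulr_ge0.
    lra.
  - by move=> w; apply: cvgM; exact: cv.
  - exact: measurable_funM.
have c2 := cvgM (cE X mX iX) (cE Y mY iY).
have E n : Ex P (fun w => clip n.+1%:R (X w) * clip n.+1%:R (Y w)) =
    Ex P (fun w => clip n.+1%:R (X w)) * Ex P (fun w => clip n.+1%:R (Y w)).
  have := cov_clip mX mY XY (ltr0Sn R n) (ltr0Sn R n).
  by rewrite mulr0 normr_le0 subr_eq0 => /eqP.
move: c1; under eq_fun do rewrite E.
by move=> c1; exact: (cvg_unique _ c1 (c2 _)).
Unshelve. all: by end_near.
Qed.

End Covariance.

(** * Covariance inequality for unbounded variables *)

Section Truncation.
Context {d : measure_display} {T : measurableType d} {R : realType}.
Variable P : probability T R.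
Implicit Types X Y : T -> R.

Lemma level_mixC X Y al : level_mix P X Y al -> level_mix P Y X al.
Proof. by move=> h a b; rewrite setIC mulrC; exact: h. Qed.

Lemma powR_meas X p : measurable_fun setT X -> measurable_fun setT (fun w => `|X w| `^ p).
Proof.
move=> mX; apply: (measurableT_comp (measurable_powR p)).
exact: measurableT_comp.
Qed.

Lemma norm_le_powR (x p : R) : 1 <= p -> `|x| <= 1 + `|x| `^ p.
Proof.
move=> p1; have := powR_ge0 `|x| p; have [x1|x1] := leP `|x| 1; first lra.
by have := powR_ge1 (ltW x1) p1; lra.
Qed.

(** Inside the box |X| <= A, |Y| <= B clipping changes nothing; outside it the error is at most |X
    Y|, which [young_off] bounds after rescaling by A and B. The coefficient 2 of A^-p has two
    sources: this error, and the mean of the clipped X, which is itself a tail term because E X =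
    0. *)
Lemma cov_trunc X Y al (A B p q M : R) : measurable_fun setT X -> measurable_fun setT Y ->
  level_mix P X Y al -> 0 < A -> 0 < B -> 1 < p -> 1 < q -> p + q <= p * q ->
  ig P (fun w => `|X w| `^ p) -> Ex P (fun w => `|X w| `^ p) <= M ->
  ig P (fun w => `|Y w| `^ q) -> Ex P (fun w => `|Y w| `^ q) <= M ->
  Ex P X = 0 ->
  `|Ex P (fun w => X w * Y w)| <= A * B * (4 * al + M * (2 * A^-1 `^ p + B^-1 `^ q)).
Proof.
move=> mX mY XYal A0 B0 p1 q1 pq iX MX iY MY EX0.
pose a w := `|X w| / A; pose b w := `|Y w| / B.
have a0 w : 0 <= a w by rewrite divr_ge0// ltW.
have b0 w : 0 <= b w by rewrite divr_ge0// ltW.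
have XE w : `|X w| = A * a w by rewrite /a mulrC divfK// gt_eqF.
have YE w : `|Y w| = B * b w by rewrite /b mulrC divfK// gt_eqF.
have apE w : a w `^ p = `|X w| `^ p * A^-1 `^ p by rewrite powRM// invr_ge0 ltW.
have bqE w : b w `^ q = `|Y w| `^ q * B^-1 `^ q by rewrite powRM// invr_ge0 ltW.
have iap : ig P (fun w => a w `^ p) by under eq_fun do rewrite apE; exact: igZr.
have ibq : ig P (fun w => b w `^ q) by under eq_fun do rewrite bqE; exact: igZr.
have Eap : Ex P (fun w => a w `^ p) <= M * A^-1 `^ p.
  under eq_fun do rewrite apE.
  by rewrite ExZr// ler_wpM2r// powR_ge0.
have Ebq : Ex P (fun w => b w `^ q) <= M * B^-1 `^ q.
  under eq_fun do rewrite bqE.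
  by rewrite ExZr// ler_wpM2r// powR_ge0.
have AB0 : 0 <= A * B by apply: mulr_ge0; exact: ltW.
have a1 w : a w <= 1 + a w `^ p.
  by have := norm_le_powR (a w) (ltW p1); rewrite ger0_norm.
have abp w : a w * b w <= 1 + (a w `^ p + b w `^ q).
  have h1 := powR_ge0 (a w) p; have h2 := powR_ge0 (b w) q.
  have [aw|aw] := leP (a w) 1; last first.
    have := young_off p1 q1 pq (a0 w) (b0 w) (or_introl aw); lra.
  have [bw|bw] := leP (b w) 1; last first.
    have := young_off p1 q1 pq (a0 w) (b0 w) (or_intror bw); lra.
  have := mulr_ile1 (a0 w) (b0 w) aw bw; lra.
have iXY : ig P (fun w => X w * Y w).
  apply: (@ig_le _ _ _ _ _ (fun w => A * B * (1 + (a w `^ p + b w `^ q)))).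
  - exact: measurable_funM.
  - by apply: igZ; apply: igD; [exact: ig_cst|exact: igD].
  - move=> w; rewrite normrM XE YE mulrACA ler_wpM2l//.
have iX1 : ig P X.
  apply: (@ig_le _ _ _ _ _ (fun w => A * (1 + a w `^ p))) => //.
  - by apply: igZ; apply: igD; [exact: ig_cst|].
  - by move=> w; rewrite XE; by apply: ler_wpM2l; [exact: ltW|exact: a1].
pose C w := clip A (X w); pose C' w := clip B (Y w).
have mC : measurable_fun setT C by exact: clip_meas.
have mC' : measurable_fun setT C' by exact: clip_meas.
have bC w : `|C w| <= A by exact/clip_bd/ltW.
have bC' w : `|C' w| <= B by exact/clip_bd/ltW.
have iC : ig P C by exact: ig_bd bC.
have iC' : ig P C' by exact: ig_bd bC'.
have iCC : ig P (fun w => C w * C' w).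
  apply: (@ig_bd _ _ _ _ _ (A * B)); first exact: measurable_funM.
  by move=> w; rewrite normrM ler_pM.
have h1 : `|Ex P (fun w => X w * Y w) - Ex P (fun w => C w * C' w)| <=
    A * B * (M * A^-1 `^ p + M * B^-1 `^ q).
  rewrite -ExB//; apply: (@le_trans _ _ (Ex P (fun w => A * B * (a w `^ p + b w `^ q)))).
    apply: Ex_norm_le; [exact: igB|by apply: igZ; exact: igD|] => w.
    have [h|h] := boolP ((a w <= 1) && (b w <= 1)).
      case/andP: h => aw bw; rewrite /C /C' !clip_id ?subrr ?normr0.
      - by apply: mulr_ge0 => //; rewrite addr_ge0 ?powR_ge0.
      - by rewrite YE ler_piMr// ltW.
      - by rewrite XE ler_piMr// ltW.
    apply: le_trans (clipM_sub _ _ (ltW A0) (ltW B0)) _.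
    rewrite XE YE mulrACA ler_wpM2l//.
    apply: young_off => //; move: h; rewrite negb_and -!ltNge => /orP[]; tauto.
  rewrite ExZ; last exact: igD.
  by rewrite ler_wpM2l// ExD// lerD.
have h2 : `|Ex P C| <= A * (M * A^-1 `^ p).
  rewrite -normrN -[- _]add0r -EX0 -ExB//.
  apply: (@le_trans _ _ (Ex P (fun w => A * (a w `^ p)))).
    apply: Ex_norm_le; [exact: igB|exact: igZ|] => w.
    have [aw|aw] := leP (a w) 1.
      rewrite /C clip_id ?subrr ?normr0; first by apply: mulr_ge0; [exact: ltW|exact: powR_ge0].
      by rewrite XE ler_piMr// ltW.
    apply: le_trans (clip_sub _ (ltW A0)) _.
    rewrite XE; apply: ler_wpM2l; [exact: ltW|exact: powR_ge1 (ltW aw) (ltW p1)].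
  by rewrite ExZ// ler_wpM2l// ltW.
have h3 := cov_clip mX mY XYal A0 B0.
have h4 : `|Ex P C * Ex P C'| <= A * (M * A^-1 `^ p) * B.
  by rewrite normrM ler_pM//; exact: Ex_bd.
move: h1 h3 h4; rewrite -/C -/C'.
set e1 := Ex P (fun w => C w * C' w); set e2 := Ex P C * Ex P C'.
have -> : A * B * (4 * al + M * (2 * A^-1 `^ p + B^-1 `^ q)) =
  A * B * (M * A^-1 `^ p + M * B^-1 `^ q) + 4 * A * B * al + A * (M * A^-1 `^ p) * B by ring.
rewrite !ler_norml => /andP[u1 u2] /andP[u3 u4] /andP[u5 u6]; clear - u1 u2 u3 u4 u5 u6.
by apply/andP; split; lra.
Qed.

(* Truncation at the levels [h `^ (s / p)] and [h `^ (s / q)] balances the terms of [cov_trunc]. *)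
Lemma cov_rate X Y (h : nat) (C M p q s : R) : measurable_fun setT X -> measurable_fun setT Y ->
  (0 < h)%N -> level_mix P X Y (C * h%:R `^ (- s)) -> 0 <= C -> 0 <= M -> 1 < p -> 1 < q ->
  p + q <= p * q -> 4 <= s * (1 - p^-1 - q^-1) ->
  ig P (fun w => `|X w| `^ p) -> Ex P (fun w => `|X w| `^ p) <= M ->
  ig P (fun w => `|Y w| `^ q) -> Ex P (fun w => `|Y w| `^ q) <= M ->
  Ex P X = 0 ->
  `|Ex P (fun w => X w * Y w)| <= (4 * C + 3 * M) * (h%:R ^+ 4)^-1.
Proof.
move=> mX mY h0 hm C0 M0 p1 q1 pq s4 iX MX iY MY EX.
have h1 : 1 <= h%:R :> R by rewrite ler1n.
have hp : 0 < h%:R :> R by rewrite ltr0n.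
have p0 : p != 0 by rewrite gt_eqF//; lra.
have q0 : q != 0 by rewrite gt_eqF//; lra.
have := cov_trunc mX mY hm (powR_gt0 (s / p) hp) (powR_gt0 (s / q) hp) p1 q1 pq iX MX iY MY EX.
rewrite -!powRN -!powRrM !mulNr !divfK// => /le_trans; apply.
rewrite -powRD ?(gt_eqF hp) ?implybT//.
(* With these levels all three error terms are multiples of h^-s, while the prefactor A B is h^(s/p
   + s/q). The total exponent is -s (1 - 1/p - 1/q) <= -4. *)
rewrite (_ : 4 * (C * h%:R `^ (- s)) + M * (2 * h%:R `^ (- s) + h%:R `^ (- s))
  = (4 * C + 3 * M) * h%:R `^ (- s)); last by ring.
rewrite mulrCA -powRD ?(gt_eqF hp) ?implybT// ler_wpM2l//.
  by rewrite addr_ge0// mulr_ge0.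
rewrite -powR_mulrn ?ler0n// -powRN ler_powR//.
move: s4; rewrite !mulrBr mulr1; lra.
Qed.

End Truncation.

Section Sort4.

(** Adjacent transpositions suffice to sort four numbers, so a property invariant under them need
    only be checked on sorted arguments. The proof is an insertion sort. *)
Lemma sort4_ind (Q : nat -> nat -> nat -> nat -> Prop) :
  (forall a b c d, Q a b c d -> Q b a c d) ->
  (forall a b c d, Q a b c d -> Q a c b d) ->
  (forall a b c d, Q a b c d -> Q a b d c) ->
  (forall a b c d, (a <= b <= c)%N -> (c <= d)%N -> Q a b c d) ->
  forall a b c d, Q a b c d.
Proof.
move=> s12 s23 s34 H.
have H3 a b c d : (a <= b <= c)%N -> Q a b c d.
  move=> /andP[ab bc]; have [cd|dc] := leqP c d; first by apply: H => //; rewrite ab.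
  apply: s34; have [bd|db] := leqP b d; first by apply: H; rewrite ?ab ?bd// ltnW.
  apply: s23; have [ad|da] := leqP a d; first by apply: H; rewrite ?ad ?(ltnW db).
  by apply: s12; apply: H; rewrite ?ab ?(ltnW da).
have H2 a b c d : (a <= b)%N -> Q a b c d.
  move=> ab; have [bc|cb] := leqP b c; first by apply: H3; rewrite ab.
  apply: s23; have [ac|ca] := leqP a c; first by apply: H3; rewrite ac ltnW.
  by apply: s12; apply: H3; rewrite ab ltnW.
move=> a b c d; have [ab|ba] := leqP a b; first exact: H2.
by apply: s12; apply: H2; exact: ltnW.
Qed.

End Sort4.

(** * Fourth moments of partial sums of a mixing sequence *)

Section FourthMoment.
Context {d : measure_display} {T : measurableType d} {R : realType}.
Variable P : probability T R.

(** The weight of one gap. It is summable, and its square has the order h^-4 of the covariance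
    bound; the shift by 1 keeps it finite at gap 0. *)
Definition gq (h : nat) : R := ((1 + h%:R) ^+ 2)^-1.
Definition Gq (a b : nat) : R := gq ((a - b) + (b - a))%N.

Lemma gq_gt0 h : 0 < gq h.
Proof. by rewrite invr_gt0 exprn_gt0// ltr_wpDr. Qed.

Lemma gq_dec h k : (h <= k)%N -> gq k <= gq h.
Proof.
by move=> hk; rewrite lef_pV2 ?posrE ?exprn_gt0 ?ltr_wpDr// ler_pXn2r ?nnegrE ?addr_ge0//
  lerD2l ler_nat.
Qed.

Lemma GqC a b : Gq a b = Gq b a.
Proof. by rewrite /Gq addnC. Qed.

Lemma sum_gq m : \sum_(h < m) gq h <= 2.
Proof.
case: m => [|m]; first by rewrite big_ord0.
(* Strengthened so that induction telescopes: 1/(k+1)^2 <= 1/k - 1/(k+1). *)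
suff H : \sum_(h < m.+1) gq h <= 2 - (m.+1%:R)^-1 by apply: le_trans H _; rewrite gerBl invr_ge0.
elim: m => [|m IH]; first by rewrite big_ord1 /gq addr0 expr1n invr1; lra.
rewrite big_ord_recr/=; apply: le_trans (lerD IH (lexx _)) _.
rewrite /gq nat1r.
have h1 : 0 < m.+1%:R :> R by rewrite ltr0n.
rewrite -[m.+2%:R]natr1; move: (m.+1%:R) h1 => x x0.
rewrite -addrA lerD2l -subr_ge0 (_ : _ - _ = (x * (x + 1) ^+ 2)^-1); last by field; lra.
by rewrite invr_ge0 mulr_ge0 ?exprn_ge0 ?addr_ge0// ltW.
Qed.

Lemma sum_Gq m : \sum_(a < m) \sum_(b < m) Gq a b <= 4 * m%:R.
Proof.
have H (a : 'I_m) : \sum_(b < m) Gq a b <= 4.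
  have -> : (4 : R) = 2 + 2 by lra.
  pose F h := gq h.
  have E : \sum_(b < m) Gq a b =
      \sum_(0 <= b < a) gq (a - b) + \sum_(a <= b < m) gq (b - a).
    rewrite -(@big_mkord _ 0 +%R m xpredT (fun b => Gq a b)).
    rewrite (@big_cat_nat _ 0 +%R a 0%N m xpredT)//=; last exact: ltnW.
    congr (_ + _); rewrite !big_nat; apply: eq_bigr => b /andP[h1 h2].
      by rewrite /Gq (_ : (b - a)%N = 0%N) ?addn0//; apply/eqP; rewrite subn_eq0 ltnW.
    by rewrite /Gq (_ : (a - b)%N = 0%N) ?add0n//; apply/eqP; rewrite subn_eq0.
  rewrite E; apply: lerD; last first.
    rewrite -{1}[nat_of_ord a]add0n big_addn.
    by under eq_bigr do rewrite addnK; rewrite big_mkord; exact: sum_gq.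
  rewrite big_nat_rev/= add0n; apply: le_trans (sum_gq a).
  rewrite -(big_mkord xpredT gq) !big_nat; apply: ler_sum => b /andP[_ ba].
  by apply: gq_dec; rewrite subKn.
apply: (@le_trans _ _ (\sum_(a < m) 4)); first by apply: ler_sum.
by rewrite sumr_const card_ord mulr_natr.
Qed.

Lemma prod4_le (a b c e : R) : `|a * b * c * e| <= a ^+ 4 + b ^+ 4 + c ^+ 4 + e ^+ 4.
Proof.
have sq (x y : R) : `|x * y| <= (x ^+ 2 + y ^+ 2) / 2.
  have h := sqr_ge0 (x - y); have h' := sqr_ge0 (x + y).
  by rewrite ler_norml; apply/andP; split; nra.
have h1 := sq (a * b) (c * e); have h2 := sq (a ^+ 2) (b ^+ 2); have h3 := sq (c ^+ 2) (e ^+ 2).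
rewrite -mulrA; apply: le_trans h1 _.
move: h2 h3; rewrite -!exprM -!exprMn !ger0_norm ?sqr_ge0// => h2 h3.
have := exprn_even_ge0 a (isT : ~~ odd 4); have := exprn_even_ge0 b (isT : ~~ odd 4).
have := exprn_even_ge0 c (isT : ~~ odd 4); have := exprn_even_ge0 e (isT : ~~ odd 4).
move: h2 h3; rewrite /muln/=; lra.
Qed.

Lemma pow4_le (x p : R) : 4 <= p -> x ^+ 4 <= 1 + `|x| `^ p.
Proof.
move=> p4; have -> : x ^+ 4 = `|x| ^+ 4 by rewrite -normrX ger0_norm// exprn_even_ge0.
have := powR_ge0 `|x| p; have [x1|x1] := leP `|x| 1.
  have : `|x| ^+ 4 <= 1 by rewrite exprn_ile1.
  lra.
rewrite -powR_mulrn//; have : `|x| `^ 4%:R <= `|x| `^ p by rewrite ler_powR// ltW.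
lra.
Qed.

(** The product is at most the cube of its largest factor. This is why a product of three variables
    is used with moments of order 2r/3 when single variables have moments of order 2r. *)
Lemma prod3_pow (a b c p : R) : 0 <= p ->
  `|a * b * c| `^ (p / 3) <= `|a| `^ p + `|b| `^ p + `|c| `^ p.
Proof.
move=> p0.
have aux (x y z : R) : `|y| <= `|x| -> `|z| <= `|x| -> `|x * y * z| `^ (p / 3) <= `|x| `^ p.
  move=> yx zx; have -> : `|x| `^ p = (`|x| ^+ 3) `^ (p / 3).
    by rewrite -powR_mulrn// -powRrM; congr (_ `^ _); field.
  rewrite ge0_ler_powR ?nnegrE ?divr_ge0 ?exprn_ge0//.
  by rewrite !normrM !exprS expr0 mulr1 -mulrA ler_wpM2l// ler_pM.
have := powR_ge0 `|a| p; have := powR_ge0 `|b| p; have := powR_ge0 `|c| p => c0 b0 a0.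
have [ab|ba] := leP `|a| `|b|; have [bc|cb] := leP `|b| `|c|.
- have -> : a * b * c = c * a * b by ring.
  have := aux c a b (le_trans ab bc) bc; lra.
- have -> : a * b * c = b * a * c by ring.
  have := aux b a c ab (ltW cb); lra.
- have [ac|ca] := leP `|a| `|c|.
    have -> : a * b * c = c * a * b by ring.
    have := aux c a b ac bc; lra.
  have := aux a b c (ltW ba) (ltW ca); lra.
- have := aux a b c (ltW ba) (le_trans (ltW cb) (ltW ba)); lra.
Qed.

Variables (u : nat -> T -> R) (r s C M : R).
Hypothesis r2 : 2 < r.
Hypothesis sr : 4 * r <= s * (r - 2).
Hypothesis C0 : 0 <= C.
Hypothesis mu : forall t, measurable_fun setT (u t).
Hypothesis iu : forall t, ig P (fun w => `|u t w| `^ (2 * r)).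
Hypothesis Mu : forall t, Ex P (fun w => `|u t w| `^ (2 * r)) <= M.
Hypothesis Eu : forall t, Ex P (u t) = 0.
(** [past] isolates the earliest of four times and [futu] the latest; once the times are sorted
    these are the only splits used. *)
Hypothesis past : forall t h i j k, (0 < h)%N -> (t + h <= i)%N -> (t + h <= j)%N -> (t + h <= k)%N ->
  level_mix P (u t) (fun w => u i w * u j w * u k w) (C * h%:R `^ (- s)).
Hypothesis futu : forall t h i j k, (0 < h)%N -> (i + h <= t)%N -> (j + h <= t)%N -> (k + h <= t)%N ->
  level_mix P (u t) (fun w => u i w * u j w * u k w) (C * h%:R `^ (- s)).

Let M0 : 0 <= M.
Proof. by apply: le_trans (Mu 0); apply: Ex_ge0 => w; exact: powR_ge0. Qed.

Let iu4 a b c e : ig P (fun w => u a w * u b w * u c w * u e w).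
Proof.
apply: (@ig_le _ _ _ _ _ (fun w => (1 + `|u a w| `^ (2 * r)) + (1 + `|u b w| `^ (2 * r)) +
  (1 + `|u c w| `^ (2 * r)) + (1 + `|u e w| `^ (2 * r)))).
- by do 3 apply: measurable_funM => //.
- have i1 t : ig P (fun w => 1 + `|u t w| `^ (2 * r)) by apply: igD; [exact: ig_cst|exact: iu].
  exact: igD (igD (igD (i1 a) (i1 b)) (i1 c)) (i1 e).
- by move=> w; apply: le_trans (prod4_le _ _ _ _) _; rewrite !lerD// pow4_le//; have := r2; lra.
Qed.

Definition quadE a b c e := Ex P (fun w => u a w * u b w * u c w * u e w).
(** For gaps h >= 1, [cov_rate] gives (4 C + 9 M) h^-4, and h + 1 <= 2 h turns h^-4 into 16 (1 +
    h)^-4, whence 64 C + 144 M. The summand 4 covers gap 0, where only the moment bound 4 + 4 M is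
    available. *)
Definition D4 := 64 * C + 144 * M + 4.

Lemma quadE_bd a b c e : `|quadE a b c e| <= 4 + 4 * M.
Proof.
have i1 t : ig P (fun w => 1 + `|u t w| `^ (2 * r)) by apply: igD; [exact: ig_cst|exact: iu].
have E1 t : Ex P (fun w => 1 + `|u t w| `^ (2 * r)) <= 1 + M.
  by rewrite ExD ?Ex_cst ?lerD2l//; exact: ig_cst.
apply: (@le_trans _ _ (Ex P (fun w => (1 + `|u a w| `^ (2 * r)) + (1 + `|u b w| `^ (2 * r)) +
  (1 + `|u c w| `^ (2 * r)) + (1 + `|u e w| `^ (2 * r))))).
  apply: Ex_norm_le => //.
  - exact: igD (igD (igD (i1 a) (i1 b)) (i1 c)) (i1 e).
  - by move=> w; apply: le_trans (prod4_le _ _ _ _) _; rewrite !lerD// pow4_le//; have := r2; lra.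
have i2 : ig P (fun w => (1 + `|u a w| `^ (2 * r)) + (1 + `|u b w| `^ (2 * r))) by exact: igD.
rewrite (ExD (igD i2 (i1 c)) (i1 e)) (ExD i2 (i1 c)) (ExD (i1 a) (i1 b)).
have := E1 a; have := E1 b; have := E1 c; have := E1 e; lra.
Qed.

(** [cov_rate] is applied to [u t] and the product of the other three with p = 2r and q = 2r/3. Then
    1 - 1/p - 1/q = (r - 2)/r, so the hypothesis [sr] is exactly the required 4 <= s (1 - 1/p -
    1/q). *)
Lemma quad_gap t i j k h : ((t + h <= i) && (t + h <= j) && (t + h <= k)
    || (i + h <= t) && (j + h <= t) && (k + h <= t))%N ->
  `|quadE t i j k| <= D4 * (gq h * gq h).
Proof.
move=> H.
case: h H => [|h] H.
  rewrite /gq addr0 expr1n invr1 !mulr1; apply: le_trans (quadE_bd _ _ _ _) _.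
  by rewrite /D4; have := C0; have := M0; lra.
have hm : level_mix P (u t) (fun w => u i w * u j w * u k w) (C * h.+1%:R `^ (- s)).
  by case/orP: H => /andP[/andP[h1 h2] h3]; [exact: past|exact: futu].
have r2' := r2; have sr' := sr; have r0 : 0 < r - 2 by lra.
have -> : quadE t i j k = Ex P (fun w => u t w * (u i w * u j w * u k w)).
  by congr (Ex P _); apply/funext => w; ring.
have i3 : ig P (fun w => `|u i w * u j w * u k w| `^ (2 * r / 3)).
  apply: (@ig_le _ _ _ _ _ (fun w => `|u i w| `^ (2 * r) + `|u j w| `^ (2 * r) + `|u k w| `^ (2 * r))).
  - by apply: powR_meas; do 2 apply: measurable_funM => //.
  - by apply: igD => //; exact: igD.
  - by move=> w; rewrite ger0_norm ?powR_ge0//; apply: prod3_pow; lra.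
have := @cov_rate _ _ _ P (u t) (fun w => u i w * u j w * u k w) h.+1 C (3 * M) (2 * r) (2 * r / 3) s.
move=> /(_ (mu _) _ isT hm C0).
have m3 : measurable_fun setT (fun w => u i w * u j w * u k w) by do 2 apply: measurable_funM => //.
have M3 : 0 <= 3 * M by have := M0; lra.
have p1 : 1 < 2 * r by lra.
have q1 : 1 < 2 * r / 3 by lra.
have pq : 2 * r + 2 * r / 3 <= 2 * r * (2 * r / 3) by nra.
have s4 : 4 <= s * (1 - (2 * r)^-1 - (2 * r / 3)^-1).
  have -> : 1 - (2 * r)^-1 - (2 * r / 3)^-1 = (r - 2) / r by field; lra.
  by rewrite mulrA ler_pdivlMr//; lra.
have Mt : Ex P (fun w => `|u t w| `^ (2 * r)) <= 3 * M by have := Mu t; have := M0; lra.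
have Mijk : Ex P (fun w => `|u i w * u j w * u k w| `^ (2 * r / 3)) <= 3 * M.
  apply: (@le_trans _ _ (Ex P (fun w => `|u i w| `^ (2 * r) + `|u j w| `^ (2 * r) + `|u k w| `^ (2 * r)))).
    apply: Ex_le => //; first by apply: igD => //; exact: igD.
    by move=> w; apply: prod3_pow; lra.
  rewrite !ExD//; last exact: igD.
  have := Mu i; have := Mu j; have := Mu k; lra.
move=> /(_ m3 M3 p1 q1 pq s4 (iu _) Mt i3 Mijk (Eu _)) /le_trans; apply.
have h1 : 1 <= h.+1%:R :> R by rewrite ler1n.
have hp : 0 < h.+1%:R :> R by rewrite ltr0n.
rewrite /gq /D4.
rewrite -invfM -exprD.
have h16 : (h.+1%:R ^+ 4)^-1 <= 16 * ((1 + h.+1%:R) ^+ 4)^-1 :> R.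
  rewrite ler_pdivlMr ?exprn_gt0 ?addr_gt0//.
  rewrite mulrC ler_pdivrMr ?exprn_gt0//.
  have -> : (16 : R) = 2 ^+ 4 by rewrite -natrX.
  rewrite -exprMn ler_pXn2r ?nnegrE ?mulr_ge0 ?addr_ge0//; lra.
have g0 : 0 <= ((1 + h.+1%:R) ^+ 4)^-1 :> R by rewrite invr_ge0 exprn_ge0// addr_ge0.
apply: (@le_trans _ _ ((4 * C + 9 * M) * (16 * ((1 + h.+1%:R) ^+ 4)^-1))).
  rewrite (_ : 3 * (3 * M) = 9 * M); last ring.
  by rewrite ler_wpM2l//; have := C0; have := M0; lra.
set g := ((1 + _) ^+ 4)^-1 in g0 *.
rewrite (_ : _ * (16 * g) = (64 * C + 144 * M) * g); last by ring.
by rewrite ler_wpM2r//; have := C0; have := M0; lra.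
Qed.

(* The product of four factors decorrelates across the larger of the two outer gaps. *)
Lemma quadE_sorted a b c e : (a <= b <= c)%N -> (c <= e)%N ->
  `|quadE a b c e| <= D4 * (Gq a b * Gq c e).
Proof.
move=> /andP[ab bc] ce.
have D0 : 0 <= D4 by rewrite /D4; have := C0; have := M0; lra.
have GE x y : (x <= y)%N -> Gq x y = gq (y - x).
  by rewrite -subn_eq0 /Gq => /eqP ->.
rewrite !GE//.
have h1 : `|quadE a b c e| <= D4 * (gq (b - a) * gq (b - a)).
  by apply: quad_gap; rewrite subnKC// leqnn bc (leq_trans bc ce).
have h2 : `|quadE a b c e| <= D4 * (gq (e - c) * gq (e - c)).
  have -> : quadE a b c e = quadE e a b c.
    by congr (Ex P _); apply/funext => w; ring.
  by apply: quad_gap; lia.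
have [h|h] := leqP (b - a) (e - c).
  apply: le_trans h2 _; rewrite ler_wpM2l// ler_wpM2r ?(ltW (gq_gt0 _))//.
  exact: gq_dec.
apply: le_trans h1 _; rewrite ler_wpM2l// ler_wpM2l ?(ltW (gq_gt0 _))//.
exact: gq_dec (ltnW h).
Qed.

(** Which pair of indices forms the outer gaps depends on their order. Summing over the three
    pairings makes the bound symmetric, so that [sort4_ind] reduces it to the sorted case. *)
Lemma quadE_le a b c e :
  `|quadE a b c e| <= D4 * (Gq a b * Gq c e + Gq a c * Gq b e + Gq a e * Gq b c).
Proof.
have D0 : 0 <= D4 by rewrite /D4; have := C0; have := M0; lra.
move: a b c e; apply: sort4_ind => a b c e.
- rewrite (_ : quadE b a c e = quadE a b c e); last first.
    by congr (Ex P _); apply/funext => w; ring.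
  move=> /le_trans; apply; rewrite (GqC b a) ler_wpM2l//; lra.
- rewrite (_ : quadE a c b e = quadE a b c e); last first.
    by congr (Ex P _); apply/funext => w; ring.
  move=> /le_trans; apply; rewrite (GqC c b) ler_wpM2l//; lra.
- rewrite (_ : quadE a b e c = quadE a b c e); last first.
    by congr (Ex P _); apply/funext => w; ring.
  move=> /le_trans; apply; rewrite (GqC e c) ler_wpM2l//; lra.
- move=> ab ce; apply: le_trans (quadE_sorted ab ce) _; rewrite ler_wpM2l//.
  have Gp x y : 0 <= Gq x y by exact/ltW/gq_gt0.
  by rewrite -addrA lerDl addr_ge0// mulr_ge0.
Qed.

(** Each of the three pairings factors into the square of the double sum of [Gq], which is at most 4
    m; this gives the constant 3 * 16 = 48 and the order m^2. *)
Lemma sum_pow4 m : ig P (fun w => (\sum_(t < m) u t w) ^+ 4) /\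
  Ex P (fun w => (\sum_(t < m) u t w) ^+ 4) <= 48 * D4 * m%:R ^+ 2.
Proof.
have D0 : 0 <= D4 by rewrite /D4; have := C0; have := M0; lra.
have E w : (\sum_(t < m) u t w) ^+ 4 = \sum_(a < m) \sum_(b < m) \sum_(c < m) \sum_(e < m)
    u a w * u b w * u c w * u e w.
  rewrite (_ : _ ^+ 4 = (\sum_(t < m) u t w) * (\sum_(t < m) u t w) * (\sum_(t < m) u t w) * (\sum_(t < m) u t w)); last by ring.
  rewrite -!mulrA mulr_suml; apply: eq_bigr => a _.
  rewrite mulr_suml mulr_sumr; apply: eq_bigr => b _.
  rewrite mulr_suml !mulr_sumr; apply: eq_bigr => c _.
  by rewrite !mulr_sumr; apply: eq_bigr => e _; rewrite !mulrA.
have -> : (fun w => (\sum_(t < m) u t w) ^+ 4) = fun w => \sum_(a < m) \sum_(b < m) \sum_(c < m) \sum_(e < m)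
    u a w * u b w * u c w * u e w by apply/funext => w; exact: E.
have i1 a b c : ig P (fun w => \sum_(e < m) u a w * u b w * u c w * u e w).
  by apply: ig_sum => e _; exact: iu4.
have i2 a b : ig P (fun w => \sum_(c < m) \sum_(e < m) u a w * u b w * u c w * u e w).
  by apply: ig_sum => c _; exact: i1.
have i3 a : ig P (fun w => \sum_(b < m) \sum_(c < m) \sum_(e < m) u a w * u b w * u c w * u e w).
  by apply: ig_sum => b _; exact: i2.
split; first by apply: ig_sum => a _; exact: i3.
rewrite Ex_sum => [|a _]; last exact: i3.
under eq_bigr => a _.
  rewrite Ex_sum => [|b _]; last exact: i2.
  under eq_bigr => b _.
    rewrite Ex_sum => [|c _]; last exact: i1.
    under eq_bigr => c _ do rewrite Ex_sum //.
    over.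
  over.
pose K := \sum_(a < m) \sum_(b < m) Gq a b.
have K0 : 0 <= K by apply: sumr_ge0 => a _; apply: sumr_ge0 => b _; exact/ltW/gq_gt0.
apply: (@le_trans _ _ (\sum_(a < m) \sum_(b < m) \sum_(c < m) \sum_(e < m)
   D4 * (Gq a b * Gq c e + Gq a c * Gq b e + Gq a e * Gq b c))).
  do 4 (apply: ler_sum => ? _).
  by apply: le_trans (ler_norm _) _; exact: quadE_le.
have -> : \sum_(a < m) \sum_(b < m) \sum_(c < m) \sum_(e < m)
   D4 * (Gq a b * Gq c e + Gq a c * Gq b e + Gq a e * Gq b c) = D4 * (K * K + K * K + K * K).
  under eq_bigr => a _.
    under eq_bigr => b _.
      under eq_bigr => c _ do rewrite -mulr_sumr !big_split/=.
      rewrite -mulr_sumr !big_split/=; over.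
    rewrite -mulr_sumr !big_split/=; over.
  rewrite -mulr_sumr !big_split/=; congr (D4 * (_ + _ + _)).
  - rewrite /K mulr_suml; apply: eq_bigr => a _; rewrite mulr_suml; apply: eq_bigr => b _.
    by rewrite mulr_sumr; apply: eq_bigr => c _; rewrite mulr_sumr.
  - rewrite /K mulr_suml; apply: eq_bigr => a _; rewrite exchange_big/= mulr_suml; apply: eq_bigr => c _.
    by rewrite mulr_sumr; apply: eq_bigr => b _; rewrite mulr_sumr.
  - rewrite /K mulr_suml; apply: eq_bigr => a _; rewrite mulr_suml.
    under eq_bigr => b _ do rewrite exchange_big/=.
    rewrite exchange_big/=; apply: eq_bigr => e _.
    by rewrite mulr_sumr; apply: eq_bigr => b _; rewrite mulr_sumr.
have K4 : K <= 4 * m%:R := sum_Gq m.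
rewrite (_ : 48 * D4 * m%:R ^+ 2 = D4 * (3 * ((4 * m%:R) * (4 * m%:R)))); last by ring.
rewrite ler_wpM2l//.
have : K * K <= (4 * m%:R) * (4 * m%:R) by apply: ler_pM.
lra.
Qed.

End FourthMoment.

(** * Sub-sigma-algebras and laws *)

Section SigmaMeasurable.
Context {d : measure_display} {T : measurableType d} {R : realType}.
Implicit Types (X Y : T -> R) (F G : set (set T)).

Definition smeas G X := forall B : set R, measurable B -> G (X @^-1` B).

(** Equipping [T] with the generated sigma-algebra as its measurable structure lets the closure
    properties of measurable functions be reused for sub-sigma-algebras. *)
Lemma smeasP F X : smeas <<s F>> X <-> measurable_fun setT (X : g_sigma_algebraType F -> R).
Proof.
split=> [h _ B mB|h B mB]; first by rewrite setTI; exact: h.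
by rewrite -[_ @^-1` _]setTI; apply: h.
Qed.

Lemma smeas_cst F c : smeas <<s F>> (fun=> c : R).
Proof. by apply/smeasP. Qed.

Lemma smeasD F X Y : smeas <<s F>> X -> smeas <<s F>> Y -> smeas <<s F>> (fun w => X w + Y w).
Proof. by move=> /smeasP mX /smeasP mY; apply/smeasP; exact: measurable_funD. Qed.

Lemma smeasB F X Y : smeas <<s F>> X -> smeas <<s F>> Y -> smeas <<s F>> (fun w => X w - Y w).
Proof. by move=> /smeasP mX /smeasP mY; apply/smeasP; exact: measurable_funB. Qed.

Lemma smeasM F X Y : smeas <<s F>> X -> smeas <<s F>> Y -> smeas <<s F>> (fun w => X w * Y w).
Proof. by move=> /smeasP mX /smeasP mY; apply/smeasP; exact: measurable_funM. Qed.

Lemma smeas_comp F X (f : R -> R) : measurable_fun setT f ->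
  smeas <<s F>> X -> smeas <<s F>> (fun w => f (X w)).
Proof. by move=> mf /smeasP mX; apply/smeasP; exact: (measurableT_comp mf mX). Qed.

Lemma smeas_sum F I (s : seq I) (X : I -> T -> R) : (forall i, smeas <<s F>> (X i)) ->
  smeas <<s F>> (fun w => \sum_(i <- s) X i w).
Proof.
move=> mX; elim: s => [|i s IH].
  by under eq_fun do rewrite big_nil; exact: smeas_cst.
by under eq_fun do rewrite big_cons; exact: smeasD.
Qed.

Lemma smeas_sub F G X : F `<=` G -> smeas F X -> smeas G X.
Proof. by move=> FG h B mB; apply: FG; exact: h. Qed.

Lemma smeas_levset G X a : smeas G X -> G (levset X a).
Proof.
move=> h; rewrite (_ : levset X a = X @^-1` `]a, +oo[); first exact: h.
by apply/seteqP; split=> w /=; rewrite in_itv/= andbT.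
Qed.

End SigmaMeasurable.

Section Laws.
Context {d : measure_display} {T : measurableType d} {R : realType}.
Variable P : probability T R.

(** Dynkin's pi-lambda argument on rectangles. The events [E] and [E'] ride along so that the lemma
    can be iterated: one pair is upgraded from rectangles to general sets while the other
    coordinates stay frozen in the event. *)
Lemma pair_law d1 d2 (S1 : measurableType d1) (S2 : measurableType d2)
    (X X' : T -> S1) (Y Y' : T -> S2) (E E' : set T) :
  measurable_fun setT X -> measurable_fun setT X' ->
  measurable_fun setT Y -> measurable_fun setT Y' -> measurable E -> measurable E' ->
  (forall A B, measurable A -> measurable B ->
    P (X @^-1` A `&` Y @^-1` B `&` E) = P (X' @^-1` A `&` Y' @^-1` B `&` E')) ->
  forall C, measurable C ->
    P ((fun w => (X w, Y w)) @^-1` C `&` E) = P ((fun w => (X' w, Y' w)) @^-1` C `&` E').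
Proof.
move=> mX mX' mY mY' mE mE' H.
set Z := fun w => (X w, Y w); set Z' := fun w => (X' w, Y' w).
have mZ : measurable_fun setT Z by exact: measurable_fun_pair.
have mZ' : measurable_fun setT Z' by exact: measurable_fun_pair.
have pZ C : measurable C -> measurable (Z @^-1` C).
  by move=> mC; rewrite -[_ @^-1` _]setTI; exact: mZ.
have pZ' C : measurable C -> measurable (Z' @^-1` C).
  by move=> mC; rewrite -[_ @^-1` _]setTI; exact: mZ'.
have EE' : P E = P E'.
  by have := H setT setT measurableT measurableT; rewrite !preimage_setT !setTI.
pose G : set (set (S1 * S2)) := [set A `*` B | A in measurable & B in measurable].
have mG : @measurable _ (S1 * S2)%type = <<s G>> by exact: measurable_prod_measurableType.
move=> C; rewrite mG.
apply: (@dynkin_induction _ _ G (fun C => P (Z @^-1` C `&` E) = P (Z' @^-1` C `&` E'))) => //.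
- move=> _ _ [A mA [B mB <-]] [A' mA' [B' mB' <-]].
  exists (A `&` A'); first exact: measurableI.
  by exists (B `&` B'); [exact: measurableI|rewrite setXI].
- by rewrite !preimage_setT !setTI.
- move=> _ [A mA [B mB <-]]; exact: H.
- move=> S mS HS.
  have e1 : P E = (P (Z @^-1` S `&` E) + P (Z @^-1` (~` S) `&` E))%E.
    rewrite -measureU; [|by apply: measurableI => //; exact: pZ| |].
    + by rewrite preimage_setC -setIUl setUv setTI.
    + by apply: measurableI => //; apply: pZ; exact: measurableC.
    + by rewrite preimage_setC setIACA setICr set0I.
  have e2 : P E' = (P (Z' @^-1` S `&` E') + P (Z' @^-1` (~` S) `&` E'))%E.
    rewrite -measureU; [|by apply: measurableI => //; exact: pZ'| |].
    + by rewrite preimage_setC -setIUl setUv setTI.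
    + by apply: measurableI => //; apply: pZ'; exact: measurableC.
    + by rewrite preimage_setC setIACA setICr set0I.
  have f1 : P (Z @^-1` (~` S) `&` E) \is a fin_num.
    by apply: fin_num_measure; apply: measurableI => //; apply: pZ; exact: measurableC.
  have f2 : P (Z' @^-1` (~` S) `&` E') \is a fin_num.
    by apply: fin_num_measure; apply: measurableI => //; apply: pZ'; exact: measurableC.
  have f3 : P (Z' @^-1` S `&` E') \is a fin_num.
    by apply: fin_num_measure; apply: measurableI => //; exact: pZ'.
  move: e1; rewrite EE' e2 HS => /(congr1 fine); rewrite !fineD// => /addrI h.
  by rewrite -(fineK f1) -(fineK f2) h.
- move=> F mF tF HF.
  rewrite !preimage_bigcup !setI_bigcupl.
  rewrite !measure_bigcup//.
  + by apply: eq_eseriesr => k _; exact: HF.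
  + by move=> k _; apply: measurableI => //; exact: pZ'.
  + apply/trivIsetP => i j _ _ ij; rewrite setIACA -preimage_setI.
    by move/trivIsetP : tF => /(_ i j Logic.I Logic.I ij) ->; rewrite preimage_set0 set0I.
  + by move=> k _; apply: measurableI => //; exact: pZ.
  + apply/trivIsetP => i j _ _ ij; rewrite setIACA -preimage_setI.
    by move/trivIsetP : tF => /(_ i j Logic.I Logic.I ij) ->; rewrite preimage_set0 set0I.
Qed.

Lemma law_Ex d1 (S : measurableType d1) (X X' : T -> S) (f : S -> R) :
  measurable_fun setT X -> measurable_fun setT X' ->
  (forall C, measurable C -> P (X @^-1` C) = P (X' @^-1` C)) ->
  measurable_fun setT f -> ig P (fun w => f (X w)) -> ig P (fun w => f (X' w)) ->
  Ex P (fun w => f (X w)) = Ex P (fun w => f (X' w)).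
Proof.
move=> mX mX' H mf iX iX'; rewrite /Ex unlock; congr fine.
have mf' : measurable_fun setT (EFin \o f) by exact/measurable_EFinP.
rewrite -(@integral_pushforward _ _ _ _ _ _ mX P setT (EFin \o f))//.
rewrite -(@integral_pushforward _ _ _ _ _ _ mX' P setT (EFin \o f))//.
apply: eq_measure_integral => A mA _; exact: H.
Qed.

(** Both sides, as functions of A, are finite measures with equal total mass that agree on a
    pi-system, hence on the sigma-algebra it generates. *)
Lemma indep_gen (G : set (set T)) (B : set T) : setI_closed G -> G `<=` measurable ->
  measurable B -> (forall A, G A -> P (A `&` B) = (P A * P B)%E) ->
  forall A, <<s G>> A -> P (A `&` B) = (P A * P B)%E.
Proof.
move=> GI Gm mB H A sA.
have pB : P B \is a fin_num by exact: fin_num_measure.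
have pB0 : 0 <= fine (P B) by exact: fine_ge0.
pose m1 := mrestr P mB; pose m2 := mscale (NngNum pB0) P.
have E2 X : m2 X = (P X * P B)%E by rewrite /m2 /mscale/= fineK// muleC.
rewrite -E2.
apply: (g_sigma_algebra_measure_unique_trace G setT measurableT _ _ m1 m2) => //.
- by move=> X [/Gm].
- by move=> X Y [GX _] [GY _]; split=> //; exact: GI.
- transitivity (P setT * P B)%E; last by rewrite -E2.
  by rewrite [LHS]/(P (setT `&` B)) setTI probability_setT mul1e.
- by move=> X [GX _]; transitivity (P X * P B)%E; [exact: H|rewrite -E2].
- by rewrite [X in (X < _)%E]/(P (setT `&` B)) setTI ltey_eq pB.
- rewrite (_ : [set X | _ /\ _] = G)//.
  by apply/seteqP; split=> [X []//|X GX]; split.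
Qed.

End Laws.

(** * Sigma-algebras of the panel: mixing, independence across individuals, stationarity *)

Section PanelSigma.
Context {d : measure_display} {T : measurableType d} {R : realType}.
Variables (P : probability T R) (K : nat).
Variables (x : nat -> nat -> T -> 'cV[R]_K) (eps : nat -> nat -> T -> R).
Hypothesis mx : forall i t (k : 'I_K), measurable_fun setT (fun w => x i t w k 0).
Hypothesis me : forall i t, measurable_fun setT (eps i t).

Notation sig := (sig_times x eps).

Lemma smeas_x i t (S : set nat) k : S t -> smeas (sig i S) (fun w => x i t w k 0).
Proof.
move=> St B mB; apply: sub_sigma_algebra; exists (fun w => x i t w k 0), B; split=> //.
by exists t => //; left; exists k.
Qed.

Lemma smeas_eps i t (S : set nat) : S t -> smeas (sig i S) (eps i t).
Proof.
move=> St B mB; apply: sub_sigma_algebra; exists (eps i t), B; split=> //.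
by exists t => //; right.
Qed.

Lemma sig_meas i S : sig i S `<=` measurable.
Proof.
apply: smallest_sub; first exact: sigma_algebra_measurable.
move=> A [f [B [[t St ft] [mB ->]]]].
rewrite -[_ @^-1` _]setTI.
by case: ft => [[k ->]|->]; [exact: mx|exact: me].
Qed.

Lemma smeas_meas i S (X : T -> R) : smeas (sig i S) X -> measurable_fun setT X.
Proof. by move=> h _ B mB; rewrite setTI; apply: sig_meas; exact: h. Qed.

Lemma mix_level s : strong_mixing_rate P x eps s -> exists2 C : R, 0 <= C &
  forall i t h X Y, (0 < h)%N -> smeas (sig i [set u | (u <= t)%N]) X ->
   smeas (sig i [set u | (t + h <= u)%N]) Y -> level_mix P X Y (C * h%:R `^ (- s)).
Proof.
move=> [C HC]; exists `|C| => // i t h X Y h0 sX sY a b.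
apply: le_trans (HC i t h h0 _ _ (smeas_levset a sX) (smeas_levset b sY)) _.
by rewrite ler_wpM2r ?powR_ge0// ler_norm.
Qed.

Hypothesis ind : indep_across_i P x eps.

Lemma prb_fin A B : measurable A -> measurable B -> prb P (A `&` B) = prb P A * prb P B <->
  P (A `&` B) = (P A * P B)%E.
Proof.
move=> mA mB; split=> [h|h]; last by rewrite /prb h fineM ?fin_num_measure.
rewrite -(fineK (fin_num_measure P _ mA)) -(fineK (fin_num_measure P _ mB)) -EFinM -h fineK//.
by apply: fin_num_measure; exact: measurableI.
Qed.

Lemma indep_level2 i j X Y : i != j -> smeas (sig i setT) X -> smeas (sig j setT) Y ->
  level_mix P X Y 0.
Proof.
move=> ij sX sY a b.
pose F k := if k == i then levset X a else levset Y b.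
have := ind (s := [:: i; j]) (A := F).
rewrite /= inE ij => /(_ isT) H.
have -> : levset X a `&` levset Y b = \bigcap_(k in [set k | k \in [:: i; j]]) F k.
  apply/seteqP; split=> [w [h1 h2] k /=|w h].
    by rewrite !inE => /orP[] /eqP ->; rewrite /F ?eqxx// eq_sym (negbTE ij).
  split; first by have := h i; rewrite /F eqxx; apply; rewrite /= inE eqxx.
  by have := h j; rewrite /F eq_sym (negbTE ij); apply; rewrite /= !inE eqxx orbT.
rewrite /prb H; last first.
  move=> k; rewrite !inE => /orP[] /eqP ->; rewrite /F ?eqxx; first exact: smeas_levset.
  by rewrite eq_sym (negbTE ij); exact: smeas_levset.
by rewrite !big_cons big_nil mulr1 /F eqxx eq_sym (negbTE ij) subrr normr0.
Qed.

(** All information on individuals before [j]; the partial sums over i < j in the swapping argument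
    are measurable for it. *)
Definition sig_lt j : set (set T) := <<s \bigcup_(i in [set i | (i < j)%N]) sig i setT >>.

Lemma smeas_sig_lt i j (X : T -> R) : (i < j)%N -> smeas (sig i setT) X -> smeas (sig_lt j) X.
Proof.
move=> ij; apply: smeas_sub => A sA; apply: sub_sigma_algebra.
by exists i.
Qed.

Lemma sig_setT i S : sig i S setT.
Proof. by have := @measurableT _ (g_sigma_algebraType
  [set A | exists f B, (\bigcup_(t in S) coordfuns x eps i t) f /\ measurable B /\ A = f @^-1` B]). Qed.

Lemma sig_setI i S A B : sig i S A -> sig i S B -> sig i S (A `&` B).
Proof. exact: (@measurableI _ (g_sigma_algebraType
  [set A | exists f B, (\bigcup_(t in S) coordfuns x eps i t) f /\ measurable B /\ A = f @^-1` B])). Qed.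

(** The intersections of one event per individual i < j form a pi-system generating [sig_lt j]. On
    it the product rule is [indep_across_i] for the list [j :: iota 0 j], divided into the factor of
    j and the rest; [indep_gen] does the extension. *)
Lemma indep_level_lt j X Y : smeas (sig_lt j) X -> smeas (sig j setT) Y -> level_mix P X Y 0.
Proof.
move=> sX sY a b.
pose I : set nat := [set i | i \in iota 0 j].
pose G := [set A | exists2 F : nat -> set T, (forall i, sig i setT (F i)) & A = \bigcap_(i in I) F i].
have Gm : G `<=` measurable.
  move=> _ [F sF ->]; apply: fin_bigcap_measurable => [|i _]; first exact: finite_seq.
  exact: sig_meas (sF i).
have GI : setI_closed G.
  move=> _ _ [F sF ->] [F' sF' ->]; exists (fun i => F i `&` F' i); last by rewrite bigcapI.
  by move=> i; exact: sig_setI.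
set A := levset X a; set B := levset Y b.
have sA : <<s G>> A.
  have := smeas_levset a sX; rewrite -/A; move: A; apply: sub_smallest2r.
    exact: smallest_sigma_algebra.
  move=> A' [i ij sA'].
  exists (fun k => if k == i then A' else setT) => [k|].
    by case: ifP => [/eqP ->//|_]; exact: sig_setT.
  apply/seteqP; split=> [w wA k _|w h]; first by case: ifP.
  by have := h i; rewrite eqxx; apply; rewrite /I/= mem_iota.
have sB : sig j setT B by exact: smeas_levset.
have mB := sig_meas sB.
have mA : measurable A.
  by move: A sA; apply: smallest_sub; [exact: sigma_algebra_measurable|exact: Gm].
suff : P (A `&` B) = (P A * P B)%E.
  by move=> /(prb_fin mA mB) ->; rewrite subrr normr0.
apply: (indep_gen GI Gm mB) => // _ [F sF ->].
have mF : measurable (\bigcap_(i in I) F i) by apply: Gm; exists F.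
apply/(prb_fin mF mB).
pose F' k := if k == j then B else F k.
have u1 : uniq (j :: iota 0 j) by rewrite /= iota_uniq mem_iota add0n ltnn andbF.
have sF' k : sig k setT (F' k) by rewrite /F'; case: eqP => // ->.
have FjB : F' j = B by rewrite /F' eqxx.
have nj k : k \in iota 0 j -> F' k = F k.
  by rewrite mem_iota add0n => /andP[_ kj]; rewrite /F' ltn_eqF.
have E2 : \prod_(i <- iota 0 j) fine (P (F' i)) = prb P (\bigcap_(i in I) F i).
  rewrite /prb (ind (iota_uniq 0 j) (fun k _ => sF k)) big_seq [RHS]big_seq.
  by apply: eq_bigr => k kj; rewrite nj.
have := ind u1 (fun k _ => sF' k); rewrite big_cons FjB E2 mulrC => <-.
congr (fine (P _)); apply/seteqP; split=> [w [h1 h2] k /=|w h].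
  rewrite inE => /orP[/eqP ->|kj]; first by rewrite /F' eqxx.
  by rewrite nj//; exact: h1.
split=> [k kj|]; first by rewrite -nj//; apply: h; rewrite /= inE kj orbT.
by have := h j; rewrite /F' eqxx; apply; rewrite /= inE eqxx.
Qed.

(** Stationarity is given only as equality of cylinder probabilities. Three uses of [pair_law] lift
    it to the joint law of the observations at two times: first the pair at one time, then the pair
    at the other, then the pair of pairs. *)
Lemma stat_law i (t tau : nat) (a b : 'I_K) (f : (R * R) * (R * R) -> R) :
  stationary_i P x eps i -> measurable_fun setT f ->
  let Z u w := ((x i u w a 0, eps i u w), (x i (u + tau)%N w b 0, eps i (u + tau)%N w)) in
  ig P (fun w => f (Z t w)) -> ig P (fun w => f (Z 0 w)) ->
  Ex P (fun w => f (Z t w)) = Ex P (fun w => f (Z 0 w)).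
Proof.
move=> st mf Z i1 i2.
have mX u : measurable_fun setT (fun w => (x i u w a 0, eps i u w)) by exact: measurable_fun_pair.
have mY u : measurable_fun setT (fun w => (x i u w b 0, eps i u w)) by exact: measurable_fun_pair.
have mZ u : measurable_fun setT (Z u) by exact: measurable_fun_pair.
apply: (@law_Ex _ _ _ P _ _ (Z t) (Z 0%N)) => //.
have key A1 A2 A3 A4 : measurable A1 -> measurable A2 -> measurable A3 -> measurable A4 ->
  P ((fun w => x i t w a 0) @^-1` A1 `&` eps i t @^-1` A2 `&`
     ((fun w => x i (t + tau)%N w b 0) @^-1` A3 `&` eps i (t + tau)%N @^-1` A4)) =
  P ((fun w => x i 0%N w a 0) @^-1` A1 `&` eps i 0%N @^-1` A2 `&`
     ((fun w => x i (0 + tau)%N w b 0) @^-1` A3 `&` eps i (0 + tau)%N @^-1` A4)).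
  move=> m1 m2 m3 m4.
  (* A constraint is switched off by replacing its set by [setT]. Constraints are intersected rather
     than chosen by cases because [tau] may be 0, and then both times, possibly even both
     coordinates, coincide. *)
  pose c (q : bool) (A : set R) := if q then A else setT.
  have mc q A : measurable A -> measurable (c q A) by rewrite /c; case: ifP.
  pose Bx (j : nat) k := c ((j == 0%N) && (k == a)) A1 `&` c ((j == tau) && (k == b)) A3.
  pose Be (j : nat) := c (j == 0%N) A2 `&` c (j == tau) A4.
  have cE u : cyl x eps i u tau.+1 Bx Be = (fun w => x i u w a 0) @^-1` A1 `&` eps i u @^-1` A2 `&`
     ((fun w => x i (u + tau)%N w b 0) @^-1` A3 `&` eps i (u + tau)%N @^-1` A4).
    apply/seteqP; split=> [w h|w [[h1 h2] [h3 h4]] j /= _].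
      have /= [h1 h2] := h 0%N isT; have /= [h3 h4] := h tau (ltnSn _).
      split; split.
      - by have := h1 a; rewrite /Bx /c !eqxx addn0 => -[].
      - by move: h2; rewrite /Be /c !eqxx addn0 => -[].
      - by have := h3 b; rewrite /Bx /c !eqxx => -[].
      - by move: h4; rewrite /Be /c !eqxx => -[].
    split=> [k|]; split; rewrite /c.
    - by case: ifP => // /andP[/eqP -> /eqP ->]; rewrite addn0.
    - by case: ifP => // /andP[/eqP -> /eqP ->].
    - by case: ifP => // /eqP ->; rewrite addn0.
    - by case: ifP => // /eqP ->.
  rewrite -!cE; apply: st.
  - by move=> j k; apply: measurableI; exact: mc.
  - by move=> j; apply: measurableI; exact: mc.
have px u k A : measurable A -> measurable ((fun w => x i u w k 0) @^-1` A).
  by move=> mA; rewrite -[_ @^-1` _]setTI; exact: mx.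
have pe u A : measurable A -> measurable (eps i u @^-1` A).
  by move=> mA; rewrite -[_ @^-1` _]setTI; exact: me.
have pX u A : measurable A -> measurable ((fun w => (x i u w a 0, eps i u w)) @^-1` A).
  by move=> mA; rewrite -[_ @^-1` _]setTI; exact: mX.
have s1 A3 A4 : measurable A3 -> measurable A4 -> forall C, measurable C ->
  P ((fun w => (x i t w a 0, eps i t w)) @^-1` C `&`
    ((fun w => x i (t + tau)%N w b 0) @^-1` A3 `&` eps i (t + tau)%N @^-1` A4)) =
  P ((fun w => (x i 0%N w a 0, eps i 0%N w)) @^-1` C `&`
    ((fun w => x i (0 + tau)%N w b 0) @^-1` A3 `&` eps i (0 + tau)%N @^-1` A4)).
  move=> m3 m4; apply: pair_law => //; try by apply: measurableI; [exact: px|exact: pe].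
  by move=> A1 A2 m1 m2; exact: key.
have s2 D : measurable D -> forall C, measurable C ->
  P ((fun w => (x i (t + tau)%N w b 0, eps i (t + tau)%N w)) @^-1` C `&`
    ((fun w => (x i t w a 0, eps i t w)) @^-1` D)) =
  P ((fun w => (x i (0 + tau)%N w b 0, eps i (0 + tau)%N w)) @^-1` C `&`
    ((fun w => (x i 0%N w a 0, eps i 0%N w)) @^-1` D)).
  move=> mD; apply: pair_law => //; try exact: pX.
  by move=> A3 A4 m3 m4; rewrite ![_ `&` (_ @^-1` D)]setIC; exact: s1.
move=> C mC; rewrite -[Z t @^-1` C]setIT -[Z 0%N @^-1` C]setIT.
apply: pair_law => //.
by move=> A B mA mB; rewrite !setIT ![(fun w => (x i _ w a 0, _)) @^-1` A `&` _]setIC; exact: s2.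
Qed.

End PanelSigma.

(** * Central limit estimate for trigonometric test functions *)

Section Taylor.
Context {R : realType}.
Implicit Types x y : R.

(** The mean value theorem. In the chain of bounds on [sin] and [cos] below, each inequality is
    obtained by noting that the derivative of the difference of its sides is nonnegative by the
    preceding one. *)
Lemma ge0_of_derive (f df : R -> R) : (forall x, is_derive x 1 f (df x)) ->
  (forall x, 0 <= x -> 0 <= df x) -> f 0 = 0 -> forall x, 0 <= x -> 0 <= f x.
Proof.
move=> fdf df0 f0 x x0.
have cf : {within `[0, x], continuous f}.
  by apply: derivable_within_continuous => y _; apply: ex_derive.
have [c] := MVT_segment x0 (fun y _ => fdf y) cf.
rewrite in_itv/= f0 !subr0 => /andP[c0 _] ->.
by rewrite mulr_ge0// df0.
Qed.

Lemma sin_le x : 0 <= x -> sin x <= x.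
Proof.
move=> x0; rewrite -subr_ge0; move: x x0.
apply: (@ge0_of_derive (fun x => x - sin x) (fun x => 1 - cos x)).
- by move=> x _; rewrite subr_ge0 cos_le1.
- by rewrite sin0 subrr.
Qed.

Lemma cos_ge x : 0 <= x -> 1 - x ^+ 2 / 2 <= cos x.
Proof.
move=> x0; rewrite -subr_ge0 (_ : _ - _ = cos x + (x ^+ 2 / 2 - 1)); last by ring.
move: x x0; apply: (@ge0_of_derive _ (fun x => x - sin x)).
- move=> x; apply: is_derive_eq; rewrite /GRing.scale/=; by field.
- by move=> x x0; rewrite subr_ge0 sin_le.
- by rewrite cos0 expr0n/= mul0r sub0r subrr.
Qed.

Lemma sin_ge x : 0 <= x -> x - x ^+ 3 / 6 <= sin x.
Proof.
move=> x0; rewrite -subr_ge0 (_ : _ - _ = sin x + (x ^+ 3 / 6 - x)); last by ring.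
move: x x0; apply: (@ge0_of_derive _ (fun x => cos x - (1 - x ^+ 2 / 2))).
- move=> x; apply: is_derive_eq; rewrite /GRing.scale/=; by field.
- by move=> x x0; rewrite subr_ge0 cos_ge.
- by rewrite sin0 expr0n/= mul0r subrr add0r.
Qed.

Lemma cos_le x : 0 <= x -> cos x <= 1 - x ^+ 2 / 2 + x ^+ 4 / 24.
Proof.
move=> x0; rewrite -subr_ge0 (_ : _ - _ = (x ^+ 4 / 24 - x ^+ 2 / 2) + (1 - cos x)); last by ring.
move: x x0; apply: (@ge0_of_derive _ (fun x => sin x - (x - x ^+ 3 / 6))).
- move=> x; apply: is_derive_eq; rewrite /GRing.scale/=; by field.
- by move=> x x0; rewrite subr_ge0 sin_ge.
- by rewrite cos0 !expr0n/= !mul0r !subrr add0r.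
Qed.

Lemma expRN_le y : 0 <= y -> expR (- y) <= 1 - y + y ^+ 2 / 2.
Proof.
move=> x0; rewrite -subr_ge0 (_ : _ - _ = (y ^+ 2 / 2 - y) + (1 - expR (- y))); last by ring.
move: y x0; apply: (@ge0_of_derive _ (fun y => expR (- y) - (1 - y))).
- move=> y; apply: is_derive_eq; rewrite /GRing.scale/=; by field.
- by move=> y _; rewrite subr_ge0 expR_ge1Dx.
- by rewrite expr0n/= mul0r !oppr0 !addr0 expR0 subrr add0r.
Qed.

Lemma sin_taylor x : `|sin x - x| <= `|x| ^+ 3.
Proof.
wlog x0 : x / 0 <= x => [h|].
  have [x0|x0] := leP 0 x; first exact: h.
  have := h (- x); rewrite sinN (_ : - sin x - - x = - (sin x - x)); last by ring.
  rewrite !normrN; apply.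
  by rewrite oppr_ge0 ltW.
rewrite (ger0_norm x0).
have := sin_le x0; have := sin_ge x0; have : 0 <= x ^+ 3 by rewrite exprn_ge0.
move=> h1 h2 h3; rewrite ler_norml; apply/andP; split; lra.
Qed.

Lemma cos_taylor x : `|cos x - (1 - x ^+ 2 / 2)| <= x ^+ 4.
Proof.
wlog x0 : x / 0 <= x => [h|].
  have [x0|x0] := leP 0 x; first exact: h.
  by have := h (- x); rewrite cosN !sqrrN -[4%N]/(2 * 2)%N !exprM sqrrN; apply; rewrite oppr_ge0 ltW.
have := cos_ge x0; have := cos_le x0; have : 0 <= x ^+ 4 by rewrite exprn_ge0.
move=> h1 h2 h3; rewrite ler_norml; apply/andP; split; lra.
Qed.

Lemma expRN_taylor y : 0 <= y -> `|expR (- y) - (1 - y)| <= y ^+ 2.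
Proof.
move=> y0; have := expRN_le y0; have := expR_ge1Dx (- y); have := sqr_ge0 y.
move=> h1 h2 h3; rewrite ler_norml; apply/andP; split; lra.
Qed.

Lemma sin_norm_le x : `|sin x| <= `|x|.
Proof.
wlog x0 : x / 0 <= x => [h|].
  have [x0|x0] := leP 0 x; first exact: h.
  by have := h (- x); rewrite sinN !normrN; apply; rewrite oppr_ge0 ltW.
have [x1|x1] := leP x 1; last first.
  by apply: (le_trans (sin_max x)); rewrite ger0_norm// ltW.
rewrite (ger0_norm x0) ler_norml sin_le// andbT.
have := sin_ge x0; have : x ^+ 3 <= x.
  by rewrite !exprS expr0 mulr1 ler_piMr// mulr_ile1.
lra.
Qed.

Lemma cos_lip x y : `|cos x - cos y| <= `|x - y|.
Proof.
have -> : cos x - cos y = - (2 * sin ((x + y) / 2) * sin ((x - y) / 2)).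
  have -> : cos x = cos ((x + y) / 2 + (x - y) / 2) by congr cos; field.
  have -> : cos y = cos ((x + y) / 2 - (x - y) / 2) by congr cos; field.
  by rewrite cosD cosB; ring.
rewrite normrN !normrM (ger0_norm (_ : 0 <= 2))//.
have h1 := sin_max ((x + y) / 2); have h2 := sin_norm_le ((x - y) / 2).
have e : `|(x - y) / 2| = `|x - y| / 2 by rewrite normrM [`|2^-1|]ger0_norm.
rewrite e in h2.
have : `|sin ((x + y) / 2)| * `|sin ((x - y) / 2)| <= 1 * (`|x - y| / 2) by exact: ler_pM.
lra.
Qed.

End Taylor.

Section TrigCLT.
Context {d : measure_display} {T : measurableType d} {R : realType}.
Variable P : probability T R.

Lemma cos_meas (X : T -> R) : measurable_fun setT X -> measurable_fun setT (fun w => cos (X w)).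
Proof. by move=> mX; apply: measurableT_comp mX; apply: continuous_measurable_fun; exact: continuous_cos. Qed.

Lemma sin_meas (X : T -> R) : measurable_fun setT X -> measurable_fun setT (fun w => sin (X w)).
Proof. by move=> mX; apply: measurableT_comp mX; apply: continuous_measurable_fun; exact: continuous_sin. Qed.

Lemma ig_cos (X : T -> R) : measurable_fun setT X -> ig P (fun w => cos (X w)).
Proof. by move=> mX; apply: (@ig_bd _ _ _ _ _ 1) => [|w]; [exact: cos_meas|exact: cos_max]. Qed.

Lemma ig_sin (X : T -> R) : measurable_fun setT X -> ig P (fun w => sin (X w)).
Proof. by move=> mX; apply: (@ig_bd _ _ _ _ _ 1) => [|w]; [exact: sin_meas|exact: sin_max]. Qed.

Section OneVariable.
Variable X : T -> R.
Hypothesis mX : measurable_fun setT X.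
Hypothesis i4 : ig P (fun w => X w ^+ 4).

Lemma pow_meas k : measurable_fun setT (fun w => X w ^+ k).
Proof. exact: measurable_funX. Qed.

Lemma ig_pow3 : ig P (fun w => `|X w| ^+ 3).
Proof.
apply: (@ig_le _ _ _ _ _ (fun w => 1 + X w ^+ 4)).
- by apply: measurable_funX; exact: measurableT_comp.
- by apply: igD => //; exact: ig_cst.
- move=> w; rewrite ger0_norm ?exprn_ge0//.
  have -> : X w ^+ 4 = `|X w| ^+ 4 by rewrite -normrX ger0_norm// exprn_even_ge0.
  have : 0 <= `|X w| by []; move: (`|X w|) => y y0.
  have [y1|y1] := leP y 1.
    have := exprn_ile1 3 y0 y1; have : 0 <= y ^+ 4 by rewrite exprn_ge0.
    lra.
  have : y ^+ 3 <= y ^+ 4 by rewrite ler_eXn2l// ltW.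
  lra.
Qed.

Lemma ig_pow2 : ig P (fun w => X w ^+ 2).
Proof.
apply: (@ig_le _ _ _ _ _ (fun w => 1 + X w ^+ 4)).
- exact: pow_meas.
- by apply: igD => //; exact: ig_cst.
- move=> w; rewrite ger0_norm ?sqr_ge0// -[4%N]/(2 * 2)%N exprM.
  have := sqr_ge0 (X w ^+ 2 - 1); have := sqr_ge0 (X w); nra.
Qed.

Lemma ig_pow1 : ig P X.
Proof.
apply: (@ig_le _ _ _ _ _ (fun w => 1 + X w ^+ 2)) => //.
- by apply: igD; [exact: ig_cst|exact: ig_pow2].
- move=> w; rewrite -(@ger0_norm _ (X w ^+ 2)) ?sqr_ge0// normrX.
  have := sqr_ge0 (`|X w| - 1); have := normr_ge0 (X w); nra.
Qed.

Hypothesis EX : Ex P X = 0.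

Lemma Esin_le : `|Ex P (fun w => sin (X w))| <= Ex P (fun w => `|X w| ^+ 3).
Proof.
have -> : Ex P (fun w => sin (X w)) = Ex P (fun w => sin (X w) - X w).
  by rewrite ExB ?EX ?subr0//; [exact: ig_sin|exact: ig_pow1].
apply: Ex_norm_le => [||w]; [|exact: ig_pow3|exact: sin_taylor].
by apply: igB; [exact: ig_sin|exact: ig_pow1].
Qed.

(** Nonnegativity of the variance of X^2. *)
Lemma var_sq : (Ex P (fun w => X w ^+ 2)) ^+ 2 <= Ex P (fun w => X w ^+ 4).
Proof.
set v := Ex P _.
have : 0 <= Ex P (fun w => (X w ^+ 2 - v) ^+ 2) by apply: Ex_ge0 => w; exact: sqr_ge0.
rewrite (_ : (fun w => _) = fun w => (X w ^+ 4 - (2 * v) * X w ^+ 2) + v ^+ 2); last first.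
  by apply/funext => w; ring.
have i1 : ig P (fun w => X w ^+ 4 - (2 * v) * X w ^+ 2) by apply: igB => //; exact/igZ/ig_pow2.
rewrite (ExD i1 (ig_cst _ _)) Ex_cst ExB//; last exact/igZ/ig_pow2.
rewrite ExZ; last exact: ig_pow2.
rewrite -/v; nra.
Qed.

(** Both terms are compared with 1 - v/2, where v = E X^2: the cosine costs E X^4, the exponential
    costs v^2 / 4, which is again at most E X^4. *)
Lemma Ecos_le : `|Ex P (fun w => cos (X w)) - expR (- (Ex P (fun w => X w ^+ 2) / 2))| <=
  2 * Ex P (fun w => X w ^+ 4).
Proof.
set v := Ex P (fun w => X w ^+ 2).
have v0 : 0 <= v by apply: Ex_ge0 => w; exact: sqr_ge0.
have i1 : ig P (fun w => 1 - X w ^+ 2 / 2).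
  by apply: igB; [exact: ig_cst|apply: igZr; exact: ig_pow2].
have E1 : Ex P (fun w => 1 - X w ^+ 2 / 2) = 1 - v / 2.
  by rewrite ExB ?Ex_cst ?ExZr//; [exact: ig_pow2|exact: ig_cst|apply: igZr; exact: ig_pow2].
have h1 : `|Ex P (fun w => cos (X w)) - (1 - v / 2)| <= Ex P (fun w => X w ^+ 4).
  rewrite -E1 -ExB//; last exact: ig_cos.
  apply: Ex_norm_le => // [|w]; last exact: cos_taylor.
  by apply: igB => //; exact: ig_cos.
have h2 := expRN_taylor (divr_ge0 v0 (ler0n _ 2)).
have h3 := var_sq; rewrite -/v in h3.
have h4 : (v / 2) ^+ 2 <= Ex P (fun w => X w ^+ 4).
  by apply: le_trans h3; rewrite expr_div_n ler_pdivrMr// ler_peMr ?sqr_ge0//; lra.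
have h5 := le_trans h2 h4.
move: h1 h5; rewrite !ler_norml => /andP[? ?] /andP[? ?]; apply/andP; split; lra.
Qed.

End OneVariable.

Variables (X : nat -> T -> R) (n : nat).
Hypothesis mX : forall j, measurable_fun setT (X j).
Hypothesis i4 : forall j, ig P (fun w => X j w ^+ 4).
Hypothesis EX : forall j, Ex P (X j) = 0.
Let S j w := \sum_(i < j) X i w.
Hypothesis indcos : forall j th, (j < n)%N ->
  Ex P (fun w => cos (th + S j w) * cos (X j w)) =
  Ex P (fun w => cos (th + S j w)) * Ex P (fun w => cos (X j w)).
Hypothesis indsin : forall j th, (j < n)%N ->
  Ex P (fun w => cos (th + S j w) * sin (X j w)) =
  Ex P (fun w => cos (th + S j w)) * Ex P (fun w => sin (X j w)).

Let mS j : measurable_fun setT (S j).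
Proof. exact: measurable_sum. Qed.

Let mthS th j : measurable_fun setT (fun w => th + S j w).
Proof. exact: measurable_funD. Qed.

(* Induction on the number of summands: by the addition formula only products of
   [cos (th + S j)] with [cos (X j)] or [sin (X j)] occur, hence the weak form of independence assumed. *)
Lemma trig_clt th :
  `|Ex P (fun w => cos (th + S n w)) - expR (- (\sum_(j < n) Ex P (fun w => X j w ^+ 2) / 2)) * cos th|
  <= \sum_(j < n) (2 * Ex P (fun w => X j w ^+ 4) + Ex P (fun w => `|X j w| ^+ 3)).
Proof.
suff H j : (j <= n)%N -> forall th,
  `|Ex P (fun w => cos (th + S j w)) - expR (- (\sum_(j < j) Ex P (fun w => X j w ^+ 2) / 2)) * cos th|
  <= \sum_(j < j) (2 * Ex P (fun w => X j w ^+ 4) + Ex P (fun w => `|X j w| ^+ 3)) by exact: H.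
elim: j => [|j IH] jn {}th.
  rewrite !big_ord0 oppr0 expR0 mul1r (_ : (fun w => _) = fun=> cos th).
    by rewrite Ex_cst subrr normr0.
  by apply/funext => w; rewrite /S big_ord0 addr0.
(* The sine of th + S is written as minus a cosine with phase th + pi/2, so only quantities of the
   form cos(phase + S) remain; this is why the statement is proved for all phases at once. *)
have SE w : cos (th + S j.+1 w) = cos (th + S j w) * cos (X j w) +
    cos ((th + pi / 2) + S j w) * sin (X j w).
  rewrite /S big_ord_recr/= addrA cosD addrAC cosDpihalf; ring.
have -> : Ex P (fun w => cos (th + S j.+1 w)) =
  Ex P (fun w => cos (th + S j w)) * Ex P (fun w => cos (X j w)) +
  Ex P (fun w => cos ((th + pi / 2) + S j w)) * Ex P (fun w => sin (X j w)).
  under eq_fun do rewrite SE.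
  rewrite ExD ?indcos ?indsin//.
  - apply: (@ig_bd _ _ _ _ _ (1 * 1)).
      by apply: measurable_funM; exact: cos_meas.
    by move=> w; rewrite normrM ler_pM ?cos_max.
  - apply: (@ig_bd _ _ _ _ _ (1 * 1)).
      by apply: measurable_funM; [exact: cos_meas|exact: sin_meas].
    by move=> w; rewrite normrM ler_pM ?cos_max ?sin_max.
rewrite !big_ord_recr/= opprD expRD.
have h1 := IH (ltnW jn) th.
have h2 := Ecos_le (mX j) (i4 j).
have h3 := Esin_le (mX j) (i4 j) (EX j).
set e := expR (- \sum_(_ < j) _) in h1 *; set c := Ex P (fun w => cos (th + S j w)) in h1 *.
set sn := Ex P (fun w => sin (X j w)) in h3 *; set cn := Ex P (fun w => cos (X j w)) in h2 *.
set f := expR _ in h2 *.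
set D := \sum_(_ < j) _ in h1 *.
have e1 : 0 <= e <= 1.
  rewrite expR_ge0/= expR_le1 oppr_le0; apply: sumr_ge0 => i _.
  by rewrite divr_ge0//; apply: Ex_ge0 => w; exact: sqr_ge0.
have cn1 : `|cn| <= 1 by apply: Ex_bd => [|w]; [exact: cos_meas|exact: cos_max].
have c2 : `|Ex P (fun w => cos ((th + pi / 2) + S j w))| <= 1.
  by apply: Ex_bd => [|w]; [exact: cos_meas|exact: cos_max].
set c' := Ex P _ in c2 *.
(* Three errors: the inductive one, the replacement of E cos(X j) by its Gaussian value, and the
   sine term of third order. Each is multiplied by a factor of modulus at most 1, so errors only
   add. *)
rewrite (_ : _ - _ = (c - e * cos th) * cn + (e * cos th) * (cn - f) + c' * sn); last by ring.
apply: le_trans (ler_normD _ _) _; rewrite addrA; apply: lerD; last first.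
  by rewrite normrM -[leRHS]mul1r ler_pM.
apply: le_trans (ler_normD _ _) _; apply: lerD.
  by rewrite normrM -[leRHS]mulr1 ler_pM.
case/andP: e1 => e0 e1.
by rewrite normrM -[leRHS]mul1r ler_pM// normrM mulr_ile1// ?cos_max// ger0_norm.
Qed.

End TrigCLT.

(** * Gaussian integrals *)

Section WeightedIntegral.
Context {d : measure_display} {T : measurableType d} {R : realType}.
Variables (mu : {measure set T -> \bar R}) (ph : T -> R).
Hypothesis ph_ge0 : forall u, 0 <= ph u.
Hypothesis ph_int : mu.-integrable setT (EFin \o ph).
Hypothesis ph_1 : \int[mu]_u ph u = 1.
Implicit Types F G : T -> R.

Definition wE F := \int[mu]_u (F u * ph u).

Definition bmeas F := measurable_fun setT F /\ exists M, forall u, `|F u| <= M.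

Lemma wint F : bmeas F -> mu.-integrable setT (EFin \o (fun u => F u * ph u)).
Proof.
move=> [mF [M bM]]; apply: (@le_integrable _ _ _ _ _ _ _ (EFin \o (fun u => M * ph u))) => //.
- apply/measurable_EFinP; apply: measurable_funM => //.
  exact/measurable_EFinP/(measurable_int mu ph_int).
- move=> u _; rewrite /= lee_fin !normrM.
  by rewrite ler_wpM2r// (le_trans (bM u))// ler_norm.
- exact: (integrableZl measurableT M ph_int).
Qed.

Lemma bmeas_cst c : bmeas (fun=> c).
Proof. by split=> //; exists `|c|. Qed.

Lemma wED F G : bmeas F -> bmeas G -> wE (fun u => F u + G u) = wE F + wE G.
Proof.
move=> bF bG; rewrite /wE -RintegralD//; [|exact: wint..].
by apply: eq_Rintegral => u _; rewrite mulrDl.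
Qed.

Lemma wEZ c F : bmeas F -> wE (fun u => c * F u) = c * wE F.
Proof.
move=> bF; rewrite /wE -RintegralZl//; last exact: wint.
by apply: eq_Rintegral => u _; rewrite mulrA.
Qed.

Lemma wE_cst c : wE (fun=> c) = c.
Proof. by rewrite /wE RintegralZl ?ph_1 ?mulr1//; exact: ph_int. Qed.

Lemma wE_le F G : bmeas F -> bmeas G -> (forall u, F u <= G u) -> wE F <= wE G.
Proof.
move=> bF bG FG; apply: le_Rintegral => //; [exact: wint..|].
by move=> u _; rewrite ler_wpM2r// ph_ge0.
Qed.

Lemma wE_bd F (M : R) : measurable_fun setT F -> (forall u, `|F u| <= M) -> `|wE F| <= M.
Proof.
move=> mF bM; have bF : bmeas F by split=> //; exists M.
rewrite ler_norml -[- M]wE_cst -[X in _ && (_ <= X)]wE_cst; apply/andP; split.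
  by apply: wE_le => // [|u]; [exact: bmeas_cst|have := bM u; rewrite ler_norml => /andP[]].
by apply: wE_le => // [|u]; [exact: bmeas_cst|have := bM u; rewrite ler_norml => /andP[]].
Qed.

Lemma Rint_dct (f : nat -> T -> R) (f0 g : T -> R) : (forall n, measurable_fun setT (f n)) ->
  measurable_fun setT f0 -> mu.-integrable setT (EFin \o g) ->
  (forall n u, `|f n u| <= g u) -> (forall u, f n u @[n --> \oo] --> f0 u) ->
  \int[mu]_u f n u @[n --> \oo] --> \int[mu]_u f0 u.
Proof.
move=> mf mf0 ig fg cf.
have fg0 u : `|f0 u| <= g u.
  have h : `|f n u| @[n --> \oo] --> `|f0 u| by apply: cvg_norm; exact: cf.
  rewrite -(cvg_lim _ h)//; apply: limr_le; first by apply/cvg_ex; eexists; exact: h.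
  by apply: nearW => n; exact: fg.
have if0 : mu.-integrable setT (EFin \o f0).
  apply: le_integrable ig => //; first exact/measurable_EFinP.
  by move=> u _; rewrite /= lee_fin (le_trans (fg0 u))// ler_norm.
apply: fine_cvg; rewrite fineK; last exact: integrable_fin_num.
apply: (@dominated_cvg _ _ _ mu setT measurableT (fun n w => (f n w)%:E) _ (EFin \o g)) => //=.
- by move=> n; exact/measurable_EFinP.
- by move=> w _; apply: cvg_EFin; [exact: nearW | exact: cf].
- by move=> n w _; rewrite lee_fin fg.
Qed.

Lemma wE_dct (F : nat -> T -> R) F0 M : (forall n, measurable_fun setT (F n)) ->
  measurable_fun setT F0 -> (forall n u, `|F n u| <= M) ->
  (forall u, F n u @[n --> \oo] --> F0 u) -> wE (F n) @[n --> \oo] --> wE F0.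
Proof.
move=> mF mF0 bM cF.
have mphi : measurable_fun setT ph by exact/measurable_EFinP/(measurable_int mu ph_int).
apply: (@Rint_dct _ _ (fun u => M * ph u)).
- by move=> n; exact: measurable_funM.
- exact: measurable_funM.
- exact: (integrableZl measurableT M ph_int).
- by move=> n u; rewrite normrM [`|ph u|]ger0_norm ?ph_ge0// ler_wpM2r// ph_ge0.
- by move=> u; apply: cvgM; [exact: cF|exact: cvg_cst].
Qed.


End WeightedIntegral.

Section Gaussian1.
Context {R : realType}.
Notation mu := (@lebesgue_measure R).
Implicit Types (F : R -> R).

Definition phi (u : R) : R := expR (- (u ^+ 2) / 2) / Num.sqrt (2 * pi).

Lemma sqrt2pi_gt0 : 0 < Num.sqrt (2 * pi) :> R.
Proof. by rewrite sqrtr_gt0 mulr_gt0// pi_gt0. Qed.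

Lemma phiE : phi = normal_pdf 0 1.
Proof.
apply/funext => u; rewrite normal_pdfE ?oner_eq0// /phi /normal_peak /normal_fun.
by rewrite subr0 !expr1n mul1r mulrC -[pi *+ 2]mulr_natl.
Qed.

Lemma phi_ge0 u : 0 <= phi u.
Proof. by rewrite divr_ge0 ?expR_ge0// ltW// sqrt2pi_gt0. Qed.

Lemma phi_cont : continuous phi.
Proof. by rewrite phiE; apply: continuous_normal_pdf; exact: oner_neq0. Qed.

Lemma phi_int : mu.-integrable setT (EFin \o phi).
Proof. by rewrite phiE; exact: integrable_normal_pdf. Qed.

Lemma phi_1 : \int[mu]_u phi u = 1.
Proof. by rewrite phiE /Rintegral integral_normal_pdf. Qed.

Definition gE F := wE mu phi F.

Lemma bmeas_cont F : continuous F -> (exists M, forall u, `|F u| <= M) ->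
  bmeas (F : measurableTypeR R -> R).
Proof. by move=> cF bF; split=> //; exact: continuous_measurable_fun. Qed.



Lemma aff_derive (c s x : R) : is_derive x 1 (fun g : R => c + s * g) s.
Proof. by apply: is_derive_eq; rewrite /GRing.scale/=; ring. Qed.

Lemma cmeas F : continuous F -> measurable_fun setT (F : measurableTypeR R -> R).
Proof. by move=> cF; exact: continuous_measurable_fun. Qed.

Lemma gauss_exp_cont (l m : R) : continuous (fun u : R => expR (- (m * (u + l) ^+ 2) / 2)).
Proof.
move=> x; apply: (@continuous_comp _ _ _ (fun u : R => - (m * (u + l) ^+ 2) / 2) expR); last exact: continuous_expR.
apply: cvgM; last exact: cvg_cst.
apply: cvgN; apply: cvgM; first exact: cvg_cst.
apply: (@continuous_comp _ _ _ (fun u : R => u + l) (fun y : R => y ^+ 2)).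
  by apply: cvgD; [exact: cvg_id|exact: cvg_cst].
exact: exprn_continuous.
Qed.

(** The substitution u = - l + g / sqrt m reduces a Gaussian weight with precision m and centre - l
    to the standard one. The integral is stated in the extended reals for nonnegative G, so that it
    yields integrability as well as the value. *)
Lemma gE_subst_ge0 (G : R -> R) (l m M : R) : continuous G -> 0 < m ->
  (forall u, 0 <= G u) -> (forall u, G u <= M) ->
  (\int[mu]_u (G u * expR (- (m * (u + l) ^+ 2) / 2))%:E =
   (Num.sqrt (2 * pi / m) * gE (fun g => G (- l + (Num.sqrt m)^-1 * g)))%:E)%E.
Proof.
move=> cG m0 G0 GM.
set s := (Num.sqrt m)^-1.
have s0 : 0 < s by rewrite invr_gt0 sqrtr_gt0.
have ms : m * s ^+ 2 = 1 by rewrite exprVn sqr_sqrtr ?ltW// divff// gt_eqF.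
pose A (g : R) : R := (g - l / s) * s.
have AE g : A g = - l + s * g by rewrite /A mulrBl divfK ?gt_eqF// addrC mulrC.
have cA : continuous A by move=> x; apply: cvgM; [apply: cvgB; [exact: cvg_id|exact: cvg_cst]|exact: cvg_cst].
have dA (x : R) : is_derive x (1 : R) A s.
  have := aff_derive (- l) s x; rewrite (_ : A = fun g : R => - l + s * g)//.
  by apply/funext => g; rewrite AE.
have A' : derive1 A = cst s by apply/funext => x; rewrite derive1E derive_val.
rewrite (@increasing_ge0_integration_by_substitutionT _ A); last first.
- by move=> u; rewrite mulr_ge0 ?expR_ge0.
- by move=> u; apply: cvgM; [exact: cG|exact: gauss_exp_cont].
- by apply/gt0_cvgMly; [|exact: cvg_addrr].
- by apply/gt0_cvgMlNy; [|exact: cvg_addrr_Ny].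
- by move=> x; apply: ex_derive.
- by rewrite A'; exact: is_cvg_cst.
- by rewrite A'; exact: is_cvg_cst.
- by rewrite A' => x; exact: cvg_cst.
- by move=> x y xy; rewrite ltr_pM2r// ltrD2r.
have bGA : bmeas ((fun g => G (- l + s * g)) : measurableTypeR R -> R).
  apply: bmeas_cont => [x|]; last by exists M => u; rewrite ger0_norm.
  under eq_fun do rewrite -AE.
  by apply: (@continuous_comp _ _ _ A G); [exact: cA|exact: cG].
rewrite (eq_integral (fun x : measurableTypeR R => ((Num.sqrt (2 * pi / m))%:E * (G (- l + s * x) * phi x)%:E)%E)).
  rewrite integralZl//; last exact: (wint phi_int).
  by rewrite EFinM /gE /wE /Rintegral fineK//; apply: integrable_fin_num => //; exact: (wint phi_int).
move=> x _; rewrite -EFinM; congr EFin.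
have e1 : m * (- l + s * x + l) ^+ 2 = x ^+ 2.
  by rewrite [- l + _]addrC addrNK exprMn mulrA ms mul1r.
have e2 : Num.sqrt (2 * pi / m) = Num.sqrt (2 * pi) * s.
  by rewrite sqrtrM ?mulr_ge0 ?pi_ge0// sqrtrV ?ltW.
rewrite !fctE A' AE e1 e2 /phi /cst.
have := sqrt2pi_gt0; move: (Num.sqrt (2 * pi)) (G _) (expR _) => q a b q0.
by field; rewrite gt_eqF.
Qed.

(** Adding the bound M makes F nonnegative; the nonnegative case is applied to F + M and to the
    constant M, and the results are subtracted. *)
Lemma gE_subst (F : R -> R) (l m M : R) : continuous F -> (forall u, `|F u| <= M) -> 0 < m ->
  \int[mu]_u (F u * expR (- (m * (u + l) ^+ 2) / 2)) =
  Num.sqrt (2 * pi / m) * gE (fun g => F (- l + (Num.sqrt m)^-1 * g)).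
Proof.
move=> cF bM m0.
set s := (Num.sqrt m)^-1.
have Mge0 : 0 <= M by apply: le_trans (bM 0).
have cFM : continuous (fun u => F u + M) by move=> x; apply: cvgD; [exact: cF|exact: cvg_cst].
have h1 := @gE_subst_ge0 (fun u => F u + M) l m (2 * M) cFM m0.
have cM : continuous (fun _ : R => M) by move=> x; exact: cvg_cst.
have h2 := @gE_subst_ge0 (fun=> M) l m M cM m0 (fun=> Mge0) (fun=> lexx _).
have FM0 u : 0 <= F u + M by have := bM u; rewrite ler_norml => /andP[]; lra.
have FM2 u : F u + M <= 2 * M by have := bM u; rewrite ler_norml => /andP[]; lra.
have {}h1 := h1 FM0 FM2.
have mE : measurable_fun setT ((fun u : R => expR (- (m * (u + l) ^+ 2) / 2)) : measurableTypeR R -> R).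
  exact: (continuous_measurable_fun (@gauss_exp_cont l m)).
have mFM : measurable_fun setT ((fun u => F u + M) : measurableTypeR R -> R).
  exact: (continuous_measurable_fun cFM).
have ii (G : measurableTypeR R -> R) (z : R) : (forall u, 0 <= G u) -> measurable_fun setT G ->
   (\int[mu]_u (G u)%:E = z%:E)%E -> mu.-integrable setT (EFin \o G).
  move=> G0 mG Gz; apply/integrableP; split; first exact/measurable_EFinP.
  under eq_integral => u _ do rewrite /= ger0_norm//.
  by rewrite Gz ltry.
have i1 : mu.-integrable setT (EFin \o (fun u => (F u + M) * expR (- (m * (u + l) ^+ 2) / 2))).
  apply: ii h1 => [u|]; first by rewrite mulr_ge0 ?expR_ge0.
  exact: measurable_funM.
have i2 : mu.-integrable setT (EFin \o (fun u => M * expR (- (m * (u + l) ^+ 2) / 2))).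
  apply: ii h2 => [u|]; first by rewrite mulr_ge0 ?expR_ge0.
  exact: measurable_funM.
have -> : \int[mu]_u (F u * expR (- (m * (u + l) ^+ 2) / 2)) =
   \int[mu]_u ((F u + M) * expR (- (m * (u + l) ^+ 2) / 2) - M * expR (- (m * (u + l) ^+ 2) / 2)).
  by apply: eq_Rintegral => u _; rewrite mulrDl addrK.
rewrite RintegralB// /Rintegral h1 h2 /= -mulrBr; congr (_ * _).
have bF : bmeas ((fun g => F (- l + s * g)) : measurableTypeR R -> R).
  apply: bmeas_cont; last by exists M => u.
  move=> x; apply: (@continuous_comp _ _ _ (fun g => - l + s * g) F); last exact: cF.
  by apply: cvgD; [exact: cvg_cst|apply: cvgM; [exact: cvg_cst|exact: cvg_id]].
rewrite /gE (wED phi_int bF (bmeas_cst _)) (wE_cst phi_int phi_1).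
by rewrite addrK.
Qed.

(** Since |v| <= exp(v^2 / 4), the factor |v| is paid for by half of the exponent; what is left is a
    Gaussian weight of precision 1/2. *)
Lemma phi_bd_int : mu.-integrable setT (EFin \o (fun u => `|u| * phi u)).
Proof.
have mphi : measurable_fun setT (phi : measurableTypeR R -> R).
  by exact: (continuous_measurable_fun phi_cont).
have c1 : continuous (fun _ : R => 1 : R) by move=> x; exact: cvg_cst.
have p2 : 0 < 2^-1 :> R by rewrite invr_gt0.
have h1 := @gE_subst_ge0 (fun=> 1) 0 (2^-1) 1 c1 p2 (fun=> ler01) (fun=> lexx _).
have i1 : mu.-integrable setT (EFin \o (fun u : R => 1 * expR (- (2^-1 * (u + 0) ^+ 2) / 2))).
  apply/integrableP; split.
    by apply/measurable_EFinP; apply: measurable_funM => //; exact: (continuous_measurable_fun (@gauss_exp_cont 0 2^-1)).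
  under eq_integral => u _ do rewrite /= ger0_norm ?mulr_ge0 ?expR_ge0//.
  by rewrite h1 ltry.
have i2 := integrableZl measurableT (Num.sqrt (2 * pi))^-1 i1.
apply: le_integrable i2 => //.
  have cn : continuous (fun u : R => `|u| * phi u).
    by move=> x; apply: cvgM; [exact: norm_continuous|exact: phi_cont].
  by apply/measurable_EFinP; exact: cmeas cn.
have key (v : R) : `|v| * phi v <= (Num.sqrt (2 * pi))^-1 * (1 * expR (- (2^-1 * (v + 0) ^+ 2) / 2)).
  have h2 : `|v| <= expR (v ^+ 2 / 4).
    have := expR_ge1Dx (v ^+ 2 / 4); have := sqr_ge0 (`|v| / 2 - 1).
    rewrite sqrrB expr_div_n real_normK ?num_real//; have := normr_ge0 v; lra.
  rewrite mul1r addr0 /phi mulrA mulrC ler_wpM2l ?invr_ge0 ?sqrtr_ge0//.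
  apply: (@le_trans _ _ (expR (v ^+ 2 / 4) * expR (- v ^+ 2 / 2))).
    by rewrite ler_wpM2r ?expR_ge0.
  by rewrite -expRD le_eqVlt; apply/orP; left; apply/eqP; congr expR; field.
move=> u _; rewrite /= lee_fin ger0_norm; last by rewrite mulr_ge0 ?phi_ge0.
exact: le_trans (key u) (ler_norm _).
Qed.

Lemma phi_derive (x : R) : is_derive x (1 : R) phi (- x * phi x).
Proof.
rewrite /phi; apply: is_derive_eq; rewrite /GRing.scale/=.
by field; rewrite gt_eqF// sqrt2pi_gt0.
Qed.

Lemma phi_le (n : nat) : phi n%:R <= 2 * (Num.sqrt (2 * pi))^-1 * (n.+1%:R)^-1.
Proof.
have q0 := sqrt2pi_gt0.
have h : expR (- n%:R ^+ 2 / 2) <= 2 / n.+1%:R :> R.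
  have h0 : n.+1%:R / 2 <= expR (n%:R ^+ 2 / 2) :> R.
    apply: le_trans (expR_ge1Dx _); rewrite -natr1.
    have := sqr_ge0 (n%:R - 1 : R); have := ler0n R n; nra.
  by rewrite mulNr expRN -[2 / _]invf_div lef_pV2 ?posrE ?expR_gt0 ?divr_gt0.
rewrite /phi (_ : 2 * _ * _ = (2 / n.+1%:R) * (Num.sqrt (2 * pi))^-1); last by ring.
by rewrite ler_wpM2r// invr_ge0 ltW.
Qed.

Definition cosH (th sg : R) := gE (fun u => cos (th + sg * u)).

Lemma usin_int (th sg : R) :
  mu.-integrable setT (EFin \o (fun u : R => u * sin (th + sg * u) * phi u)).
Proof.
have c1 : continuous (fun u : R => u * sin (th + sg * u) * phi u).
  move=> x; apply: cvgM; last exact: phi_cont.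
  apply: cvgM; first exact: cvg_id.
  apply: (@continuous_comp _ _ _ (fun u : R => th + sg * u) sin); last exact: continuous_sin.
  by apply: cvgD; [exact: cvg_cst|apply: cvgM; [exact: cvg_cst|exact: cvg_id]].
apply: le_integrable phi_bd_int => //; first by apply/measurable_EFinP; exact: cmeas c1.
move=> u _; rewrite /= lee_fin !normrM normr_id ler_wpM2r//.
by rewrite ler_piMr// sin_max.
Qed.

Lemma cosb (th sg : R) : bmeas ((fun u : R => cos (th + sg * u)) : measurableTypeR R -> R).
Proof.
apply: bmeas_cont; last by exists 1 => u; exact: cos_max.
move=> x; apply: (@continuous_comp _ _ _ (fun u : R => th + sg * u) cos); last exact: continuous_cos.
by apply: cvgD; [exact: cvg_cst|apply: cvgM; [exact: cvg_cst|exact: cvg_id]].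
Qed.

(* Gaussian integration by parts: the integrand is the derivative of sin (th + sg u) phi u. *)
Lemma stein (th sg : R) : \int[mu]_u (u * sin (th + sg * u) * phi u) = sg * cosH th sg.
Proof.
pose F (u : R) := sin (th + sg * u) * phi u.
pose f (u : R) := sg * (cos (th + sg * u) * phi u) - u * sin (th + sg * u) * phi u.
have dF (x : R) : is_derive x (1 : R) F (f x).
  have h := phi_derive x.
  rewrite /F; apply: is_derive_eq; rewrite /f /GRing.scale/=; ring.
have cF : continuous F.
  by move=> x; apply: differentiable_continuous; apply/derivable1_diffP; apply: ex_derive.
have cf : continuous f.
  move=> x; apply: cvgB.
    apply: cvgM; first exact: cvg_cst.
    apply: cvgM; last exact: phi_cont.
    apply: (@continuous_comp _ _ _ (fun u : R => th + sg * u) cos); last exact: continuous_cos.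
    by apply: cvgD; [exact: cvg_cst|apply: cvgM; [exact: cvg_cst|exact: cvg_id]].
  apply: cvgM; last exact: phi_cont.
  apply: cvgM; first exact: cvg_id.
  apply: (@continuous_comp _ _ _ (fun u : R => th + sg * u) sin); last exact: continuous_sin.
  by apply: cvgD; [exact: cvg_cst|apply: cvgM; [exact: cvg_cst|exact: cvg_id]].
have ic : mu.-integrable setT (EFin \o (fun u => cos (th + sg * u) * phi u)) by by apply: wint; [exact: phi_int|exact: cosb].
have ic' := integrableZl measurableT sg ic.
have if_ : mu.-integrable setT (EFin \o f).
  exact: (integrableB measurableT ic' (usin_int th sg)).
have intf : \int[mu]_u f u = sg * cosH th sg - \int[mu]_u (u * sin (th + sg * u) * phi u).
  rewrite /f RintegralB//; last exact: usin_int.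
  by rewrite RintegralZl.
suff : \int[mu]_u f u = 0 by rewrite intf => /eqP; rewrite subr_eq0 eq_sym => /eqP.
(* The integral of a derivative over [-n-1, n+1] is a boundary term, of order 1/n by [phi_le]; by
   dominated convergence the integral over the line vanishes. *)
have FTC (n : nat) : \int[mu]_(u in `[- n.+1%:R, n.+1%:R]) f u = F n.+1%:R - F (- n.+1%:R).
  have nn : - n.+1%:R < n.+1%:R :> R by rewrite -subr_gt0 opprK addr_gt0.
  rewrite /Rintegral (@continuous_FTC2 _ f F _ _ nn)//.
  - exact: continuous_subspaceT.
  - split=> [x _||]; first by apply: ex_derive.
      by apply: cvg_at_right_filter; exact: cF.
    by apply: cvg_at_left_filter; exact: cF.
  - by move=> x _; rewrite derive1E derive_val.
have cv1 : \int[mu]_(u in `[- n.+1%:R, n.+1%:R]) f u @[n --> \oo] --> \int[mu]_u f u.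
  under eq_fun do rewrite Rintegral_mkcond.
  apply: (@Rint_dct _ _ _ mu _ _ (fun u => `|f u|)).
  - move=> n; apply/(measurable_restrictT _ _).1 => //.
    by apply: measurable_funTS; exact: (continuous_measurable_fun cf).
  - exact: (continuous_measurable_fun cf).
  - exact: integrable_norm.
  - by move=> n u; rewrite /patch; case: ifP => _; rewrite ?normr0.
  - move=> u; apply: cvg_near_cst; near=> n; rewrite /patch ifT//.
    rewrite inE/= in_itv/= -ler_norml.
    near: n; exists (Num.truncn `|u|) => // n /= hn.
    by apply: le_trans (ltW (truncnS_gt _)) _; rewrite ler_nat ltnS.
have cv2 : \int[mu]_(u in `[- n.+1%:R, n.+1%:R]) f u @[n --> \oo] --> (0 : R).
  under eq_fun do rewrite FTC.
  have b n : `|F n.+1%:R - F (- n.+1%:R)| <= 4 * (Num.sqrt (2 * pi))^-1 * n.+1%:R^-1.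
    have e : phi (- n.+1%:R) = phi n.+1%:R by rewrite /phi sqrrN.
    have p0 := phi_ge0 n.+1%:R.
    have pn : `|phi n.+1%:R| = phi n.+1%:R by rewrite ger0_norm.
    apply: le_trans (ler_normB _ _) _.
    rewrite /F e [X in X + _]normrM [X in _ + X]normrM pn.
    have h1 : `|sin (th + sg * n.+1%:R)| * phi n.+1%:R <= 1 * phi n.+1%:R by rewrite ler_wpM2r// sin_max.
    have h2 : `|sin (th + sg * - n.+1%:R)| * phi n.+1%:R <= 1 * phi n.+1%:R by rewrite ler_wpM2r// sin_max.
    have h3 := phi_le n.+1.
    have h4 : 2 * (Num.sqrt (2 * pi))^-1 * n.+2%:R^-1 <= 2 * (Num.sqrt (2 * pi))^-1 * n.+1%:R^-1 :> R.
      by rewrite ler_wpM2l ?mulr_ge0 ?invr_ge0 ?sqrtr_ge0// lef_pV2 ?posrE// ler_nat.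
    rewrite (_ : 4 * (Num.sqrt (2 * pi))^-1 * n.+1%:R^-1 = 2 * (Num.sqrt (2 * pi))^-1 * n.+1%:R^-1 +
      2 * (Num.sqrt (2 * pi))^-1 * n.+1%:R^-1); last by ring.
    rewrite mul1r in h1 h2.
    exact: lerD (le_trans h1 (le_trans h3 h4)) (le_trans h2 (le_trans h3 h4)).
  apply: norm_cvg0.
  apply: (@squeeze_cvgr _ _ _ _ (fun=> 0) (fun n => 4 * (Num.sqrt (2 * pi))^-1 * n.+1%:R^-1)).
  - by near=> n; rewrite normr_ge0 b.
  - exact: cvg_cst.
  - rewrite -[X in _ --> X](mulr0 (4 * (Num.sqrt (2 * pi))^-1)).
    by apply: cvgM; [exact: cvg_cst|exact: cvg_harmonic].
exact: (cvg_unique _ cv1 cv2).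
Unshelve. all: by end_near.
Qed.

(** Differentiating under the integral, with dominating function |u| phi(u), produces - u sin(th +
    sg u), which [stein] turns back into [cosH]. The outcome is the linear differential equation
    solved by exp(- sg^2 / 2). *)
Lemma cosH_derive (th sg : R) : is_derive sg (1 : R) (cosH th) (- sg * cosH th sg).
Proof.
pose f (s u : R) := cos (th + s * u) * phi u.
have df (s u : R) : is_derive s (1 : R) (f ^~ u) (- (u * sin (th + s * u) * phi u)).
  rewrite /f; apply: is_derive_eq; rewrite /GRing.scale/=; ring.
have E (s u : R) : partial1of2 f s u = - (u * sin (th + s * u) * phi u).
  by rewrite partial1of2E; apply: derive_val.
have I : sg \in `]sg - 1, sg + 1[ by rewrite in_itv/= ltrBlDr !ltrDl ltr01.
have intf s : sg - 1 < s < sg + 1 -> mu.-integrable setT (EFin \o f s).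
  by move=> _; apply: wint; [exact: phi_int|exact: cosb].
have H := @cvg_differentiation_under_integral R _ _ mu f setT measurableT sg (sg - 1) (sg + 1).
have {}H : h^-1 *: (cosH th (h + sg) - cosH th sg) @[h --> 0^'] --> - sg * cosH th sg.
  have -> : - sg * cosH th sg = \int[mu]_(y in setT) partial1of2 f sg y.
    rewrite mulNr -stein -mulN1r -RintegralZl//; last exact: usin_int.
    by apply: eq_Rintegral => u _; rewrite E mulN1r.
  apply: (H _ _ _ (fun u => `|u| * phi u)) => //.
  - by move=> u; rewrite mulr_ge0 ?phi_ge0.
  - exact: phi_bd_int.
  - move=> s u _ _; rewrite E normrN normrM (ger0_norm (phi_ge0 u)).
    by rewrite ler_wpM2r ?phi_ge0// normrM ler_piMr// sin_max.
have H' : h^-1 *: ((cosH th \o shift sg) (h *: (1 : R)) - cosH th sg) @[h --> 0^'] --> - sg * cosH th sg.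
  by under eq_fun => h do rewrite /= /GRing.scale/= mulr1.
apply: DeriveDef; first by apply/cvg_ex; eexists; exact: H'.
by rewrite /derive; exact: (cvg_lim _ H').
Qed.

(** The integrating factor exp(s^2 / 2) makes [k] constant, and its value at s = 0 is cos th. *)
Lemma gcos (th sg : R) : gE (fun u => cos (th + sg * u)) = expR (- (sg ^+ 2) / 2) * cos th.
Proof.
pose k s := cosH th s * expR (s ^+ 2 / 2).
have dk (s : R) : is_derive s (1 : R) k 0.
  have h := cosH_derive th s.
  rewrite /k; apply: is_derive_eq; rewrite /GRing.scale/=; by field.
have := is_derive_0_is_cst sg 0 dk.
rewrite /k expr0n/= mul0r expR0 mulr1 => h.
have c0 : cosH th 0 = cos th.
  rewrite /cosH (_ : (fun u => _) = fun=> cos th); first exact: wE_cst phi_int phi_1 _.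
  by apply/funext => u; rewrite mul0r addr0.
rewrite -c0 -h mulrCA mulNr expRN [X in _ * X]mulVf ?mulr1//.
by rewrite gt_eqF// expR_gt0.
Qed.


Lemma gED (F G : measurableTypeR R -> R) : bmeas F -> bmeas G -> gE (fun u => F u + G u) = gE F + gE G.
Proof. by move=> bF bG; apply: wED => //; exact: phi_int. Qed.

Lemma gEZ c (F : measurableTypeR R -> R) : bmeas F -> gE (fun u => c * F u) = c * gE F.
Proof. by move=> bF; apply: wEZ => //; exact: phi_int. Qed.

Lemma gE_cst c : gE (fun=> c) = c.
Proof. by apply: wE_cst; [exact: phi_int|exact: phi_1]. Qed.

Lemma gE_le (F G : measurableTypeR R -> R) : bmeas F -> bmeas G -> (forall u, F u <= G u) -> gE F <= gE G.
Proof. by move=> bF bG FG; apply: wE_le => //; [exact: phi_ge0|exact: phi_int]. Qed.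

Lemma gE_bd (F : measurableTypeR R -> R) M : bmeas F -> (forall u, `|F u| <= M) -> `|gE F| <= M.
Proof. by move=> [mF _] bM; apply: wE_bd => //; [exact: phi_ge0|exact: phi_int|exact: phi_1]. Qed.

Lemma gE_dct (F : nat -> measurableTypeR R -> R) F0 M : (forall n, bmeas (F n)) -> bmeas F0 ->
  (forall n u, `|F n u| <= M) ->
  (forall u, F n u @[n --> \oo] --> F0 u) -> gE (F n) @[n --> \oo] --> gE F0.
Proof.
move=> bF [mF0 _] bM cF; apply: (wE_dct _ _ (M := M)) => //; [exact: phi_ge0|exact: phi_int|].
by move=> n; have [] := bF n.
Qed.

End Gaussian1.

Lemma cvg_sumR {R : realType} I (r : seq I) (Q : pred I) (f : I -> nat -> R) (l : I -> R) :
  (forall i, Q i -> f i n @[n --> \oo] --> l i) ->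
  \sum_(i <- r | Q i) f i n @[n --> \oo] --> \sum_(i <- r | Q i) l i.
Proof.
move=> h; elim: r => [|i r IH].
  by rewrite big_nil; under eq_fun do rewrite big_nil; exact: cvg_cst.
rewrite big_cons; under eq_fun do rewrite big_cons.
by case: ifPn => // Qi; apply: cvgD => //; exact: h.
Qed.

(** * Iterated Gaussian integrals in K dimensions *)

Section GaussianK.
Context {R : realType} (K : nat).
Notation mu := (@lebesgue_measure R).
Notation V := ('cV[R]_K).
Implicit Types (f F G : V -> R) (v : V).

(** Sequential, coordinatewise continuity. This is the form that dominated convergence consumes and
    reproduces, so the class [BC] is stable under integrating out a coordinate. *)
Definition scont F := forall (vn : nat -> V) v,
  (forall j, vn n j 0 @[n --> \oo] --> v j 0) -> F (vn n) @[n --> \oo] --> F v.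

Definition BC F := scont F /\ exists M, forall v, `|F v| <= M.

Lemma cvg_cV (vn : nat -> V) v : (forall j, vn n j 0 @[n --> \oo] --> v j 0) -> vn n @[n --> \oo] --> v.
Proof.
move=> h; apply/cvg_ballP => e e0.
have H (j : 'I_K) : exists N, forall n, (N <= n)%N -> ball (v j 0) e (vn n j 0).
  have /cvg_ballP/(_ e e0)[N _ HN] := h j.
  by exists N => n Nn; exact: HN.
have [N HN] := choice H.
exists (\max_(j < K) N j)%N => // n /= Nn.
split=> // i j; rewrite ord1; apply: HN; apply: leq_trans Nn.
exact: leq_bigmax.
Qed.

Lemma continuous_scont F : continuous F -> scont F.
Proof.
move=> cF vn v h; apply: (@cvg_comp _ _ _ vn F _ (nbhs v)); last exact: cF.
exact: cvg_cV.
Qed.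

Definition upd (k : nat) v (u : R) : V := \col_j (if (j : nat) == k then u else v j 0).

Lemma seq_continuous (h : R -> R) :
  (forall (un : nat -> R) u, un n @[n --> \oo] --> u -> h (un n) @[n --> \oo] --> h u) -> continuous h.
Proof. by move=> H u; apply/(@cvg_nbhsP R R^o) => un; exact: H. Qed.

Lemma scont_upd F k v (a b : R) : scont F -> continuous (fun g => F (upd k v (a + b * g))).
Proof.
move=> cF; apply: seq_continuous => un u cu; apply: cF => j; rewrite !mxE.
under eq_fun do rewrite mxE.
case: eqP => _; last exact: cvg_cst.
by apply: cvgD; [exact: cvg_cst|apply: cvgM; [exact: cvg_cst|]].
Qed.

Variables (L : 'M[R]_K) (m : 'I_K -> R).
Hypothesis L0 : forall i j : 'I_K, (j < i)%N -> L i j = 0.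
Hypothesis L1 : forall i, L i i = 1.
Hypothesis m0 : forall i, 0 < m i.

Definition lin (i : 'I_K) v := (L *m v) i 0.

Lemma linE i v : lin i v = \sum_j L i j * v j 0.
Proof. by rewrite /lin mxE. Qed.

Lemma lin_upd_gt (k : nat) (i : 'I_K) v u : (k < i)%N -> lin i (upd k v u) = lin i v.
Proof.
move=> ki; rewrite !linE; apply: eq_bigr => j _; rewrite mxE.
by case: eqP => // jk; rewrite L0 ?mul0r// jk.
Qed.

Lemma lin_upd (k : 'I_K) v u : lin k (upd k v u) = u + (lin k v - v k 0).
Proof.
rewrite !linE (bigD1 k)//= [in RHS](bigD1 k)//= L1 !mul1r mxE eqxx.
rewrite [v k 0 + _]addrC addrK; congr (_ + _); apply: eq_bigr => j jk.
by rewrite mxE; case: eqP => // /val_inj e; rewrite e eqxx in jk.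
Qed.

Lemma lin_cvg (vn : nat -> V) v i : (forall j, vn n j 0 @[n --> \oo] --> v j 0) ->
  lin i (vn n) @[n --> \oo] --> lin i v.
Proof.
move=> h; rewrite linE; under eq_fun do rewrite linE.
apply: cvg_sumR => j _; apply: cvgM; [exact: cvg_cst|exact: h].
Qed.

(* The density of N(0, U) factors along [invmx U = L^T *m diag m *m L] with [L] unit upper triangular: [Bop k]
   integrates coordinate [k] against its conditional law given the later coordinates, and [Nop k] iterates
   this over the coordinates below [k]. *)
Definition Bop (k : 'I_K) F v :=
  gE (fun g => F (upd k v (- (lin k v - v k 0) + (Num.sqrt (m k))^-1 * g))).

Lemma Bop_bmeas (k : 'I_K) F v : BC F ->
  bmeas ((fun g => F (upd k v (- (lin k v - v k 0) + (Num.sqrt (m k))^-1 * g))) : measurableTypeR R -> R).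
Proof.
move=> [cF [M bM]]; apply: bmeas_cont; last by exists M => g.
exact: scont_upd.
Qed.

Lemma Bop_bd k F v (M : R) : BC F -> (forall v, `|F v| <= M) -> `|Bop k F v| <= M.
Proof.
move=> bF bM; apply: gE_bd => [|g]; last exact: bM.
exact: Bop_bmeas.
Qed.

Lemma upd_cvg k (vn : nat -> V) v (un : nat -> R) u :
  (forall j, vn n j 0 @[n --> \oo] --> v j 0) -> un n @[n --> \oo] --> u ->
  forall j, upd k (vn n) (un n) j 0 @[n --> \oo] --> upd k v u j 0.
Proof.
move=> h hu j; rewrite mxE; under eq_fun do rewrite mxE.
by case: eqP => _ //; exact: h.
Qed.

Lemma Bop_dct k (F : nat -> V -> R) F0 (vn : nat -> V) v (M : R) : (forall n, BC (F n)) -> BC F0 ->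
  (forall n v, `|F n v| <= M) ->
  (forall (vn : nat -> V) v, (forall j, vn n j 0 @[n --> \oo] --> v j 0) -> F n (vn n) @[n --> \oo] --> F0 v) ->
  (forall j, vn n j 0 @[n --> \oo] --> v j 0) ->
  Bop k (F n) (vn n) @[n --> \oo] --> Bop k F0 v.
Proof.
move=> bF bF0 bM cF cv.
apply: (gE_dct (M := M)).
- by move=> n; exact: Bop_bmeas.
- exact: Bop_bmeas.
- by move=> n u; exact: bM.
- move=> u; apply: cF; apply: upd_cvg => //.
  apply: cvgD; last exact: cvg_cst.
  by apply: cvgN; apply: cvgB; [exact: lin_cvg|exact: cv].
Qed.

Lemma Bop_BC k F : BC F -> BC (Bop k F).
Proof.
move=> bF; have [cF [M bM]] := bF; split; last by exists M => v; exact: Bop_bd.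
by move=> vn v h; apply: (Bop_dct (F := fun=> F) (M := M)).
Qed.

Lemma BopD k F G v : BC F -> BC G -> Bop k (fun v => F v + G v) v = Bop k F v + Bop k G v.
Proof. by move=> bF bG; apply: gED; exact: Bop_bmeas. Qed.

Lemma BopZ k c F v : BC F -> Bop k (fun v => c * F v) v = c * Bop k F v.
Proof. by move=> bF; apply: gEZ; exact: Bop_bmeas. Qed.

Lemma Bop_le k F G v : BC F -> BC G -> (forall v, F v <= G v) -> Bop k F v <= Bop k G v.
Proof. by move=> bF bG FG; apply: gE_le => [||u]; [exact: Bop_bmeas..|exact: FG]. Qed.

Lemma BC_cst c : BC (fun=> c).
Proof. by split; [move=> ? ? _; exact: cvg_cst|exists `|c|]. Qed.

Lemma BCD F G : BC F -> BC G -> BC (fun v => F v + G v).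
Proof.
move=> [cF [M bM]] [cG [N bN]]; split.
  by move=> vn v h; apply: cvgD; [exact: cF|exact: cG].
by exists (M + N) => v; rewrite (le_trans (ler_normD _ _))// lerD.
Qed.

Lemma BCZ c F : BC F -> BC (fun v => c * F v).
Proof.
move=> [cF [M bM]]; split.
  by move=> vn v h; apply: cvgM; [exact: cvg_cst|exact: cF].
by exists (`|c| * M) => v; rewrite normrM ler_wpM2l.
Qed.

Fixpoint Nop (k : nat) F : V -> R :=
  if k is k'.+1 then
    (if insub k' is Some i then Bop i (Nop k' F) else Nop k' F)
  else F.

Lemma Nop_BC k F : BC F -> BC (Nop k F).
Proof. by move=> bF; elim: k => //= k IH; case: insubP => [i _ _|_] //; exact: Bop_BC. Qed.

Lemma NopD k F G v : BC F -> BC G -> Nop k (fun v => F v + G v) v = Nop k F v + Nop k G v.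
Proof.
move=> bF bG; elim: k v => //= k IH v; case: insubP => [i _ _|_] //.
rewrite -BopD; [|exact: Nop_BC..].
by congr (Bop _ _ _); apply/funext => w; exact: IH.
Qed.

Lemma NopZ k c F v : BC F -> Nop k (fun v => c * F v) v = c * Nop k F v.
Proof.
move=> bF; elim: k v => //= k IH v; case: insubP => [i _ _|_] //.
rewrite -BopZ; last exact: Nop_BC.
by congr (Bop _ _ _); apply/funext => w; exact: IH.
Qed.

Lemma Nop_cst k c v : Nop k (fun=> c) v = c.
Proof.
elim: k v => //= k IH v; case: insubP => [i _ _|_] //.
rewrite -[RHS](gE_cst c).
by congr gE; apply/funext => w; exact: IH.
Qed.

Lemma Nop_le k F G v : BC F -> BC G -> (forall v, F v <= G v) -> Nop k F v <= Nop k G v.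
Proof.
move=> bF bG FG; elim: k v => //= k IH v; case: insubP => [i _ _|_] //.
by apply: Bop_le => //; exact: Nop_BC.
Qed.

Lemma Nop_bd k F v (M : R) : BC F -> (forall v, `|F v| <= M) -> `|Nop k F v| <= M.
Proof.
move=> bF bM; elim: k v => //= k IH v; case: insubP => [i _ _|_] //.
by apply: Bop_bd => //; exact: Nop_BC.
Qed.

Lemma Nop_dct k (F : nat -> V -> R) F0 (M : R) : (forall n, BC (F n)) -> BC F0 ->
  (forall n v, `|F n v| <= M) ->
  (forall (vn : nat -> V) v, (forall j, vn n j 0 @[n --> \oo] --> v j 0) -> F n (vn n) @[n --> \oo] --> F0 v) ->
  forall (vn : nat -> V) v, (forall j, vn n j 0 @[n --> \oo] --> v j 0) ->
  Nop k (F n) (vn n) @[n --> \oo] --> Nop k F0 v.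
Proof.
move=> bF bF0 bM cF; elim: k => [|k IH] vn v cv /=; first exact: cF.
case: insubP => [i _ _|_]; last exact: IH.
apply: (Bop_dct (M := M)) => //.
- by move=> n; exact: Nop_BC.
- exact: Nop_BC.
- by move=> n w; exact: Nop_bd.
Qed.

Lemma lin_sum_cont (c : R) (b : 'I_K -> R) (Q : pred 'I_K) : BC (fun v => cos (c + \sum_(i | Q i) b i * lin i v)).
Proof.
split; last by exists 1 => v; exact: cos_max.
move=> vn v h; apply: (@cvg_comp _ _ _ (fun n => c + \sum_(i | Q i) b i * lin i (vn n)) cos); last exact: continuous_cos.
apply: cvgD; first exact: cvg_cst.
apply: cvg_sumR => i _; apply: cvgM; [exact: cvg_cst|exact: lin_cvg].
Qed.

(** Integrating out coordinate k replaces [lin k] by g / sqrt(m k) with g standard normal, and by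
    triangularity leaves the later [lin j] untouched. [gcos] then removes the term of index k at the
    price of a factor exp(- b_k^2 / (2 m_k)). *)
Lemma Nop_cos k (th : R) (b : 'I_K -> R) v : (k <= K)%N ->
  Nop k (fun v => cos (th + \sum_i b i * lin i v)) v =
  expR (- (\sum_(i < K | (i < k)%N) (b i ^+ 2 / m i)) / 2) *
  cos (th + \sum_(i < K | (k <= i)%N) b i * lin i v).
Proof.
elim: k v => [|k IH] v kK /=.
  by rewrite [X in expR (- X / 2)]big_pred0// oppr0 mul0r expR0 mul1r.
case: insubP => [i _ ik|]; last by rewrite kK.
rewrite (_ : Nop k _ = fun v => expR (- (\sum_(i < K | (i < k)%N) (b i ^+ 2 / m i)) / 2) *
  cos (th + \sum_(i < K | (k <= i)%N) b i * lin i v)); last first.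
  by apply/funext => w; exact: IH (ltnW kK).
rewrite BopZ; last exact: lin_sum_cont.
have E w : \sum_(j < K | (k <= j)%N) b j * lin j w = b i * lin i w + \sum_(j < K | (k < j)%N) b j * lin j w.
  rewrite (bigD1 i) /= ?ik//; congr (_ + _); apply: eq_bigl => j.
  by rewrite ltn_neqAle andbC -ik eq_sym.
have Es : \sum_(j < K | (j < k.+1)%N) (b j ^+ 2 / m j) = b i ^+ 2 / m i + \sum_(j < K | (j < k)%N) (b j ^+ 2 / m j).
  rewrite (bigD1 i) /= ?ik//; congr (_ + _); apply: eq_bigl => j.
  by rewrite ltnS [in RHS]ltn_neqAle andbC -ik.
rewrite Es /Bop.
rewrite (_ : (fun g => _) = fun g => cos ((th + \sum_(j < K | (k < j)%N) b j * lin j v) +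
   (b i * (Num.sqrt (m i))^-1) * g)); last first.
  apply/funext => g; rewrite E lin_upd.
  rewrite (_ : - _ + _ + _ = (Num.sqrt (m i))^-1 * g); last by ring.
  rewrite (eq_bigr (fun j => b j * lin j v)) => [|j kj]; last by rewrite lin_upd_gt// ik.
  by congr cos; ring.
rewrite gcos mulrA -expRD; congr (expR _ * _).
rewrite expr_div_n sqr_sqrtr ?(ltW (m0 i))//.
by field; rewrite gt_eqF.
Qed.


(** As a function of coordinate k, the factors of index above k are constant by triangularity and
    leave the integral; the factor of index k is a Gaussian weight in that coordinate, and
    [gE_subst] extracts its normalisation sqrt(2 pi / m_k). *)
Lemma iter_intE F k v : BC F -> (k <= K)%N ->
  iter_int k (fun y => F y * \prod_i expR (- (m i * lin i y ^+ 2) / 2)) v =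
  (\prod_(i < K | (i < k)%N) Num.sqrt (2 * pi / m i)) *
  (\prod_(i < K | (k <= i)%N) expR (- (m i * lin i v ^+ 2) / 2)) * Nop k F v.
Proof.
move=> bF; elim: k v => [|k IH] v kK.
  by rewrite [X in X * _ * _]big_pred0// mul1r /= mulrC.
rewrite /=; case: insubP => [i _ /= ik|]; last by rewrite kK.
move: IH kK; rewrite -{k}ik => IH kK.
set c := \prod_(j < K | (j < i)%N) Num.sqrt (2 * pi / m j).
set W := \prod_(j < K | (i < j)%N) expR (- (m j * lin j v ^+ 2) / 2).
have Ec : \prod_(j < K | (j < i.+1)%N) Num.sqrt (2 * pi / m j) = Num.sqrt (2 * pi / m i) * c.
  rewrite (bigD1 i) ?ltnSn//=; congr (_ * _); apply: eq_bigl => j.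
  by rewrite ltnS [in RHS]ltn_neqAle andbC.
have EW u : \prod_(j < K | (i <= j)%N) expR (- (m j * lin j (upd i v u) ^+ 2) / 2) =
    expR (- (m i * (u + (lin i v - v i 0)) ^+ 2) / 2) * W.
  rewrite (bigD1 i) ?leqnn//= lin_upd; congr (_ * _).
  rewrite (eq_bigl (fun j : 'I_K => (i < j)%N)) => [|j]; last by rewrite ltn_neqAle andbC eq_sym.
  by apply: eq_bigr => j kj; rewrite lin_upd_gt.
have bN := Nop_BC i bF.
have [cN [M bM]] := bN.
transitivity (\int[mu]_u ((c * W * Nop i F (upd i v u)) *
   expR (- (m i * (u + (lin i v - v i 0)) ^+ 2) / 2))).
  apply: eq_Rintegral => u _.
  rewrite -[X in iter_int i _ X]/(upd i v u) (IH _ (ltnW kK)) -/c EW.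
  by rewrite -mulrA [in RHS]mulrAC -!mulrA; congr (_ * _); ring.
rewrite (@gE_subst _ (fun u => c * W * Nop i F (upd i v u)) _ _ (`|c * W| * M)).
- by rewrite Ec (gEZ (c * W) (Bop_bmeas i v bN)) -/(Bop i (Nop i F) v); ring.
- have cg : continuous (fun g => Nop i F (upd i v g)).
    apply: seq_continuous => un u cu; apply: cN; apply: upd_cvg => // j; exact: cvg_cst.
  by move=> x; apply: cvgM; [exact: cvg_cst|exact: cg].
- by move=> u; rewrite normrM ler_wpM2l.
- exact: m0.
Qed.

End GaussianK.

(** * Factorisation of positive definite matrices *)

Section LDL.
Context {R : realType}.

Definition posdef K (A : 'M[R]_K) := forall v : 'cV[R]_K, v != 0 -> 0 < (v^T *m A *m v) 0 0.

Lemma posdef_unit K (A : 'M[R]_K) : posdef A -> A \in unitmx.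
Proof.
move=> pA; rewrite unitmxE unitfE; apply/negP => /det0P[v v0 vA].
have v0' : v^T != 0 by apply: contra_neq v0 => h; rewrite -[v]trmxK h trmx0.
by have := pA _ v0'; rewrite trmxK vA mul0mx mxE ltxx.
Qed.

Lemma posdef_inv K (A : 'M[R]_K) : A^T = A -> posdef A -> posdef (invmx A).
Proof.
move=> sA pA v v0; have uA := posdef_unit pA.
have := pA (invmx A *m v).
rewrite trmx_mul trmx_inv sA -!mulmxA mulKVmx//; apply.
apply: contraNneq v0 => h.
by rewrite -[v](mulKVmx uA) h mulmx0.
Qed.

(** Block elimination: the pivot a = A 0 0 is split off and the induction continues with the Schur
    complement S = B - r^T r / a. *)
Lemma LDL K (A : 'M[R]_K) : A^T = A -> posdef A ->
  exists (L : 'M[R]_K) (m : 'rV[R]_K), [/\ (forall i j : 'I_K, (j < i)%N -> L i j = 0),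
    (forall i, L i i = 1), (forall i, 0 < m 0 i) & A = L^T *m diag_mx m *m L].
Proof.
elim: K A => [|K IH] A sA pA.
  by exists 0, 0; split=> [[]|[]|[]|]; [..|apply/matrixP => -[]].
move: A sA pA; rewrite -[K.+1]/(1 + K)%N => A sA pA.
pose a : R := A 0 0.
pose r : 'rV_K := ursubmx A.
pose B := drsubmx A.
have Aul : ulsubmx A = a%:M by rewrite [ulsubmx A]mx11_scalar !mxE lshift0.
have Adl : dlsubmx A = r^T by rewrite -[A in dlsubmx A]sA -trmx_ursub.
have AE : A = block_mx a%:M r r^T B by rewrite -[LHS]submxK Aul Adl.
have sB : B^T = B by rewrite /B trmx_drsub sA.
have a0 : 0 < a.
  have := pA (delta_mx 0 0); rewrite trmx_delta -rowE -colE !mxE; apply.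
  by apply/eqP => /matrixP/(_ 0 0); rewrite !mxE/= => /eqP; rewrite oner_eq0.
pose S := B - a^-1 *: (r^T *m r).
have sS : S^T = S by rewrite /S linearB/= linearZ/= trmx_mul trmxK sB.
have pS : posdef S.
  (* The first coordinate minimises the quadratic form of A for fixed w, and the minimum is the
     quadratic form of S. *)
  move=> w w0; pose v := col_mx (- (a^-1 *: (r *m w))) w.
  have v0 : v != 0 by rewrite col_mx_eq0 negb_and w0 orbT.
  have := pA v v0; rewrite AE /v tr_col_mx mul_row_block mul_row_col.
  set p := - (a^-1 *: (r *m w)).
  have pT : p^T = - (a^-1 *: (w^T *m r^T)) by rewrite /p linearN/= linearZ/= trmx_mul.
  have -> : p^T *m a%:M + w^T *m r^T = 0.
    by rewrite mul_mx_scalar pT scalerN scalerA divff ?gt_eqF// scale1r addNr.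
  rewrite mul0mx add0r pT (_ : - _ *m r + _ = w^T *m S)//.
  by rewrite /S mulmxBr addrC mulNmx -scalemxAl -scalemxAr mulmxA.
have [L [m [L0 L1 m0 SE]]] := IH S sS pS.
exists (block_mx 1%:M (a^-1 *: r) 0 L), (row_mx a%:M m); split.
- move=> i j; rewrite -(splitK i) -(splitK j) /unsplit.
  case: (fintype.split i) => i'; case: (fintype.split j) => j' /=.
  + by rewrite !ord1.
  + by rewrite !ord1.
  + by move=> _; rewrite block_mxEdl mxE.
  + by rewrite ltn_add2l block_mxEdr; exact: L0.
- move=> i; rewrite -(splitK i) /unsplit; case: (fintype.split i) => i' /=.
  + by rewrite block_mxEul mxE !ord1.
  + by rewrite block_mxEdr.
- move=> i; rewrite -(splitK i) /unsplit; case: (fintype.split i) => i' /=.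
  + by rewrite row_mxEl mxE !ord1 mulr1n.
  + by rewrite row_mxEr.
- have dE : diag_mx (row_mx a%:M m : 'rV_(1 + K)) = block_mx a%:M 0 0 (diag_mx m).
    rewrite diag_mx_row; congr block_mx.
    by apply/matrixP => i j; rewrite !mxE !ord1 mulr1n.
  rewrite dE tr_block_mx !mulmx_block !trmx0 !trmx1 !mul0mx !mulmx0 !addr0 !add0r !mul1mx !mulmx1 -SE AE.
  have rT : (a^-1 *: r)^T *m a%:M = r^T.
    by rewrite mul_mx_scalar linearZ/= scalerA divff ?gt_eqF// scale1r.
  rewrite rT; congr block_mx.
    by rewrite mul0mx addr0 mul_scalar_mx scalerA divff ?gt_eqF// scale1r.
  by rewrite -scalemxAr addrC subrK.
Qed.

End LDL.

Section GaussFunctional.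
Context {R : realType} (K : nat).
Notation V := ('cV[R]_K).

Lemma quad_LDL (L : 'M[R]_K) (m : 'rV[R]_K) (v : V) :
  (v^T *m (L^T *m diag_mx m *m L) *m v) 0 0 = \sum_i m 0 i * lin L i v ^+ 2.
Proof.
rewrite !mulmxA -trmx_mul -[_ *m L *m v]mulmxA /lin; set w := L *m v.
rewrite mul_mx_diag mxE; apply: eq_bigr => i _; rewrite !mxE; ring.
Qed.

Lemma prod_expR I (r : seq I) (f : I -> R) : \prod_(i <- r) expR (f i) = expR (\sum_(i <- r) f i).
Proof.
by elim: r => [|i r IH]; rewrite ?big_nil ?expR0// !big_cons IH expRD.
Qed.

Lemma prod_sqrt I (r : seq I) (f : I -> R) : (forall i, 0 <= f i) ->
  \prod_(i <- r) Num.sqrt (f i) = Num.sqrt (\prod_(i <- r) f i).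
Proof.
move=> f0; elim: r => [|i r IH]; first by rewrite !big_nil sqrtr1.
by rewrite !big_cons IH sqrtrM.
Qed.

(** The factorisation is that of the precision matrix [invmx U]. Since \det L = 1, \det U is the
    inverse of the product of the m_i, so the density normalisation cancels the one-dimensional
    ones. For the cosines, b = a L^-1 and L U L^T = diag(1 / m) turn the sum of b_i^2 / m_i into a U
    a^T. *)
Lemma normal_expectE (U : 'M[R]_K) : U^T = U -> posdef U ->
  exists (L : 'M[R]_K) (m : 'I_K -> R),
  [/\ (forall i j : 'I_K, (j < i)%N -> L i j = 0),
    (forall i, L i i = 1), (forall i, 0 < m i),
    (forall f : V -> R, BC f -> normal_expect U f = Nop L m K f 0) &
    (forall (a : 'rV[R]_K) th,
      Nop L m K (fun y => cos (th + (a *m y) 0 0)) 0 = expR (- (a *m U *m a^T) 0 0 / 2) * cos th)].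
Proof.
move=> sU pU; have uU := posdef_unit pU.
have sI : (invmx U)^T = invmx U by rewrite trmx_inv sU.
have [L [m' [L0 L1 m0 IE]]] := LDL sI (posdef_inv sU pU).
pose m (i : 'I_K) : R := m' 0 i; exists L, m; split=> // [f bf|a th].
- rewrite /normal_expect.
  have detL : \det L = 1.
    rewrite -det_tr det_trig; last by apply/is_trig_mxP => i j ij; rewrite mxE L0.
    by rewrite big1// => i _; rewrite mxE L1.
  have detU : \det U = (\prod_i m i)^-1.
    rewrite -[U]invmxK det_inv IE !det_mulmx det_tr detL mul1r mulr1 det_diag//.
  pose c := (\prod_(i < K) Num.sqrt (2 * pi / m i))^-1.
  have cE : (Num.sqrt ((2 * pi) ^+ K * \det U))^-1 = c.
    rewrite /c prod_sqrt => [|i]; last by rewrite divr_ge0 ?(ltW (m0 i))// mulr_ge0// pi_ge0.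
    congr (Num.sqrt _)^-1; rewrite detU big_split/= prodfV; congr (_ * _).
    by rewrite prodr_const card_ord.
  have E : (fun y => f y * gauss_density U y) =
      fun y => (c * f y) * \prod_i expR (- (m i * lin L i y ^+ 2) / 2).
    apply/funext => y; rewrite /gauss_density cE prod_expR IE quad_LDL.
    transitivity (c * f y * expR (- (\sum_i m' 0 i * lin L i y ^+ 2) / 2)); first by ring.
    by congr (_ * expR _); rewrite -mulr_suml sumrN.
  rewrite E (iter_intE L0 L1 m0 _ (BCZ c bf) (leqnn K)).
  rewrite NopZ//.
  rewrite (eq_bigl xpredT) => [|i]; last by rewrite ltn_ord.
  rewrite [X in _ * X * _]big_pred0 => [|i]; last by rewrite leqNgt ltn_ord.
  rewrite mulr1 mulrA divff ?mul1r//.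
  rewrite gt_eqF// prodr_gt0// => i _.
  by rewrite sqrtr_gt0 divr_gt0 ?m0// mulr_gt0// pi_gt0.
- have uL : L \in unitmx.
    rewrite unitmxE -det_tr det_trig; last by apply/is_trig_mxP => i j ij; rewrite mxE L0.
    by rewrite big1 ?unitr1// => i _; rewrite mxE L1.
  pose b := a *m invmx L.
  have aE : a = b *m L by rewrite /b mulmxKV.
  have sE y : (a *m y) 0 0 = \sum_i b 0 i * lin L i y by rewrite aE -mulmxA mxE.
  rewrite (_ : (fun y => _) = fun y => cos (th + \sum_i b 0 i * lin L i y)); last first.
    by apply/funext => y; rewrite sE.
  rewrite (Nop_cos L0 L1 m0 _ _ _ (leqnn K)).
  rewrite [X in cos (th + X)]big_pred0 => [|i]; last by rewrite leqNgt ltn_ord.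
  rewrite addr0 (eq_bigl xpredT) => [|i]; last by rewrite ltn_ord.
  pose E : 'rV[R]_K := \row_i (m i)^-1.
  have DE : diag_mx m' *m diag_mx E = 1%:M.
    apply/matrixP => i j; rewrite mul_diag_mx !mxE.
    by case: eqP => [->|_]; rewrite ?mulr1n ?mulr0n ?mulr0// divff// gt_eqF// m0.
  have LUL : L *m U *m L^T = diag_mx E.
    have h : L *m U *m L^T *m diag_mx m' = 1%:M.
      have : L *m (U *m (L^T *m diag_mx m' *m L)) *m invmx L = 1%:M.
        by rewrite -IE mulmxV// mulmx1 mulmxV.
      by rewrite !mulmxA mulmxK.
    by rewrite -[LHS]mulmx1 -DE mulmxA h mul1mx.
  have -> : a *m U *m a^T = b *m diag_mx E *m b^T.
    by rewrite -LUL aE trmx_mul !mulmxA.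
  congr (expR (- _ / 2) * _).
  rewrite mul_mx_diag mxE; apply: eq_bigr => i _; rewrite !mxE; ring.
Qed.

End GaussFunctional.

(** * Approximation by trigonometric polynomials *)

Section Bernstein.
Context {R : realType}.
Implicit Types (p : R) (ps : nat -> R).

(* Binomial probabilities, defined by the Bernoulli recursion rather than through 'C(n, l). *)
Fixpoint bw p (n l : nat) : R :=
  match n, l with
  | 0, 0 => 1
  | 0, _.+1 => 0
  | n'.+1, 0 => (1 - p) * bw p n' 0
  | n'.+1, l'.+1 => p * bw p n' l' + (1 - p) * bw p n' l'.+1
  end.

Lemma bw_ge0 p n l : 0 <= p <= 1 -> 0 <= bw p n l.
Proof.
move=> /andP[p0 p1]; have q0 : 0 <= 1 - p by rewrite subr_ge0.
elim: n l => [|n IH] [|l] //=; first by rewrite mulr_ge0.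
by rewrite addr_ge0// mulr_ge0.
Qed.

Lemma bw_gt p n l : (n < l)%N -> bw p n l = 0.
Proof. by elim: n l => [|n IH] [|l] //= nl; rewrite !IH ?mulr0 ?addr0// ltnW. Qed.

(** Conditioning on one Bernoulli trial; moments of the binomial law then follow by induction on
    n. *)
Lemma bw_step p n ps : \sum_(l < n.+2) ps l * bw p n.+1 l =
  p * (\sum_(l < n.+1) ps l.+1 * bw p n l) + (1 - p) * \sum_(l < n.+1) ps l * bw p n l.
Proof.
rewrite big_ord_recl /=.
have -> : \sum_(l < n.+1) ps l * bw p n l = ps 0%N * bw p n 0 + \sum_(l < n.+1) ps l.+1 * bw p n l.+1.
  have -> : \sum_(l < n.+1) ps l * bw p n l = \sum_(l < n.+2) ps l * bw p n l.
    by rewrite [RHS]big_ord_recr/= bw_gt// mulr0 addr0.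
  by rewrite big_ord_recl.
rewrite mulrDr addrCA; congr (_ + _); first by ring.
rewrite !mulr_sumr -big_split/=; apply: eq_bigr => l _.
by rewrite /bump/= add1n; ring.
Qed.

Lemma bw_sum p n : \sum_(l < n.+1) bw p n l = 1.
Proof.
have H m : \sum_(l < m.+1) 1 * bw p m l = 1.
  elim: m => [|m IH]; first by rewrite big_ord1 mul1r.
  by rewrite (bw_step p m (fun=> 1)) IH; ring.
by rewrite -[RHS](H n); apply: eq_bigr => l _; rewrite mul1r.
Qed.

(** The centre c stays free because a success in the conditioning step shifts it to c - 1. *)
Lemma bw_var p n (c : R) : \sum_(l < n.+1) (l%:R - c) ^+ 2 * bw p n l =
  n%:R * p * (1 - p) + (n%:R * p - c) ^+ 2.
Proof.
elim: n c => [|n IH] c; first by rewrite big_ord1 /=; ring.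
rewrite (bw_step p n (fun l => (l%:R - c) ^+ 2)) IH.
rewrite (eq_bigr (fun l : 'I_n.+1 => (l%:R - (c - 1)) ^+ 2 * bw p n l)) => [|l _].
  by rewrite IH -natr1; ring.
by rewrite -natr1; congr (_ ^+ 2 * _); ring.
Qed.

Lemma bw_cheb p n : 0 <= p <= 1 -> (0 < n)%N ->
  \sum_(l < n.+1) (l%:R / n%:R - p) ^+ 2 * bw p n l <= n%:R^-1.
Proof.
move=> /andP[p0 p1] n0; have n1 : 0 < n%:R :> R by rewrite ltr0n.
have := bw_var p n (n%:R * p); rewrite subrr expr0n/= addr0 => H.
have -> : \sum_(l < n.+1) (l%:R / n%:R - p) ^+ 2 * bw p n l =
  (n%:R ^+ 2)^-1 * \sum_(l < n.+1) (l%:R - n%:R * p) ^+ 2 * bw p n l.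
  rewrite mulr_sumr; apply: eq_bigr => l _; rewrite mulrA; congr (_ * _).
  by field; rewrite gt_eqF.
rewrite H expr2 invfM -!mulrA mulKf ?gt_eqF// ler_piMr//.
by rewrite mulr_ile1//; lra.
Qed.

Lemma sin_third (t : R) : 0 <= t <= 2 -> t / 3 <= sin t.
Proof.
move=> /andP[t0 t2]; apply: le_trans (sin_ge t0).
have : t ^+ 3 <= 4 * t.
  by rewrite !exprS expr0 mulr1 mulrC ler_wpM2r//; nra.
lra.
Qed.

(** The sine flattens quadratically at the ends of the interval, hence the square. With t the half
    difference and c the midpoint, sin a - sin b = 2 cos c sin t, where cos c >= sin t because |c| +
    t <= pi/2. Together with sin t >= t/3 this gives at least 2 t^2 / 9 = (a - b)^2 / 18. *)
Lemma sin_sep (a b : R) : - (pi / 2) <= a <= pi / 2 -> - (pi / 2) <= b <= pi / 2 ->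
  (a - b) ^+ 2 <= 18 * `|sin a - sin b|.
Proof.
wlog ab : a b / b <= a => [h|] ha hb.
  have [ab|ab] := leP b a; first exact: h.
  by rewrite -[a - b]opprB sqrrN distrC; apply: h => //; exact: ltW.
case/andP: ha => a1 a2; case/andP: hb => b1 b2.
pose t := (a - b) / 2; pose c := (a + b) / 2.
have t0 : 0 <= t by rewrite /t divr_ge0// subr_ge0.
have trig_poly : t <= pi / 2 by rewrite /t; lra.
have E : sin a - sin b = 2 * cos c * sin t.
  have -> : sin a = sin (c + t) by congr sin; rewrite /c /t; field.
  have -> : sin b = sin (c - t) by congr sin; rewrite /c /t; field.
  by rewrite sinD sinB; ring.
have st : t / 3 <= sin t by apply: sin_third; rewrite t0/=; have := @pihalf_lt2 R; lra.
have ct : sin t <= cos c.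
  have -> : sin t = cos (pi / 2 - t).
    by rewrite -[pi / 2 - t]opprB cosN cosBpihalf.
  have [c0|c0] := leP 0 c.
    have [|h] := leP (pi / 2 - t) c; last first.
      by apply: ltW; rewrite ltr_cos ?in_itv/=; rewrite /c /t in c0 h *; lra.
    by move=> h; rewrite (_ : c = pi / 2 - t)//; apply/le_anti; rewrite h andbT /c /t; lra.
  rewrite -[cos c]cosN.
  have [|h] := leP (pi / 2 - t) (- c); last first.
    by apply: ltW; rewrite ltr_cos ?in_itv/=; rewrite /c /t in c0 h *; lra.
  by move=> h; rewrite (_ : - c = pi / 2 - t)//; apply/le_anti; rewrite h andbT /c /t; lra.
have s0 : 0 <= sin t by apply: le_trans st; rewrite divr_ge0.
rewrite E ger0_norm; last by rewrite !mulr_ge0//; exact: le_trans s0 ct.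
have h1 : (t / 3) * (t / 3) <= cos c * sin t.
  have t3 : 0 <= t / 3 by rewrite divr_ge0.
  by exact: (ler_pM t3 t3 (le_trans st ct) st).
have -> : (a - b) = 2 * t by rewrite /t; field.
nra.
Qed.

End Bernstein.

(** * Trigonometric polynomials and multivariate Bernstein operators *)

Section TrigPoly.
Context {R : realType} (K : nat).
Notation V := ('cV[R]_K).

Definition trig_poly (s : seq (R * R * 'rV[R]_K)) (y : V) : R :=
  \sum_(t <- s) t.1.1 * cos (t.1.2 + (t.2 *m y) 0 0).

Definition is_trig_poly (T : V -> R) := exists s, T =1 trig_poly s.

Lemma is_trig_poly_cst c : is_trig_poly (fun=> c).
Proof.
exists [:: (c, 0, 0)] => y; rewrite /trig_poly big_seq1 /= mul0mx mxE addr0 cos0 mulr1 //.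
Qed.

Lemma is_trig_poly_cos th (a : 'rV[R]_K) : is_trig_poly (fun y => cos (th + (a *m y) 0 0)).
Proof. by exists [:: (1, th, a)] => y; rewrite /trig_poly big_seq1 /= mul1r. Qed.

Lemma is_trig_polyD T S : is_trig_poly T -> is_trig_poly S -> is_trig_poly (fun y => T y + S y).
Proof. by move=> [s hs] [t ht]; exists (s ++ t) => y; rewrite /trig_poly big_cat/= hs ht. Qed.

Lemma is_trig_polyM T S : is_trig_poly T -> is_trig_poly S -> is_trig_poly (fun y => T y * S y).
Proof.
move=> [s hs] [t ht].
exists ([seq (u.1.1 * v.1.1 / 2, u.1.2 + v.1.2, u.2 + v.2) | u <- s, v <- t] ++
        [seq (u.1.1 * v.1.1 / 2, u.1.2 - v.1.2, u.2 - v.2) | u <- s, v <- t]) => y.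
rewrite hs ht /trig_poly big_cat/= !big_allpairs_dep/= -big_split/= mulr_suml; apply: eq_bigr => u _.
rewrite -big_split/= mulr_sumr; apply: eq_bigr => v _.
rewrite mulmxDl mulmxBl !mxE.
set A := u.1.2; set B := v.1.2; set a := \sum_j u.2 _ _ * _; set b := \sum_j v.2 _ _ * _.
have -> : A + B + (a + b) = (A + a) + (B + b) by ring.
have -> : A - B + (a - b) = (A + a) - (B + b) by ring.
by move: (A + a) (B + b) => p q; rewrite cosD cosB; field.
Qed.

Lemma is_trig_poly_sum I (r : seq I) (T : I -> V -> R) : (forall i, is_trig_poly (T i)) -> is_trig_poly (fun y => \sum_(i <- r) T i y).
Proof.
move=> h; elim: r => [|i r IH].
  by have [s hs] := is_trig_poly_cst 0; exists s => y; rewrite big_nil; exact: hs.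
by have [s hs] := is_trig_polyD (h i) IH; exists s => y; rewrite big_cons; exact: hs.
Qed.

Lemma is_trig_poly_prod I (r : seq I) (T : I -> V -> R) : (forall i, is_trig_poly (T i)) -> is_trig_poly (fun y => \prod_(i <- r) T i y).
Proof.
move=> h; elim: r => [|i r IH].
  by have [s hs] := is_trig_poly_cst 1; exists s => y; rewrite big_nil; exact: hs.
by have [s hs] := is_trig_polyM (h i) IH; exists s => y; rewrite big_cons; exact: hs.
Qed.

Variable L : R.
Hypothesis L0 : 0 < L.

(** The Bernstein variable: trigonometric in x, increasing on [-L, L], and with values in [0, 1] on
    the whole line, so that the approximants stay bounded outside the box too. *)
Definition pL (x : R) := (1 + sin (pi / (2 * L) * x)) / 2.
(** The point of [-L, L] at which [pL] takes the value l / n. *)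
Definition qL (n l : nat) : R := 2 * L / pi * asin (2 * (l%:R / n%:R) - 1).

Lemma pL01 x : 0 <= pL x <= 1.
Proof. by rewrite /pL; have := sin_geN1 (pi / (2 * L) * x); have := sin_le1 (pi / (2 * L) * x); lra. Qed.

(** [sin_sep] after scaling: sines are twice the [pL] values up to a shift, so 18 becomes 36, and 2
    L / pi <= L because pi >= 2. *)
Lemma qL_sep (x : R) n l : (0 < n)%N -> (l <= n)%N -> `|x| <= L ->
  `|qL n l| <= L /\ (x - qL n l) ^+ 2 <= 36 * L ^+ 2 * `|l%:R / n%:R - pL x|.
Proof.
move=> n0 ln xL; have n1 : 0 < n%:R :> R by rewrite ltr0n.
have pi0 := @pi_gt0 R; have pi2 := @pi_ge2 R.
pose z : R := 2 * (l%:R / n%:R) - 1.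
have z1 : -1 <= z <= 1.
  have h0 : 0 <= (l%:R / n%:R : R) by rewrite divr_ge0.
  have h1 : (l%:R / n%:R : R) <= 1 by rewrite ler_pdivrMr// mul1r ler_nat.
  by rewrite /z; apply/andP; split; lra.
pose b := asin z; pose a := pi / (2 * L) * x.
have b1 : - (pi / 2) <= b <= pi / 2 by rewrite asin_geNpi2//= asin_lepi2.
have qE : qL n l = 2 * L / pi * b by [].
have Lu : L != 0 by rewrite gt_eqF.
have piu : (pi : R) != 0 by rewrite gt_eqF.
have xE : x = 2 * L / pi * a.
  by rewrite /a; move: piu; generalize (pi : R) => p pn; field; rewrite Lu.
have a1 : - (pi / 2) <= a <= pi / 2.
  move: xL; rewrite -ler_norml xE normrM ger0_norm; last by rewrite divr_ge0 ?mulr_ge0 ?ltW.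
  rewrite mulrC -ler_pdivlMr ?divr_gt0 ?mulr_gt0// => /le_trans; apply.
  by rewrite le_eqVlt; apply/orP; left; apply/eqP; move: piu; generalize (pi : R) => p pn; field; rewrite Lu pn.
split.
  rewrite qE normrM ger0_norm; last by rewrite divr_ge0 ?mulr_ge0 ?ltW.
  rewrite mulrC -ler_pdivlMr ?divr_gt0 ?mulr_gt0//.
  rewrite (_ : L / _ = pi / 2); last by move: piu; generalize (pi : R) => p pn; field; rewrite Lu pn.
  by rewrite ler_norml.
rewrite {1}xE qE -mulrBr exprMn.
have := sin_sep a1 b1; rewrite /b asinK ?in_itv//= -/b -/a.
have -> : sin a - z = - 2 * (l%:R / n%:R - pL x) by rewrite /pL -/a /z; field; rewrite gt_eqF.
rewrite normrM normrN (ger0_norm (_ : 0 <= 2))// => h.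
have h2 : (2 * L / pi) ^+ 2 <= L ^+ 2.
  have L0' := ltW L0; have pi0' := ltW pi0.
  rewrite ler_pXn2r ?nnegrE ?divr_ge0 ?mulr_ge0//.
  by rewrite ler_pdivrMr// [leRHS]mulrC ler_wpM2r.
rewrite (_ : 36 * L ^+ 2 * `|_| = L ^+ 2 * (18 * (2 * `|l%:R / n%:R - pL x|))); last by ring.
by apply: ler_pM => //; rewrite ?sqr_ge0.
Qed.

Lemma is_trig_poly_pL (j : 'I_K) : is_trig_poly (fun y => pL (y j 0)).
Proof.
have [s hs] : is_trig_poly (fun y => (1 + cos (- (pi / 2) + ((pi / (2 * L) *: delta_mx 0 j : 'rV[R]_K) *m y) 0 0)) * 2^-1).
  by apply: is_trig_polyM; [apply: is_trig_polyD; [exact: is_trig_poly_cst|exact: is_trig_poly_cos]|exact: is_trig_poly_cst].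
exists s => y; rewrite -hs /pL -scalemxAl mxE -rowE mxE [- _ + _]addrC cosBpihalf.
by congr ((_ + _) / _).
Qed.

Lemma is_trig_poly_bw (j : 'I_K) n l : is_trig_poly (fun y => bw (pL (y j 0)) n l).
Proof.
have h1 : is_trig_poly (fun y => 1 - pL (y j 0)).
  have [s hs] := is_trig_polyD (is_trig_poly_cst 1) (is_trig_polyM (is_trig_poly_cst (-1)) (is_trig_poly_pL j)).
  by exists s => y; rewrite -hs mulN1r.
elim: n l => [|n IH] [|l] /=; [exact: is_trig_poly_cst|exact: is_trig_poly_cst|exact: is_trig_polyM|].
by apply: is_trig_polyD; apply: is_trig_polyM => //; exact: is_trig_poly_pL.
Qed.

Definition node n (l : {ffun 'I_K -> 'I_n.+1}) : V := \col_j qL n (l j).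
(** The joint law of K independent binomial variables with success probabilities [pL (y j 0)]; sums
    against it factor over coordinates through [bigA_distr_bigA]. *)
Definition wt n (l : {ffun 'I_K -> 'I_n.+1}) (y : V) := \prod_j bw (pL (y j 0)) n (l j).

Lemma wt_ge0 n l y : 0 <= wt (n := n) l y.
Proof. by apply: prodr_ge0 => j _; apply: bw_ge0; exact: pL01. Qed.

Lemma wt_sum n y : \sum_l wt (n := n) l y = 1.
Proof.
rewrite /wt -(bigA_distr_bigA (fun (j : 'I_K) (l : 'I_n.+1) => bw (pL (y j 0)) n l)) /=.
by rewrite big1// => j _; exact: bw_sum.
Qed.

Lemma wt_cheb n (j : 'I_K) (y : V) : (0 < n)%N ->
  \sum_(l : {ffun 'I_K -> 'I_n.+1}) ((l j)%:R / n%:R - pL (y j 0)) ^+ 2 * wt l y <= n%:R^-1.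
Proof.
move=> n0.
pose F (i : 'I_K) (l : 'I_n.+1) := (if i == j then (l%:R / n%:R - pL (y j 0)) ^+ 2 else 1) * bw (pL (y i 0)) n l.
have -> : \sum_(l : {ffun 'I_K -> 'I_n.+1}) ((l j)%:R / n%:R - pL (y j 0)) ^+ 2 * wt l y =
      \sum_(l : {ffun 'I_K -> 'I_n.+1}) \prod_i F i (l i).
  apply: eq_bigr => l _; rewrite /F big_split/=; congr (_ * _).
  by rewrite (bigD1 j)//= eqxx big1 ?mulr1// => i /negbTE ->.
rewrite -(bigA_distr_bigA F) /= (bigD1 j)//= [X in _ * X]big1 => [|i ij]; last first.
  by rewrite /F (negbTE ij); under eq_bigr do rewrite mul1r; exact: bw_sum.
by rewrite mulr1 /F eqxx; apply: bw_cheb => //; exact: pL01.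
Qed.

Definition bern n (f : V -> R) y := \sum_l f (node l) * wt (n := n) l y.

Lemma is_trig_poly_bern n f : is_trig_poly (bern n f).
Proof.
apply: is_trig_poly_sum => l; apply: is_trig_polyM; first exact: is_trig_poly_cst.
by apply: is_trig_poly_prod => j; exact: is_trig_poly_bw.
Qed.

Lemma bern_bd n f M : (forall v, `|f v| <= M) -> forall y, `|bern n f y| <= M.
Proof.
move=> fM y; rewrite /bern; apply: le_trans (ler_norm_sum _ _ _) _.
rewrite -[M]mulr1 -(wt_sum n y) mulr_sumr; apply: ler_sum => l _.
by rewrite normrM (ger0_norm (wt_ge0 _ _)) ler_wpM2r// wt_ge0.
Qed.

(** Bernstein's argument. Nodes within [eta] of y contribute at most [e]. At any other node some
    coordinate is off by [eta], so [qL_sep] forces 1 <= c |l_j / n - pL (y_j)| with c = 36 L^2 /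
    eta^2, and Chebyshev bounds their total weight through [wt_cheb]. *)
Lemma bern_approx n f (M e eta : R) : (0 < n)%N -> (forall v, `|f v| <= M) -> 0 < eta ->
  (forall x q : V, (forall j, `|x j 0| <= L) -> (forall j, `|q j 0| <= L) ->
     (forall j, `|x j 0 - q j 0| < eta) -> `|f x - f q| <= e) -> 0 <= e ->
  forall y : V, (forall j, `|y j 0| <= L) ->
  `|f y - bern n f y| <= e + 2 * M * (36 * L ^+ 2 / eta ^+ 2) ^+ 2 * K%:R / n%:R.
Proof.
move=> n0 fM eta0 uc e0 y yL.
set c := 36 * L ^+ 2 / eta ^+ 2.
have M0 : 0 <= M by apply: le_trans (fM 0).
have -> : f y - bern n f y = \sum_l (f y - f (node l)) * wt (n := n) l y.
  by rewrite /bern -{1}[f y]mulr1 -(wt_sum n y) mulr_sumr -sumrB; apply: eq_bigr => l _; rewrite mulrBl.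
apply: le_trans (ler_norm_sum _ _ _) _.
apply: (@le_trans _ _ (\sum_(l : {ffun 'I_K -> 'I_n.+1}) (e + 2 * M * c ^+ 2 * \sum_j ((l j)%:R / n%:R - pL (y j 0)) ^+ 2) * wt l y)).
  apply: ler_sum => l _; rewrite normrM (ger0_norm (wt_ge0 _ _)) ler_wpM2r ?wt_ge0//.
  have sq0 : 0 <= \sum_j ((l j)%:R / n%:R - pL (y j 0)) ^+ 2 by apply: sumr_ge0 => j _; exact: sqr_ge0.
  have C0 : 0 <= 2 * M * c ^+ 2 by rewrite mulr_ge0 ?sqr_ge0// mulr_ge0.
  have [/forallP h|] := boolP [forall j, `|y j 0 - node l j 0| < eta].
    apply: (@le_trans _ _ e); last by rewrite lerDl mulr_ge0.
    apply: uc => // j; rewrite mxE.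
    by have [] := @qL_sep (y j 0) n (l j) n0 (ltn_ord (l j)) (yL j).
  rewrite negb_forall => /existsP[j]; rewrite -leNgt mxE => hj.
  have [_ h] := @qL_sep (y j 0) n (l j) n0 (ltn_ord (l j)) (yL j).
  have h1 : 1 <= c * `|(l j)%:R / n%:R - pL (y j 0)|.
    rewrite /c mulrAC ler_pdivlMr ?exprn_gt0// mul1r; apply: le_trans h.
    by rewrite -[leRHS](@ger0_norm _ (_ ^+ 2)) ?sqr_ge0// normrX ler_pXn2r// nnegrE ltW.
  have h2 : 1 <= c ^+ 2 * \sum_j ((l j)%:R / n%:R - pL (y j 0)) ^+ 2.
    have h3 : 1 <= (c * `|(l j)%:R / n%:R - pL (y j 0)|) ^+ 2 by rewrite exprn_ege1.
    apply: (le_trans h3); rewrite exprMn real_normK ?num_real// ler_wpM2l ?sqr_ge0//.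
    by rewrite (bigD1 j)//= lerDl; apply: sumr_ge0 => i _; exact: sqr_ge0.
  apply: (@le_trans _ _ (2 * M)).
    by apply: le_trans (ler_normB _ _) _; have := fM y; have := fM (node l); lra.
  rewrite -mulrA; have : 2 * M * 1 <= 2 * M * (c ^+ 2 * \sum_j ((l j)%:R / n%:R - pL (y j 0)) ^+ 2).
    by rewrite ler_wpM2l// mulr_ge0.
  lra.
under eq_bigr do rewrite mulrDl.
rewrite big_split/= -mulr_sumr wt_sum mulr1 lerD2l.
under eq_bigr do rewrite -mulrA mulr_suml.
rewrite -mulr_sumr exchange_big/= -[leRHS]mulrA ler_wpM2l//.
  by rewrite mulr_ge0 ?sqr_ge0// mulr_ge0.
apply: (@le_trans _ _ (\sum_(j < K) n%:R^-1)); first by apply: ler_sum => j _; exact: wt_cheb.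
by rewrite sumr_const card_ord mulr_natl.
Qed.

(** Heine-Cantor on the box with the second point unrestricted. Compactness is used in its
    near-covering form: the local radius [eta] found around each v works for all v' near it, hence
    one radius works on the box. *)
Lemma unif_cont (f : V -> R) (e : R) : continuous f -> 0 < e ->
  exists2 eta, 0 < eta & forall x q : V, (forall j, `|x j 0| <= L) ->
     (forall j, `|x j 0 - q j 0| < eta) -> `|f x - f q| <= e.
Proof.
move=> cf e0.
have cA : compact [set v : 'rV[R]_K | forall i, `[- L, L]%classic (v ord0 i)].
  by apply: (@rV_compact R K (fun=> `[- L, L]%classic)) => i; exact: segment_compact.
move/compact_near_coveringP : cA => /(_ _ (0 : R)^'+ (fun eta v => forall q : V,
   (forall j, `|v 0 j - q j 0| < eta) -> `|f v^T - f q| <= e)).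
case.
- move=> v _.
  have e2 : 0 < e / 2 by rewrite divr_gt0.
  have /cvg_ballP/(_ _ e2) := cf v^T.
  move=> /nbhs_ballP[r /= r0 hr].
  have r2 : 0 < r / 2 by rewrite divr_gt0.
  exists (ball v (r / 2), [set eta | 0 < eta < r / 2]) => /=.
    split; first exact: nbhsx_ballx.
    by near=> t; apply/andP; split.
  move=> [v' eta] [/= bv' /andP[eta0 etar]] q hq.
  have b1 : ball (f v^T) (e / 2) (f v'^T).
    apply: hr; split=> // i j; rewrite !mxE ord1.
    have [_ h] := bv'; have := h 0 i; rewrite /ball/=; lra.
  have b2 : ball (f v^T) (e / 2) (f q).
    apply: hr; split=> // i j; rewrite !mxE ord1 /ball/=.
    have [_ h] := bv'; have := h 0 i; rewrite /ball/= => h1.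
    have -> : v 0 i - q i 0 = (v 0 i - v' 0 i) + (v' 0 i - q i 0) by ring.
    apply: le_lt_trans (ler_normD _ _) _; have := hq i; lra.
  have -> : f v'^T - f q = - (f v^T - f v'^T) + (f v^T - f q) by ring.
  apply: le_trans (ler_normD _ _) _; rewrite normrN.
  move: b1 b2; rewrite /ball/=; lra.
- move=> eta0 /= eta00 h.
  exists (eta0 / 2); first by rewrite divr_gt0.
  move=> x q xL xq; rewrite -[x]trmxK; apply: (h (eta0 / 2)) => //=.
  + by rewrite sub0r normrN ger0_norm ?divr_ge0 ?(ltW eta00)//; lra.
  + by rewrite divr_gt0.
  + by move=> i; rewrite mxE /= in_itv/= -ler_norml.
  + by move=> j; rewrite mxE.
Unshelve. all: by end_near.
Qed.

End TrigPoly.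

(** The bound [M] holds on the whole space and not just on the box; this controls the mass outside
    the box when expectations are compared. *)
Lemma trig_approx {R : realType} K (f : 'cV[R]_K -> R) (M L e : R) : continuous f ->
  (forall v, `|f v| <= M) -> 0 < L -> 0 < e ->
  exists s, (forall y, `|trig_poly s y| <= M) /\
   (forall y : 'cV[R]_K, (forall j, `|y j 0| <= L) -> `|f y - trig_poly s y| <= e).
Proof.
move=> cf fM L0 e0; have e2 : 0 < e / 2 by rewrite divr_gt0.
have [eta eta0 uc] := unif_cont L cf e2.
set c := 2 * M * (36 * L ^+ 2 / eta ^+ 2) ^+ 2 * K%:R.
have c0 : 0 <= c.
  have M0 : 0 <= M by exact: le_trans (normr_ge0 _) (fM 0).
  by rewrite mulr_ge0// mulr_ge0 ?sqr_ge0// mulr_ge0.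
have [n hn] : exists n : nat, c / n.+1%:R <= e / 2.
  exists (Num.truncn (c / (e / 2))); rewrite ler_pdivrMr// mulrC -ler_pdivrMr//.
  exact: ltW (truncnS_gt _).
have [s hs] := is_trig_poly_bern L n.+1 f.
exists s; split=> [y|y yL]; rewrite -hs; first exact: bern_bd.
apply: le_trans (bern_approx L0 (ltn0Sn n) fM eta0 _ (ltW e2) yL) _.
  by move=> x q xL _ xq; exact: uc.
by rewrite -/c [leRHS]splitr lerD2l.
Qed.

(** * Convergence in law to a normal distribution *)

Section ConvergenceInLaw.
Context {d : measure_display} {T : measurableType d} {R : realType}.
Variables (P : probability T R) (K : nat).
Notation V := ('cV[R]_K).
Implicit Types (S W : T -> V).

Definition rvec S := forall j, measurable_fun setT (fun w => S w j 0).

Lemma rvec_lin S (a : 'rV[R]_K) : rvec S -> measurable_fun setT (fun w => (a *m S w) 0 0).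
Proof.
move=> mS; under eq_fun do rewrite mxE.
apply: measurable_sum => j; apply: measurable_funM; [exact: measurable_cst|exact: mS].
Qed.

Lemma rvec_cos S (th : R) (a : 'rV[R]_K) : rvec S -> measurable_fun setT (fun w => cos (th + (a *m S w) 0 0)).
Proof.
move=> mS; apply: cos_meas; apply: measurable_funD; [exact: measurable_cst|exact: rvec_lin].
Qed.

Lemma trig_poly_meas (s : seq (R * R * 'rV[R]_K)) S : rvec S -> measurable_fun setT (fun w => trig_poly s (S w)).
Proof.
move=> mS; rewrite /trig_poly; apply: measurable_sum => t; apply: measurable_funM; first exact: measurable_cst.
exact: rvec_cos.
Qed.

(* The trigonometric polynomials approximating f on growing boxes converge to f pointwise. *)
Lemma cont_meas (f : V -> R) M S : continuous f -> (forall v, `|f v| <= M) -> rvec S ->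
  measurable_fun setT (f \o S).
Proof.
move=> cf fM mS.
have H n : exists s, forall y : V, (forall j, `|y j 0| <= n.+1%:R) -> `|f y - trig_poly s y| <= n.+1%:R^-1.
  have n0 : (0 : R) < n.+1%:R by rewrite ltr0n.
  have i0 : (0 : R) < n.+1%:R^-1 by rewrite invr_gt0.
  by have [s [_ hs]] := trig_approx cf fM n0 i0; exists s.
pose s n := projT1 (cid (H n)); have hs n := projT2 (cid (H n)).
apply: (@measurable_fun_cvg _ _ _ _ (fun n w => trig_poly (s n) (S w))) => [n|w _]; first exact: trig_poly_meas.
apply/cvgrPdist_le => e e0; have near_ge : \forall n \near \oo, \sum_i `|S w i 0| <= n.+1%:R.
  exists (Num.truncn (\sum_i `|S w i 0|)) => // n /= hn.
  by apply: ltW; apply: lt_le_trans (truncnS_gt _) _; rewrite ler_nat ltnS.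
near=> n.
apply: (@le_trans _ _ (n.+1%:R^-1)).
  apply: hs => j.
  apply: (@le_trans _ _ (\sum_i `|S w i 0|)); last by near: n.
  by rewrite (bigD1 j)//= lerDl; apply: sumr_ge0.
near: n; have /cvgrPdist_le/(_ e e0) := @cvg_harmonic R.
by apply: filterS => n; rewrite /harmonic/= sub0r normrN ger0_norm// invr_ge0.
Unshelve. all: by end_near.
Qed.

(** The sets [A j] are exceptional events: off them the integrand is at most [e], on them the crude
    bound [c] is paid. *)
Lemma Ex_off_bad (X : T -> R) (A : 'I_K -> set T) (e c : R) : measurable_fun setT X ->
  (forall j, measurable (A j)) -> (forall w, `|X w| <= e + c * \sum_j \1_(A j) w) ->
  `|Ex P X| <= e + c * \sum_j prb P (A j).
Proof.
move=> mX mA XA.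
have i1 j : ig P (\1_(A j)) by exact: ig_indic.
have i2 : ig P (fun w => \sum_j \1_(A j) w) by exact: ig_sum.
have i3 : ig P (fun w => e + c * \sum_j \1_(A j) w) by apply: igD; [exact: ig_cst|exact: igZ].
rewrite (_ : e + _ = Ex P (fun w => e + c * \sum_j \1_(A j) w)); last first.
  rewrite ExD ?Ex_cst ?ExZ//; [|exact: ig_cst|exact: igZ].
  by rewrite Ex_sum//; congr (_ + _ * _); apply: eq_bigr => j _; rewrite Ex_indic.
by apply: Ex_norm_le => //; exact: ig_le XA.
Qed.

Lemma rvec_levset S (e : R) j : rvec S -> measurable [set w | e < `|S w j 0|].
Proof. by move=> mS; apply: levset_meas; exact: measurableT_comp. Qed.

Lemma rvecB S W : rvec S -> rvec W -> rvec (fun w => S w - W w).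
Proof.
move=> mS mW j; under eq_fun do rewrite !mxE.
by apply: measurable_funB; [exact: mS|exact: mW].
Qed.

Variables (S W : nat -> T -> V).
Hypothesis mS : forall k, rvec (S k).
Hypothesis mW : forall k, rvec (W k).
Hypothesis close : forall j (e : R), 0 < e ->
  prb P [set w | e < `|(S k w - W k w) j 0|] @[k --> \oo] --> (0 : R).

Lemma close_sum (e eta : R) : 0 < e -> 0 < eta ->
  \forall k \near \oo, \sum_j prb P [set w | e < `|(S k w - W k w) j 0|] <= eta.
Proof.
move=> e0 eta0.
have : \sum_j prb P [set w | e < `|(S k w - W k w) j 0|] @[k --> \oo] --> (\sum_(j < K) (0 : R)).
  by apply: cvg_sumR => j _; exact: close.
rewrite big1// => /cvgrPdist_le/(_ _ eta0); apply: filterS => k.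
rewrite sub0r normrN ger0_norm//; apply: sumr_ge0 => j _; exact: prb_ge0.
Qed.

Lemma slutsky_cos (a : 'rV[R]_K) (th c : R) :
  Ex P (fun w => cos (th + (a *m W k w) 0 0)) @[k --> \oo] --> c ->
  Ex P (fun w => cos (th + (a *m S k w) 0 0)) @[k --> \oo] --> c.
Proof.
move=> /cvgrPdist_le h; apply/cvgrPdist_le => e e0.
have e3 : 0 < e / 3 by rewrite divr_gt0.
(* The cosine is 1-Lipschitz, so deviations of at most [dl] in every coordinate move it by at most N
   dl = e/3; the 1 keeps N positive when a = 0. On the exceptional events the difference is at most
   2, which is why their total probability is kept below e/6. *)
pose N := 1 + \sum_j `|a 0 j|.
have N0 : 0 < N by rewrite /N ltr_pwDl// sumr_ge0.
pose dl := e / 3 / N; have dl0 : 0 < dl by rewrite divr_gt0.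
have e6 : 0 < e / 6 by rewrite divr_gt0.
near=> k.
have h1 : `|c - Ex P (fun w => cos (th + (a *m W k w) 0 0))| <= e / 3 by near: k; exact: h.
have h2 : \sum_j prb P [set w | dl < `|(S k w - W k w) j 0|] <= e / 6.
  by near: k; exact: close_sum.
have h3 : `|Ex P (fun w => cos (th + (a *m W k w) 0 0) - cos (th + (a *m S k w) 0 0))| <=
    e / 3 + 2 * \sum_j prb P [set w | dl < `|(S k w - W k w) j 0|].
  apply: Ex_off_bad => [|j|w].
  - by apply: measurable_funB; exact: rvec_cos.
  - by apply: (@rvec_levset (fun w => S k w - W k w)); exact: rvecB.
  have [/forallP b|] := boolP [forall j, `|(S k w - W k w) j 0| <= dl].
    rewrite big1 ?mulr0 ?addr0 => [|j _]; last first.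
      by rewrite indicE memNset//=; apply/negP; rewrite -leNgt.
    apply: le_trans (cos_lip _ _) _.
    have -> : th + (a *m W k w) 0 0 - (th + (a *m S k w) 0 0) = - (a *m (S k w - W k w)) 0 0.
      by rewrite mulmxBr !mxE; ring.
    rewrite normrN mxE; apply: le_trans (ler_norm_sum _ _ _) _.
    apply: (@le_trans _ _ (\sum_j `|a 0 j| * dl)).
      by apply: ler_sum => j _; rewrite normrM ler_wpM2l.
    rewrite -mulr_suml /dl mulrC -[leRHS](@divfK _ N) ?gt_eqF// ler_wpM2l//; first exact: ltW.
    by rewrite /N lerDr.
  rewrite negb_forall => /existsP[j]; rewrite -ltNge => hj.
  have b1 : 1 <= \sum_i \1_[set w | dl < `|(S k w - W k w) i 0|] w :> R.
    rewrite (bigD1 j)//= indicE mem_set//= lerDl.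
    by apply: sumr_ge0 => i _; rewrite indicE.
  apply: le_trans (ler_normB _ _) _.
  have := cos_max (th + (a *m W k w) 0 0); have := cos_max (th + (a *m S k w) 0 0); lra.
have h4 : Ex P (fun w => cos (th + (a *m W k w) 0 0) - cos (th + (a *m S k w) 0 0)) =
    Ex P (fun w => cos (th + (a *m W k w) 0 0)) - Ex P (fun w => cos (th + (a *m S k w) 0 0)).
  apply: ExB; apply: ig_cos; apply: measurable_funD => //; exact: rvec_lin.
move: h1 h2 h3; rewrite h4 !ler_norml => /andP[u1 u2] u3 /andP[u4 u5].
by clear - u1 u2 u3 u4 u5; apply/andP; split; lra.
Unshelve. all: by end_near.
Qed.

Hypothesis tight : forall e : R, 0 < e -> exists2 L : R, 0 < L &
  \forall k \near \oo, forall j, prb P [set w | L < `|W k w j 0|] <= e.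

Lemma slutsky_tight (e : R) : 0 < e -> exists2 L : R, 0 < L &
  \forall k \near \oo, forall j, prb P [set w | L < `|S k w j 0|] <= e.
Proof.
move=> e0; have e2 : 0 < e / 2 by rewrite divr_gt0.
have [L L0 hL] := tight e2; exists (L + 1); first by rewrite addr_gt0.
near=> k => j.
have h1 : prb P [set w | L < `|W k w j 0|] <= e / 2.
  by move: j; near: k; exact: hL.
have h2 : prb P [set w | 1 < `|(S k w - W k w) j 0|] <= e / 2.
  apply: (@le_trans _ _ (\sum_j prb P [set w | 1 < `|(S k w - W k w) j 0|])).
    by rewrite (bigD1 j)//= lerDl sumr_ge0// => i _; exact: prb_ge0.
  by near: k; exact: close_sum.
have m1 := rvec_levset L j (mW k).
have m2 := rvec_levset 1 j (rvecB (mS k) (mW k)).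
apply: le_trans (prb_le P (rvec_levset _ j (mS k)) (measurableU _ _ m1 m2) _) _.
  move=> w /= h; have [|h3] := ltP L `|W k w j 0|; [by left|right].
  rewrite ltNge; apply/negP; rewrite !mxE => h4.
  have : `|S k w j 0| <= `|W k w j 0| + `|S k w j 0 - W k w j 0|.
    by rewrite -{1}[S k w j 0](subrK (W k w j 0)) addrC ler_normD.
  lra.
apply: le_trans (prb_U P m1 m2) _; lra.
Unshelve. all: by end_near.
Qed.

(** A bounded continuous substitute for the indicator of leaving a box: outside the box of size 1/c
    some coordinate contributes at least 1/2. On the Gaussian side only the functional [Nop] is at
    hand, and its tails are controlled by letting c tend to 0 in [Nop_dct]. *)
Definition tailf (c : R) (y : V) := \sum_j (1 - (1 + (c * y j 0) ^+ 2)^-1).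

Lemma tailf_cvg (c : nat -> R) c0 (vn : nat -> V) (v : V) : c n @[n --> \oo] --> c0 ->
  (forall j, vn n j 0 @[n --> \oo] --> v j 0) -> tailf (c n) (vn n) @[n --> \oo] --> tailf c0 v.
Proof.
move=> hc hv; apply: cvg_sumR => j _; apply: cvgB; first exact: cvg_cst.
apply: cvgV; first by rewrite gt_eqF// ltr_wpDr// sqr_ge0.
apply: cvgD; first exact: cvg_cst.
by apply: cvgM; apply: cvgM.
Qed.

Lemma tailf01 (x : R) : 0 <= 1 - (1 + x ^+ 2)^-1 <= 1.
Proof.
have := sqr_ge0 x => x0.
have h : (1 + x ^+ 2)^-1 <= 1 by rewrite invf_le1 ?ltr_wpDr// lerDl.
have h' : 0 <= (1 + x ^+ 2)^-1 by rewrite invr_ge0 addr_ge0.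
by apply/andP; split; lra.
Qed.

Lemma tailf_bd c y : `|tailf c y| <= K%:R.
Proof.
rewrite ger0_norm; last by apply: sumr_ge0 => j _; have /andP[] := tailf01 (c * y j 0).
rewrite -[K in leRHS]card_ord -sumr_const; apply: ler_sum => j _.
by have /andP[] := tailf01 (c * y j 0).
Qed.

Lemma tailf_ge (L : R) (y : V) : 0 < L -> ~~ [forall j, `|y j 0| <= L] -> 1 <= 2 * tailf L^-1 y.
Proof.
move=> L0; rewrite negb_forall => /existsP[j]; rewrite -ltNge => hj.
have h1 : 1 <= (L^-1 * y j 0) ^+ 2.
  rewrite -(@ger0_norm _ (_ ^+ 2)) ?sqr_ge0// normrX exprn_ege1// normrM ger0_norm ?invr_ge0; last exact: ltW.
  by rewrite mulrC ler_pdivlMr// mul1r ltW.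
have h2 : (1 + (L^-1 * y j 0) ^+ 2)^-1 <= 2^-1.
  by rewrite lef_pV2 ?posrE//; [lra|rewrite ltr_wpDr// sqr_ge0].
have : 1 - (1 + (L^-1 * y j 0) ^+ 2)^-1 <= tailf L^-1 y.
  rewrite /tailf (bigD1 j)//= lerDl; apply: sumr_ge0 => i _.
  by have /andP[] := tailf01 (L^-1 * y i 0).
lra.
Qed.

Lemma tailf_BC c : BC (tailf c).
Proof.
by split; [move=> vn v h; apply: tailf_cvg => //; exact: cvg_cst|exists K%:R => v; exact: tailf_bd].
Qed.

Lemma trig_poly_BC (s : seq (R * R * 'rV[R]_K)) : BC (trig_poly s).
Proof.
rewrite /trig_poly; elim: s => [|t s [c1 [M b1]]].
  by under eq_fun do rewrite big_nil; exact: BC_cst.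
under eq_fun do rewrite big_cons.
apply: BCD; last by split=> //; exists M.
apply: BCZ; split; last by exists 1 => v; exact: cos_max.
move=> vn v h.
apply: (@cvg_comp _ _ _ (fun n => t.1.2 + (t.2 *m vn n) 0 0) cos); last exact: continuous_cos.
apply: cvgD; first exact: cvg_cst.
rewrite mxE; under eq_fun do rewrite mxE.
by apply: cvg_sumR => j _; apply: cvgM; [exact: cvg_cst|exact: h].
Qed.

(* Levy's continuity theorem combined with Slutsky's lemma, for a nondegenerate Gaussian limit. *)
Theorem conv_law_normal_cos (U : 'M[R]_K) : U^T = U -> posdef U ->
  (forall (a : 'rV[R]_K) th, Ex P (fun w => cos (th + (a *m W k w) 0 0)) @[k --> \oo] -->
     expR (- (a *m U *m a^T) 0 0 / 2) * cos th) ->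
  conv_law_normal P S U.
Proof.
move=> sU pU hW f cf [M fM].
have [L [m [L0 L1 m0 NE Ncos]]] := normal_expectE sU pU.
have M0 : 0 <= M by exact: le_trans (normr_ge0 _) (fM 0).
have fBC : BC f by split; [exact: continuous_scont|exists M].
rewrite NE//.
have tpc (s : seq (R * R * 'rV[R]_K)) : Ex P (fun w => trig_poly s (S k w)) @[k --> \oo] --> Nop L m K (trig_poly s) 0.
  elim: s => [|t s IH].
    rewrite /trig_poly; under eq_fun do under eq_fun do rewrite big_nil.
    rewrite (_ : (fun y => _) = fun=> 0); last by apply/funext => y; rewrite big_nil.
    rewrite Nop_cst; under eq_fun do rewrite Ex_cst; exact: cvg_cst.
  have E y : trig_poly (t :: s) y = t.1.1 * cos (t.1.2 + (t.2 *m y) 0 0) + trig_poly s y by rewrite /trig_poly big_cons.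
  have -> : Nop L m K (trig_poly (t :: s)) 0 = t.1.1 * (expR (- (t.2 *m U *m t.2^T) 0 0 / 2) * cos t.1.2) + Nop L m K (trig_poly s) 0.
    rewrite (_ : trig_poly (t :: s) = fun y => t.1.1 * cos (t.1.2 + (t.2 *m y) 0 0) + trig_poly s y); last exact/funext.
    have bc : BC (fun y : V => cos (t.1.2 + (t.2 *m y) 0 0)).
      have := trig_poly_BC [:: (1, t.1.2, t.2)]; congr BC.
      by apply/funext => y; rewrite /trig_poly big_seq1 mul1r.
    by rewrite NopD ?NopZ ?Ncos//; [exact: BCZ|exact: trig_poly_BC].
  have -> : (fun k => Ex P (fun w => trig_poly (t :: s) (S k w))) =
      (fun k => t.1.1 * Ex P (fun w => cos (t.1.2 + (t.2 *m S k w) 0 0)) + Ex P (fun w => trig_poly s (S k w))).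
    apply/funext => k; under [X in Ex P X]eq_fun do rewrite E.
    have ic : ig P (fun w => cos (t.1.2 + (t.2 *m S k w) 0 0)).
      by apply: ig_cos; apply: measurable_funD => //; exact: rvec_lin.
    have [_ [B bB]] := trig_poly_BC s.
    rewrite ExD ?ExZ//; first exact: igZ.
    by apply: (@ig_bd _ _ _ _ _ B) => [|w]; [exact: trig_poly_meas|exact: bB].
  apply: cvgD => //; apply: cvgM; first exact: cvg_cst.
  exact: slutsky_cos.
apply/cvgrPdist_le => e e0.
(* The total error budget in units of [eta]: 1 + 4 M for approximating f under the Gaussian
   functional ([A1]), 1 for the convergence of trigonometric expectations ([A2]), and 1 + 2 M K for
   approximating f under the law of S ([A3]). *)
pose D : R := 3 + 4 * M + 2 * M * K%:R.
have D0 : 0 < D by rewrite /D; have := ler0n R K; nra.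
pose eta : R := e / D; have eta0 : 0 < eta by rewrite divr_gt0.
have [L' L'0 hL'] := slutsky_tight eta0.
(* One box serves both laws: its size n + 1 makes the Gaussian tail small and exceeds the tightness
   level of the sequence S. *)
have [n hn] : exists n : nat, Nop L m K (tailf n.+1%:R^-1) 0 <= eta /\ L' <= n.+1%:R.
  have : Nop L m K (tailf n.+1%:R^-1) 0 @[n --> \oo] --> Nop L m K (fun=> 0) 0.
    apply: (@Nop_dct R K L m K (fun n => tailf n.+1%:R^-1) (fun=> 0) K%:R) => //.
    - by move=> n; exact: tailf_BC.
    - exact: BC_cst.
    - by move=> n v; exact: tailf_bd.
    - move=> vn v h; have -> : 0 = tailf 0 v.
        by rewrite /tailf big1// => j _; rewrite mul0r expr0n addr0 invr1 subrr.
      by apply: tailf_cvg => //; exact: cvg_harmonic.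
    - by move=> j; exact: cvg_cst.
  rewrite Nop_cst => /cvgrPdist_le/(_ _ eta0)[N _ hN].
  exists (N + Num.truncn L')%N; split.
    have := hN (N + Num.truncn L')%N; rewrite /= leq_addr => /(_ isT).
    by rewrite sub0r normrN; apply: le_trans; exact: ler_norm.
  apply: ltW; apply: lt_le_trans (truncnS_gt _) _.
  by rewrite ler_nat ltnS leq_addl.
have [hn1 hn2] := hn.
have n0 : (0 : R) < n.+1%:R by rewrite ltr0n.
have [s [sM fs]] := trig_approx cf fM n0 eta0.
have bcs := trig_poly_BC s.
have fs2 y : `|f y - trig_poly s y| <= 2 * M.
  by apply: le_trans (ler_normB _ _) _; have := fM y; have := sM y; lra.
have A1 : `|Nop L m K f 0 - Nop L m K (trig_poly s) 0| <= eta + 4 * M * eta.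
  have h : forall y, `|f y - trig_poly s y| <= eta + 4 * M * tailf n.+1%:R^-1 y.
    move=> y; have t0 : 0 <= tailf n.+1%:R^-1 y.
      by apply: sumr_ge0 => j _; have /andP[] := tailf01 (n.+1%:R^-1 * y j 0).
    have [/forallP h|h] := boolP [forall j, `|y j 0| <= n.+1%:R].
      by apply: le_trans (fs _ h) _; rewrite lerDl mulr_ge0// mulr_ge0.
    have := tailf_ge n0 h; have := fs2 y; have := ltW eta0; clear - M0; nra.
  have b1 : BC (fun y => eta + 4 * M * tailf n.+1%:R^-1 y).
    by apply: BCD; [exact: BC_cst|apply: BCZ; exact: tailf_BC].
  have u0 : Nop L m K (fun y => eta + 4 * M * tailf n.+1%:R^-1 y) 0 = eta + 4 * M * Nop L m K (tailf n.+1%:R^-1) 0.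
    by rewrite NopD ?Nop_cst ?NopZ//; [exact: tailf_BC|exact: BC_cst|apply: BCZ; exact: tailf_BC].
  have u1 : Nop L m K f 0 <= Nop L m K (trig_poly s) 0 + (eta + 4 * M * Nop L m K (tailf n.+1%:R^-1) 0).
    rewrite -u0 -NopD//; apply: Nop_le => //; first exact: BCD.
    by move=> y; have := h y; rewrite ler_norml => /andP[]; clear; lra.
  have u2 : Nop L m K (trig_poly s) 0 <= Nop L m K f 0 + (eta + 4 * M * Nop L m K (tailf n.+1%:R^-1) 0).
    rewrite -u0 -NopD//; apply: Nop_le => //; first exact: BCD.
    by move=> y; have := h y; rewrite ler_norml => /andP[]; clear; lra.
  have u3 : 4 * M * Nop L m K (tailf n.+1%:R^-1) 0 <= 4 * M * eta by rewrite ler_wpM2l// mulr_ge0.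
  by clear - u1 u2 u3; rewrite ler_norml; apply/andP; split; lra.
near=> k.
have A2 : `|Nop L m K (trig_poly s) 0 - Ex P (fun w => trig_poly s (S k w))| <= eta.
  by near: k; move/cvgrPdist_le : (tpc s) => /(_ _ eta0).
have A3 : `|Ex P (fun w => trig_poly s (S k w) - f (S k w))| <= eta + 2 * M * (eta * K%:R).
  apply: (@le_trans _ _ (eta + 2 * M * \sum_j prb P [set w | L' < `|S k w j 0|])).
    apply: Ex_off_bad => [|j|w].
    - by apply: measurable_funB; [exact: trig_poly_meas|exact: (cont_meas cf fM)].
    - exact: rvec_levset.
    rewrite distrC; have s0 : 0 <= \sum_j \1_[set w | L' < `|S k w j 0|] w :> R.
      by apply: sumr_ge0 => j _; rewrite indicE.
    have [/forallP h|] := boolP [forall j, `|S k w j 0| <= n.+1%:R].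
      by apply: le_trans (fs _ h) _; rewrite lerDl mulr_ge0// mulr_ge0.
    rewrite negb_forall => /existsP[j]; rewrite -ltNge => hj.
    have b1 : 1 <= \sum_i \1_[set w | L' < `|S k w i 0|] w :> R.
      rewrite (bigD1 j)//= indicE mem_set//=; last exact: le_lt_trans hj.
      by rewrite lerDl; apply: sumr_ge0 => i _; rewrite indicE.
    have := fs2 (S k w); have := ltW eta0; clear - b1 M0; nra.
  rewrite lerD2l ler_wpM2l ?mulr_ge0// mulr_natr -[K in leRHS]card_ord -sumr_const.
  by apply: ler_sum => j _; move: j; near: k; exact: hL'.
have E : Ex P (fun w => trig_poly s (S k w) - f (S k w)) = Ex P (fun w => trig_poly s (S k w)) - Ex P (f \o S k).
  apply: ExB.
    by apply: (@ig_bd _ _ _ _ _ M) => [|w]; [exact: trig_poly_meas|exact: sM].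
  by apply: (@ig_bd _ _ _ _ _ M) => [|w]; [exact: (cont_meas cf fM)|exact: fM].
rewrite E in A3.
have eE : e = eta * D by rewrite /eta divfK// gt_eqF.
move: A1 A2 A3; rewrite eE /D !ler_norml => /andP[u1 u2] /andP[u3 u4] /andP[u5 u6].
by clear - u1 u2 u3 u4 u5 u6; apply/andP; split; lra.
Unshelve. all: by end_near.
Qed.

End ConvergenceInLaw.

(** * Finite sums and second moments *)

Section FiniteSums.
Context {R : realType}.

Lemma sq_sum_le n (a : 'I_n -> R) : (\sum_i a i) ^+ 2 <= n%:R * \sum_i a i ^+ 2.
Proof.
rewrite expr2 mulr_suml.
apply: (@le_trans _ _ (\sum_(i < n) \sum_(j < n) (a i ^+ 2 / 2 + a j ^+ 2 / 2))).
  apply: ler_sum => i _; rewrite mulr_sumr; apply: ler_sum => j _.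
  have := sqr_ge0 (a i - a j); nra.
under eq_bigr do rewrite big_split/= sumr_const card_ord.
by rewrite big_split/= sumrMnl sumr_const card_ord -mulr_suml -mulrnDl -splitr mulr_natl.
Qed.

Lemma pow4_sum_le n (a : 'I_n -> R) : (\sum_i a i) ^+ 4 <= n%:R ^+ 3 * \sum_i a i ^+ 4.
Proof.
have h1 := sq_sum_le a; have h2 := sq_sum_le (fun i => a i ^+ 2).
rewrite (exprM _ 2 2).
apply: (@le_trans _ _ ((n%:R * \sum_i a i ^+ 2) ^+ 2)).
  by rewrite ler_pXn2r ?nnegrE ?sqr_ge0// mulr_ge0// sumr_ge0// => i _; exact: sqr_ge0.
rewrite exprMn [n%:R ^+ 3]exprSr -mulrA ler_wpM2l ?sqr_ge0//.
by under [in leRHS]eq_bigr do rewrite (exprM _ 2 2).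
Qed.

(** Grouping pairs by lag: m - u pairs on each side of the diagonal have lag u. The induction adds
    the last row and column; the diagonal is counted once, through p 0. *)
Lemma sum_lag (h : nat -> nat -> R) (p q : nat -> R) m :
  (forall t u, h t (t + u)%N = p u) -> (forall t u, h (t + u)%N t = q u) ->
  \sum_(t < m) \sum_(u < m) h t u = m%:R * p 0%N + \sum_(1 <= u < m) (m - u)%:R * (p u + q u).
Proof.
move=> hp hq; elim: m => [|m IH]; first by rewrite big_ord0 mul0r big_geq// addr0.
rewrite big_ord_recr/=; under eq_bigr do rewrite big_ord_recr/=.
rewrite big_split/= IH big_ord_recr/=.
have -> : h m m = p 0%N by rewrite -{2}[m]addn0 hp.
have e1 : \sum_(t < m) h t m = \sum_(1 <= u < m.+1) p u.
  rewrite big_add1/= big_mkord (reindex_inj rev_ord_inj)/=; apply: eq_bigr => t _.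
  by rewrite -(hp (m - t.+1)%N) subnK.
have e2 : \sum_(t < m) h m t = \sum_(1 <= u < m.+1) q u.
  rewrite big_add1/= big_mkord (reindex_inj rev_ord_inj)/=; apply: eq_bigr => t _.
  by rewrite -(hq (m - t.+1)%N) subnK.
have -> : \sum_(1 <= u < m.+1) (m.+1 - u)%:R * (p u + q u) =
    \sum_(1 <= u < m.+1) (m - u)%:R * (p u + q u) + \sum_(1 <= u < m.+1) (p u + q u).
  rewrite -big_split/= !big_nat; apply: eq_bigr => u /andP[_ um].
  by rewrite subSn// -natr1 mulrDl mul1r.
have -> : \sum_(1 <= u < m.+1) (m - u)%:R * (p u + q u) = \sum_(1 <= u < m) (m - u)%:R * (p u + q u).
  case: m {IH e1 e2} => [|m]; first by rewrite !big_geq.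
  by rewrite big_nat_recr//= subnn mul0r addr0.
rewrite e1 e2 big_split/= -natr1; ring.
Qed.

End FiniteSums.

Section SecondMoments.
Context {d : measure_display} {T : measurableType d} {R : realType}.
Variable P : probability T R.
Implicit Types X Y : T -> R.

Lemma ig_mul X Y : measurable_fun setT X -> measurable_fun setT Y ->
  ig P (fun w => X w ^+ 2) -> ig P (fun w => Y w ^+ 2) ->
  ig P (fun w => X w * Y w) /\
  Ex P (fun w => `|X w * Y w|) <= (Ex P (fun w => X w ^+ 2) + Ex P (fun w => Y w ^+ 2)) / 2.
Proof.
move=> mX mY iX iY.
have le w : `|X w * Y w| <= 2^-1 * (X w ^+ 2 + Y w ^+ 2).
  have h := sqr_ge0 (X w - Y w); have h' := sqr_ge0 (X w + Y w).
  by rewrite ler_norml; apply/andP; split; nra.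
have i2 : ig P (fun w => 2^-1 * (X w ^+ 2 + Y w ^+ 2)) by apply: igZ; exact: igD.
have iXY : ig P (fun w => X w * Y w) by apply: ig_le i2 le => //; exact: measurable_funM.
split=> //; rewrite mulrC -ExD// -ExZ; last exact: igD.
by apply: Ex_le => //; exact: ig_norm.
Qed.

Lemma ig_sq_of_mul X Y : measurable_fun setT X -> measurable_fun setT Y ->
  ig P (fun w => X w ^+ 4) -> ig P (fun w => Y w ^+ 4) ->
  ig P (fun w => (X w * Y w) ^+ 2) /\
  Ex P (fun w => (X w * Y w) ^+ 2) <= (Ex P (fun w => X w ^+ 4) + Ex P (fun w => Y w ^+ 4)) / 2.
Proof.
move=> mX mY iX iY.
have E Z : (fun w => Z w ^+ 4) = (fun w => (Z w ^+ 2) ^+ 2) :> (T -> R).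
  by apply/funext => w; rewrite -exprM.
have [||||i1 e1] := @ig_mul (fun w => X w ^+ 2) (fun w => Y w ^+ 2).
- exact: measurable_funX.
- exact: measurable_funX.
- by rewrite -E.
- by rewrite -E.
rewrite -!E in e1.
have E2 : (fun w => (X w * Y w) ^+ 2) = (fun w => X w ^+ 2 * Y w ^+ 2).
  by apply/funext => w; rewrite exprMn.
rewrite E2; split=> //; apply: le_trans e1; apply: Ex_le => //; first exact: ig_norm.
by move=> w; exact: ler_norm.
Qed.

Lemma ig_sq_cst_sub X c : measurable_fun setT X -> ig P (fun w => X w ^+ 2) ->
  ig P X /\ ig P (fun w => (X w - c) ^+ 2).
Proof.
move=> mX iX.
have iX1 : ig P X.
  rewrite (_ : X = fun w => X w * 1); last by apply/funext => w; rewrite mulr1.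
  by have [] := ig_mul mX (measurable_cst (1 : R)) iX (ig_cst P (1 ^+ 2)).
split=> //; rewrite (_ : (fun w => _) = fun w => (X w ^+ 2 - (2 * c) * X w) + c ^+ 2); last first.
  by apply/funext => w; ring.
by apply: igD; [apply: igB => //; exact: igZ|exact: ig_cst].
Qed.

Lemma var_sum n (X : nat -> T -> R) : (forall i, measurable_fun setT (X i)) ->
  (forall i, ig P (fun w => X i w ^+ 2)) ->
  (forall i j, i != j -> Ex P (fun w => X i w * X j w) = Ex P (X i) * Ex P (X j)) ->
  ig P (fun w => (\sum_(i < n) (X i w - Ex P (X i))) ^+ 2) /\
  Ex P (fun w => (\sum_(i < n) (X i w - Ex P (X i))) ^+ 2) <= \sum_(i < n) Ex P (fun w => X i w ^+ 2).
Proof.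
move=> mX iX uc.
pose Y i w := X i w - Ex P (X i).
have mY i : measurable_fun setT (Y i) by apply: measurable_funB => //; exact: measurable_cst.
have iX1 i : ig P (X i) by have [] := ig_sq_cst_sub 0 (mX i) (iX i).
have iY i : ig P (fun w => Y i w ^+ 2) by have [] := ig_sq_cst_sub (Ex P (X i)) (mX i) (iX i).
have iYY i j : ig P (fun w => Y i w * Y j w) by have [] := ig_mul (mY i) (mY j) (iY i) (iY j).
have iXX i j : ig P (fun w => X i w * X j w) by have [] := ig_mul (mX i) (mX j) (iX i) (iX j).
have E : (fun w => (\sum_(i < n) Y i w) ^+ 2) = (fun w => \sum_(i < n) \sum_(j < n) Y i w * Y j w).
  by apply/funext => w; rewrite expr2 mulr_suml; apply: eq_bigr => i _; rewrite mulr_sumr.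
have EYY i j : Ex P (fun w => Y i w * Y j w) = Ex P (fun w => X i w * X j w) - Ex P (X i) * Ex P (X j).
  rewrite (_ : (fun w => _) = fun w => (X i w * X j w - Ex P (X j) * X i w) - (Ex P (X i) * X j w - Ex P (X i) * Ex P (X j))); last first.
    by apply/funext => w; rewrite /Y; ring.
  rewrite ExB; [|apply: igB => //; exact: igZ|apply: igB; [exact: igZ|exact: ig_cst]].
  rewrite ExB//; last exact: igZ.
  rewrite [X in _ - X]ExB; [|exact: igZ|exact: ig_cst].
  by rewrite Ex_cst !ExZ//; ring.
rewrite -/(Y _ _) E; split; first by apply: ig_sum => i _; exact: ig_sum.
rewrite Ex_sum => [|i _]; last exact: ig_sum.
apply: ler_sum => i _; rewrite Ex_sum// (bigD1 i)//= big1 => [|j ji]; last first.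
  by rewrite EYY uc ?subrr// eq_sym.
rewrite addr0 EYY lerBlDr; under eq_fun do rewrite -expr2.
by rewrite lerDl -expr2 sqr_ge0.
Qed.

(** By [var_sq] the square of the second moment is at most C m^2; C <= (C + 1)^2 avoids a square
    root. *)
Lemma Ex_sq_le X (C m : R) : measurable_fun setT X -> 0 <= C -> 0 <= m -> ig P (fun w => X w ^+ 4) ->
  Ex P (fun w => X w ^+ 4) <= C * m ^+ 2 -> Ex P (fun w => X w ^+ 2) <= (C + 1) * m.
Proof.
move=> mX C0 m0 i4 E4.
have h := var_sq mX i4.
have h2 : (Ex P (fun w => X w ^+ 2)) ^+ 2 <= ((C + 1) * m) ^+ 2.
  apply: le_trans h _; apply: le_trans E4 _; rewrite exprMn ler_wpM2r ?sqr_ge0//; nra.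
rewrite -(@ler_pXn2r _ 2)// nnegrE; last by rewrite mulr_ge0// addr_ge0.
by apply: Ex_ge0 => w; exact: sqr_ge0.
Qed.

Lemma cheb2 X (e C : R) : measurable_fun setT X -> 0 < e -> ig P (fun w => X w ^+ 2) ->
  Ex P (fun w => X w ^+ 2) <= C -> prb P [set w | e < `|X w|] <= C / e ^+ 2.
Proof.
move=> mX e0 iX EX; have e2 : 0 < e ^+ 2 by rewrite exprn_gt0.
have := markov_prb e2 iX (fun w => sqr_ge0 (X w)).
move=> h; apply: (@le_trans _ _ (Ex P (fun w => X w ^+ 2) / e ^+ 2)); last first.
  by rewrite ler_wpM2r// invr_ge0 ltW.
apply: le_trans h; apply: prb_le.
- by apply: (@levset_meas _ _ _ (fun w => `|X w|)); exact: measurableT_comp.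
- rewrite -[X in measurable X]setTI; apply: measurable_fun_le => //; exact: measurable_funX.
move=> w /= h; rewrite -[leRHS]ger0_norm ?sqr_ge0// normrX ler_pXn2r ?nnegrE// ltW//.
Qed.

Lemma cheb1 X (e C : R) : 0 < e -> ig P X ->
  Ex P (fun w => `|X w|) <= C -> prb P [set w | e < `|X w|] <= C / e.
Proof.
move=> e0 iX EX; have mX := ig_meas iX.
have h := markov_prb e0 (ig_norm iX) (fun w => normr_ge0 (X w)).
apply: (@le_trans _ _ (Ex P (fun w => `|X w|) / e)); last by rewrite ler_wpM2r// invr_ge0 ltW.
apply: le_trans h; apply: prb_le.
- by apply: (@levset_meas _ _ _ (fun w => `|X w|)); exact: measurableT_comp.
- by rewrite -[X in measurable X]setTI; apply: measurable_fun_le => //; exact: measurableT_comp.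
by move=> w /= /ltW.
Qed.

End SecondMoments.

(** * Coercive matrices and perturbed linear systems *)

Section Coercive.
Context {R : realType} (K : nat).
Implicit Types (v q : 'cV[R]_K) (A D S : 'M[R]_K).

Definition nsq v : R := \sum_i v i 0 ^+ 2.

Lemma nsq_ge0 v : 0 <= nsq v.
Proof. by apply: sumr_ge0 => i _; exact: sqr_ge0. Qed.

Lemma nsqE v : (v^T *m v) 0 0 = nsq v.
Proof. by rewrite mxE; apply: eq_bigr => i _; rewrite mxE expr2. Qed.

Lemma nsq_coord v i : v i 0 ^+ 2 <= nsq v.
Proof. by rewrite /nsq (bigD1 i)//= lerDl; apply: sumr_ge0 => j _; exact: sqr_ge0. Qed.

Lemma nsqD v q : nsq (v + q) <= 2 * nsq v + 2 * nsq q.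
Proof.
rewrite /nsq !mulr_sumr -big_split/=; apply: ler_sum => i _; rewrite mxE.
have := sqr_ge0 (v i 0 - q i 0); nra.
Qed.

Lemma nsq_gt0 v : v != 0 -> 0 < nsq v.
Proof.
move=> v0; rewrite lt_neqAle nsq_ge0 andbT eq_sym; apply: contraNneq v0 => h.
apply/eqP/matrixP => i j; rewrite ord1 mxE; apply/eqP; rewrite -sqrf_eq0.
by rewrite eq_le sqr_ge0 andbT -h; exact: nsq_coord.
Qed.

Definition coercive (l : R) A := forall v, l * nsq v <= (v^T *m A *m v) 0 0.

Lemma coercive_posdef l A : 0 < l -> coercive l A -> posdef A.
Proof. by move=> l0 cA v v0; apply: lt_le_trans (cA v); rewrite mulr_gt0// nsq_gt0. Qed.

Lemma dot_young (c : R) v q : 0 < c -> (v^T *m q) 0 0 <= c / 2 * nsq v + (2 * c)^-1 * nsq q.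
Proof.
move=> c0; rewrite mxE /nsq !mulr_sumr -big_split/=; apply: ler_sum => i _; rewrite mxE.
have h := sqr_ge0 (c * v i 0 - q i 0).
rewrite -subr_ge0 (_ : _ - _ = (2 * c)^-1 * (c * v i 0 - q i 0) ^+ 2); last by field; rewrite gt_eqF.
by rewrite mulr_ge0// invr_ge0 mulr_ge0// ltW.
Qed.

(** Young's inequality with weight l gives l |v|^2 <= v.Av <= (l/2) |v|^2 + |Av|^2 / (2 l), and the
    first term on the right is absorbed. *)
Lemma coercive_solve l A v : 0 < l -> coercive l A -> nsq v <= (l ^+ 2)^-1 * nsq (A *m v).
Proof.
move=> l0 cA; have h1 := cA v; have h2 := dot_young v (A *m v) l0.
rewrite mulmxA in h2; rewrite mulrC ler_pdivlMr ?exprn_gt0//.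
have h3 : l / 2 * nsq v <= (2 * l)^-1 * nsq (A *m v) by lra.
have : l / 2 * nsq v * (2 * l) <= (2 * l)^-1 * nsq (A *m v) * (2 * l) by rewrite ler_wpM2r// mulr_ge0// ltW.
rewrite [X in _ <= X -> _]mulrAC mulVf ?mul1r ?gt_eqF ?mulr_gt0//.
by apply: le_trans; rewrite le_eqVlt; apply/orP; left; apply/eqP; field.
Qed.

Lemma nsq_mul A v (dl : R) : (forall a b, `|A a b| <= dl) -> nsq (A *m v) <= (K%:R * dl) ^+ 2 * nsq v.
Proof.
move=> Ad; rewrite {1}/nsq.
apply: (@le_trans _ _ (\sum_(a < K) K%:R * dl ^+ 2 * nsq v)).
  apply: ler_sum => a _; rewrite mxE; apply: le_trans (sq_sum_le _) _.
  rewrite -mulrA ler_wpM2l// /nsq mulr_sumr; apply: ler_sum => b _.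
  rewrite exprMn ler_wpM2r ?sqr_ge0// -[leLHS]ger0_norm ?sqr_ge0// normrX.
  by rewrite ler_pXn2r ?nnegrE// (le_trans _ (Ad a b)).
by rewrite sumr_const card_ord -mulr_natl le_eqVlt; apply/orP; left; apply/eqP; ring.
Qed.

(** Entries of size [dl] change the quadratic form by at most K dl |v|^2, which the assumption keeps
    below half of the coercivity constant. *)
Lemma coercive_perturb l S D (dl : R) : coercive l S -> (forall a b, `|(D - S) a b| <= dl) ->
  K%:R * dl <= l / 2 -> 0 <= dl -> 0 < l -> coercive (l / 2) D.
Proof.
move=> cS Dd Kd d0 l0 v.
have h1 := cS v.
have [K0|K0] := posnP K.
  have v0 : v = 0 by apply/matrixP => i; have := ltn_ord i; rewrite {2}K0.
  rewrite v0 !mulmx0 mxE /nsq big1 ?mulr0// => i _; by rewrite mxE expr0n.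
have h2 : - (l / 2 * nsq v) <= (v^T *m (D - S) *m v) 0 0.
  have h3 := dot_young (- v) ((D - S) *m v) (_ : 0 < l / 2).
  have h4 := nsq_mul v Dd.
  have n0 := nsq_ge0 v.
  have nN : nsq (- v) = nsq v by apply: eq_bigr => i _; rewrite mxE sqrrN.
  have h5 : nsq ((D - S) *m v) <= (l / 2) ^+ 2 * nsq v.
    apply: le_trans h4 _; rewrite ler_wpM2r// ler_pXn2r ?nnegrE ?mulr_ge0//.
    by rewrite ltW// divr_gt0.
  have l2 : 0 < l / 2 by rewrite divr_gt0.
  have := h3 l2; rewrite nN linearN/= mulNmx mxE mulmxA => h6.
  have h7 : (2 * (l / 2))^-1 * nsq ((D - S) *m v) <= (2 * (l / 2))^-1 * ((l / 2) ^+ 2 * nsq v).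
    by rewrite ler_wpM2l// invr_ge0 mulr_ge0// ltW.
  have h8 : (2 * (l / 2))^-1 * ((l / 2) ^+ 2 * nsq v) = l / 2 / 2 * nsq v by field; rewrite gt_eqF.
  lra.
have E : (v^T *m D *m v) 0 0 = (v^T *m S *m v) 0 0 + (v^T *m (D - S) *m v) 0 0.
  by rewrite -[in LHS](subrK S D) mulmxDr mulmxDl mxE addrC.
rewrite E; lra.
Qed.

(* [D w = q] and [S w0 = q0] give [S (w - w0) = (S - D) w + (q - q0)]. *)
Lemma perturb_solve l S D q q0 (dl : R) : coercive l S -> (forall a b, `|(D - S) a b| <= dl) ->
  K%:R * dl <= l / 2 -> 0 <= dl -> 0 < l ->
  D \in unitmx /\ nsq (invmx D *m q - invmx S *m q0) <=
    (l ^+ 2)^-1 * (2 * ((K%:R * dl) ^+ 2 * (((l / 2) ^+ 2)^-1 * nsq q)) + 2 * nsq (q - q0)).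
Proof.
move=> cS Dd Kd d0 l0; have cD := coercive_perturb cS Dd Kd d0 l0.
have l2 : 0 < l / 2 by rewrite divr_gt0.
have uD := posdef_unit (coercive_posdef l2 cD); have uS := posdef_unit (coercive_posdef l0 cS).
split=> //; apply: le_trans (coercive_solve _ l0 cS) _.
rewrite ler_wpM2l ?invr_ge0 ?exprn_ge0 ?(ltW l0)//.
have -> : S *m (invmx D *m q - invmx S *m q0) = (S - D) *m (invmx D *m q) + (q - q0).
  by rewrite mulmxBr mulmxBl !mulmxA !mulmxV// !mul1mx addrA subrK.
apply: le_trans (nsqD _ _) _; rewrite lerD2r ler_wpM2l//.
have h1 : nsq (invmx D *m q) <= ((l / 2) ^+ 2)^-1 * nsq q.
  by have := coercive_solve (invmx D *m q) l2 cD; rewrite mulmxA mulmxV// mul1mx.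
apply: (@le_trans _ _ ((K%:R * dl) ^+ 2 * nsq (invmx D *m q))); last by rewrite ler_wpM2l// sqr_ge0.
by apply: nsq_mul => a b; rewrite -opprB mxE normrN.
Qed.

End Coercive.

(** * Measurability of matrix expressions; union and moment bounds *)

Section MeasurableInverse.
Context {d : measure_display} {T : measurableType d} {R : realType}.

(** The inverse is written as x |x|^-2, a product of functions known to be measurable; at x = 0 both
    sides are 0 by convention. *)
Lemma measurable_invr (X : T -> R) : measurable_fun setT X -> measurable_fun setT (fun w => (X w)^-1).
Proof.
move=> mX; rewrite (_ : (fun w => _) = fun w => X w * (`|X w| `^ (-1)) ^+ 2).
  by apply: measurable_funM => //; apply: measurable_funX; exact: powR_meas.
apply/funext => w; rewrite powR_inv1// exprVn real_normK ?num_real//.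
have [->|x0] := eqVneq (X w) 0; first by rewrite invr0 mul0r.
by rewrite expr2 invfM mulrA mulfV// mul1r.
Qed.

Definition mxmeas m n (A : T -> 'M[R]_(m, n)) := forall i j, measurable_fun setT (fun w => A w i j).

Lemma det_meas n (A : T -> 'M[R]_n) : mxmeas A -> measurable_fun setT (fun w => \det (A w)).
Proof.
move=> mA; rewrite /determinant; apply: measurable_sum => s.
apply: measurable_funM; first exact: measurable_cst.
by apply: measurable_prod => i _; exact: mA.
Qed.

(** [invmx] returns its argument on singular matrices, so the entries are cofactor quotients where
    the determinant is nonzero and entries of A elsewhere. *)
Lemma invmx_meas n (A : T -> 'M[R]_n) : mxmeas A -> mxmeas (fun w => invmx (A w)).
Proof.
move=> mA i j.
have madj : measurable_fun setT (fun w => (\adj (A w)) i j).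
  under eq_fun do rewrite mxE; rewrite /cofactor; apply: measurable_funM; first exact: measurable_cst.
  apply: det_meas => a b; under eq_fun do rewrite !mxE; exact: mA.
have mdet := det_meas mA.
rewrite (_ : (fun w => _) = fun w => if ~~ (\det (A w) == 0) then (\det (A w))^-1 * (\adj (A w)) i j else A w i j).
  apply: measurable_fun_ifT; last exact: mA.
    by apply: measurable_neg; apply: measurable_fun_eqr => //; exact: measurable_cst.
  by apply: measurable_funM => //; exact: measurable_invr.
by apply/funext => w; rewrite /invmx unitmxE unitfE; case: ifP => // _; rewrite mxE.
Qed.

Lemma mulmx_meas m n p (A : T -> 'M[R]_(m, n)) (B : T -> 'M[R]_(n, p)) : mxmeas A -> mxmeas B ->
  mxmeas (fun w => A w *m B w).
Proof.
move=> mA mB i j; under eq_fun do rewrite mxE.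
by apply: measurable_sum => k; apply: measurable_funM.
Qed.

Lemma summx_meas m n I (s : seq I) (A : I -> T -> 'M[R]_(m, n)) : (forall i, mxmeas (A i)) ->
  mxmeas (fun w => \sum_(i <- s) A i w).
Proof. by move=> mA a b; under eq_fun do rewrite summxE; apply: measurable_sum => i; exact: mA. Qed.

Lemma scalemx_meas m n (c : T -> R) (A : T -> 'M[R]_(m, n)) : measurable_fun setT c -> mxmeas A ->
  mxmeas (fun w => c w *: A w).
Proof. by move=> mc mA i j; under eq_fun do rewrite mxE; exact: measurable_funM. Qed.

Lemma subx_meas m n (A B : T -> 'M[R]_(m, n)) : mxmeas A -> mxmeas B -> mxmeas (fun w => A w - B w).
Proof. by move=> mA mB i j; under eq_fun do rewrite !mxE; exact: measurable_funB. Qed.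

Variable P : probability T R.

Lemma prb_union (I : finType) (A : set T) (B : I -> set T) : measurable A ->
  (forall i, measurable (B i)) -> (forall w, A w -> exists i, B i w) ->
  prb P A <= \sum_i prb P (B i).
Proof.
move=> mA mB AB; rewrite -Ex_indic//.
under eq_bigr => i _ do rewrite -Ex_indic//.
rewrite -Ex_sum => [|i _]; last exact: ig_indic.
apply: Ex_le => [||w]; [exact: ig_indic|by apply: ig_sum => i _; exact: ig_indic|].
have s0 (i : I) : (0 : R) <= \1_(B i) w by rewrite indicE.
have [Aw|Aw] := pselect (A w); last first.
  by rewrite [leLHS]indicE memNset//= sumr_ge0.
have [i Bi] := AB w Aw; rewrite indicE mem_set//= (bigD1 i)//= indicE mem_set//= lerDl sumr_ge0//.
Qed.

(** From 2 |X| c <= X^2 + c^2: a second moment of order c^2 gives a first absolute moment of order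
    c. *)
Lemma Ex_norm_le_sq (X : T -> R) (c C : R) : measurable_fun setT X -> 0 < c -> ig P (fun w => X w ^+ 2) ->
  Ex P (fun w => X w ^+ 2) <= c ^+ 2 * C -> Ex P (fun w => `|X w|) <= c * (C + 1).
Proof.
move=> mX c0 iX EX; have h0 : 0 <= Ex P (fun w => X w ^+ 2) by apply: Ex_ge0 => w; exact: sqr_ge0.
have C0 : 0 <= C by rewrite -(@pmulr_rge0 _ (c ^+ 2)) ?exprn_gt0// (le_trans h0).
have [iXc h] := @ig_mul _ _ _ P X (fun=> c) mX (measurable_cst c) iX (ig_cst P (c ^+ 2)).
rewrite Ex_cst in h.
have [iX1 _] := ig_sq_cst_sub 0 mX iX.
have E : Ex P (fun w => `|X w * c|) = Ex P (fun w => `|X w|) * c.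
  rewrite -ExZr; last exact: ig_norm.
  by congr (Ex P _); apply/funext => w; rewrite normrM (gtr0_norm c0).
rewrite -(ler_pM2r c0) -E; apply: le_trans h _.
apply: (@le_trans _ _ (c ^+ 2 * C + c ^+ 2)); last by rewrite le_eqVlt; apply/orP; left; apply/eqP; ring.
have : 0 <= c ^+ 2 * C by rewrite mulr_ge0// sqr_ge0.
have := sqr_ge0 c; lra.
Qed.

End MeasurableInverse.

(** * The within-group estimator *)

Section WithinGroup.
Context {d : measure_display} {T : measurableType d} {R : realType}.
Variables (P : probability T R) (K : nat).
Variables (x : nat -> nat -> T -> 'cV[R]_K) (eps : nat -> nat -> T -> R) (r s : R).
Hypothesis mx : forall i t (k : 'I_K), measurable_fun setT (fun w => x i t w k 0).
Hypothesis me : forall i t, measurable_fun setT (eps i t).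
Hypothesis Eeps : forall i t, Ex P (eps i t) = 0.
Hypothesis Exeps : forall i t, Evec P (fun w => eps i t w *: x i t w) = 0.
Hypothesis r2 : 2 < r.
Hypothesis mom1 : exists C : R, forall i t (k : 'I_K),
     ('E_P[fun w => (`|x i t w k ord0| `^ (2 * r))%R] <= C%:E)%E /\
     ('E_P[fun w => (`|eps i t w| `^ (2 * r))%R] <= C%:E)%E.
Hypothesis mom2 : exists C : R, forall i t (k : 'I_K),
     ('E_P[fun w => (`|x i t w k ord0 * eps i t w| `^ (3 * r))%R] <= C%:E)%E.
Hypothesis ind : indep_across_i P x eps.
Hypothesis stat : forall i, stationary_i P x eps i.
Hypothesis s_gt : 4 * r / (r - 2) < s.
Hypothesis mix : strong_mixing_rate P x eps s.

Notation sig := (sig_times x eps).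

Definition z (i : nat) (k : 'I_K) (t : nat) (w : T) : R := x i t w k 0 - Ex P (fun w => x i t w k 0).

Lemma zcE i k t w : zc P x i t w k 0 = z i k t w.
Proof. by rewrite /zc /z !mxE. Qed.

Lemma smeas_z i k t (S : set nat) : S t -> smeas (sig i S) (z i k t).
Proof. by move=> St; apply: smeasB; [exact: smeas_x|exact: smeas_cst]. Qed.

Lemma smeas_zeps i k t (S : set nat) : S t -> smeas (sig i S) (fun w => z i k t w * eps i t w).
Proof. by move=> St; apply: smeasM; [exact: smeas_z|exact: smeas_eps]. Qed.

Lemma z_meas i k t : measurable_fun setT (z i k t).
Proof. by apply: measurable_funB; [exact: mx|exact: measurable_cst]. Qed.

Lemma zeps_meas i k t : measurable_fun setT (fun w => z i k t w * eps i t w).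
Proof. by apply: measurable_funM; [exact: z_meas|exact: me]. Qed.

Lemma powR_sub_le (a b p : R) : 0 <= p -> `|a - b| `^ p <= 2 `^ p * (`|a| `^ p + `|b| `^ p).
Proof.
move=> p0.
wlog ab : a b / `|b| <= `|a|.
  move=> h; have [ab|ab] := leP `|b| `|a|; first exact: h.
  by rewrite distrC [X in _ * X]addrC; apply: h; exact: ltW.
apply: (@le_trans _ _ ((2 * `|a|) `^ p)).
  apply: ge0_ler_powR => //; rewrite ?nnegrE ?mulr_ge0//.
  by apply: le_trans (ler_normB _ _) _; lra.
by rewrite powRM// ler_wpM2l ?powR_ge0// lerDl powR_ge0.
Qed.

Definition mom_le (X : T -> R) (M : R) := [/\ measurable_fun setT X,
  ig P (fun w => `|X w| `^ (2 * r)) & Ex P (fun w => `|X w| `^ (2 * r)) <= M].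

Lemma mom_ig1 X M : mom_le X M -> ig P X /\ `|Ex P X| <= 1 + M.
Proof.
move=> [mX iX EX].
have p1 : 1 <= 2 * r by have := r2; lra.
have i1 : ig P (fun w => 1 + `|X w| `^ (2 * r)) by apply: igD => //; exact: ig_cst.
have iX1 : ig P X by apply: ig_le i1 _ => // w; exact: norm_le_powR.
split=> //; apply: (@le_trans _ _ (Ex P (fun w => 1 + `|X w| `^ (2 * r)))).
  by apply: Ex_norm_le => // w; exact: norm_le_powR.
by rewrite ExD ?Ex_cst ?lerD2l//; exact: ig_cst.
Qed.

Lemma mom_sub X Y M N : mom_le X M -> mom_le Y N ->
  mom_le (fun w => X w - Y w) (2 `^ (2 * r) * (M + N)).
Proof.
move=> [mX iX EX] [mY iY EY].
have i1 : ig P (fun w => 2 `^ (2 * r) * (`|X w| `^ (2 * r) + `|Y w| `^ (2 * r))) by apply: igZ; exact: igD.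
have p0 : 0 <= 2 * r by have := r2; lra.
have mB : measurable_fun setT (fun w => X w - Y w) by exact: measurable_funB.
have i2 : ig P (fun w => `|X w - Y w| `^ (2 * r)).
  apply: ig_le i1 _; first exact: powR_meas.
  by move=> w; rewrite ger0_norm ?powR_ge0// powR_sub_le.
split=> //; apply: (@le_trans _ _ (Ex P (fun w => 2 `^ (2 * r) * (`|X w| `^ (2 * r) + `|Y w| `^ (2 * r))))).
  by apply: Ex_le => // w; exact: powR_sub_le.
by rewrite ExZ ?ExD//; [rewrite ler_wpM2l ?powR_ge0// lerD|exact: igD].
Qed.

Lemma mom_scale (c B : R) X M : `|c| <= B -> mom_le X M -> mom_le (fun w => c * X w) (B `^ (2 * r) * M).
Proof.
move=> cB [mX iX EX].
have p0 : 0 <= 2 * r by have := r2; lra.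
have M0 : 0 <= M by apply: le_trans EX; apply: Ex_ge0 => w; exact: powR_ge0.
have E : (fun w => `|c * X w| `^ (2 * r)) = (fun w => `|c| `^ (2 * r) * `|X w| `^ (2 * r)).
  by apply/funext => w; rewrite normrM powRM.
split; first by apply: measurable_funM => //; exact: measurable_cst.
  by rewrite E; exact: igZ.
rewrite E ExZ//; apply: ler_pM => //; rewrite ?powR_ge0//.
  by apply: Ex_ge0 => w; exact: powR_ge0.
by apply: ge0_ler_powR => //; rewrite nnegrE// (le_trans _ cB).
Qed.

Lemma mom_cst (c B : R) : `|c| <= B -> mom_le (fun=> c) (B `^ (2 * r)).
Proof.
move=> cB; have p0 : 0 <= 2 * r by have := r2; lra.
split=> //; [exact: ig_cst|rewrite Ex_cst].
by apply: ge0_ler_powR => //; rewrite nnegrE// (le_trans _ cB).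
Qed.

(** One bound on moments of order 2r for the three series fed to [sum_pow4]. Order 3r for x eps
    covers order 2r, and z eps = x eps - E(x) eps with E(x) bounded uniformly. *)
Lemma panel_mom : exists M : R, forall i t (k : 'I_K),
  [/\ mom_le (z i k t) M, mom_le (eps i t) M & mom_le (fun w => z i k t w * eps i t w) M].
Proof.
have [C1 h1] := mom1; have [C2 h2] := mom2.
have mxe i t (k : 'I_K) : measurable_fun setT (fun w => x i t w k 0 * eps i t w).
  by apply: measurable_funM; [exact: mx|exact: me].
have ix i t (k : 'I_K) : mom_le (fun w => x i t w k 0) C1.
  have [|? ?] := ig_fin (powR_meas (2 * r) (mx i t k)) _ (proj1 (h1 i t k)).
    by move=> w; exact: powR_ge0.
  by split.
have ie i t (k : 'I_K) : mom_le (eps i t) C1.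
  have [|? ?] := ig_fin (powR_meas (2 * r) (me i t)) _ (proj2 (h1 i t k)).
    by move=> w; exact: powR_ge0.
  by split.
have ixe i t (k : 'I_K) : mom_le (fun w => x i t w k 0 * eps i t w) (1 + C2).
  have [|i1 E1] := ig_fin (powR_meas (3 * r) (mxe i t k)) _ (h2 i t k).
    by move=> w; exact: powR_ge0.
  have le w : `|x i t w k 0 * eps i t w| `^ (2 * r) <= 1 + `|x i t w k 0 * eps i t w| `^ (3 * r).
    have := powR_ge0 `|x i t w k 0 * eps i t w| (3 * r).
    have [y1|y1] := leP `|x i t w k 0 * eps i t w| 1.
      have : `|x i t w k 0 * eps i t w| `^ (2 * r) <= 1 `^ (2 * r).
        by apply: ge0_ler_powR; rewrite ?nnegrE//; have := r2; lra.
      by rewrite powR1; lra.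
    have : `|x i t w k 0 * eps i t w| `^ (2 * r) <= `|x i t w k 0 * eps i t w| `^ (3 * r).
      by apply: ler_powR; [exact: ltW|have := r2; lra].
    lra.
  have i2 : ig P (fun w => 1 + `|x i t w k 0 * eps i t w| `^ (3 * r)) by apply: igD => //; exact: ig_cst.
  have i3 : ig P (fun w => `|x i t w k 0 * eps i t w| `^ (2 * r)).
    apply: ig_le i2 _; first exact: powR_meas.
    by move=> w; rewrite ger0_norm ?powR_ge0.
  split=> //; apply: (@le_trans _ _ (Ex P (fun w => 1 + `|x i t w k 0 * eps i t w| `^ (3 * r)))).
    exact: Ex_le.
  by rewrite ExD ?Ex_cst ?lerD2l//; exact: ig_cst.
pose p := 2 * r; pose B := 1 + C1.
pose M1 := 2 `^ p * (C1 + B `^ p); pose M2 := 2 `^ p * ((1 + C2) + B `^ p * C1).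
have mon X M M' : mom_le X M -> M <= M' -> mom_le X M'.
  by move=> [? ? ?] MM; split=> //; apply: le_trans MM.
exists (`|M1| + `|C1| + `|M2|) => i t k.
have B1 : `|Ex P (fun w => x i t w k 0)| <= B by have [] := mom_ig1 (ix i t k).
split.
- apply: (mon _ M1); first by apply: mom_sub => //; exact: mom_cst.
  by have := ler_norm M1; have := normr_ge0 C1; have := normr_ge0 M2; lra.
- apply: (mon _ C1) => //; first exact: ie.
  by have := ler_norm C1; have := normr_ge0 M1; have := normr_ge0 M2; lra.
- rewrite (_ : (fun w => _) = fun w => x i t w k 0 * eps i t w - Ex P (fun w => x i t w k 0) * eps i t w); last first.
    by apply/funext => w; rewrite /z mulrBl.
  apply: (mon _ M2); first by exact: mom_sub (ixe i t k) (mom_scale B1 (ie i t k)).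
  by have := ler_norm M2; have := normr_ge0 M1; have := normr_ge0 C1; lra.
Qed.

Lemma panel_ig i t (k : 'I_K) : [/\ ig P (z i k t), ig P (eps i t) & ig P (fun w => z i k t w * eps i t w)].
Proof.
have [M h] := panel_mom; have [h1 h2 h3] := h i t k.
by split; [exact: (proj1 (mom_ig1 h1))|exact: (proj1 (mom_ig1 h2))|exact: (proj1 (mom_ig1 h3))].
Qed.

Lemma ig_x i t (k : 'I_K) : ig P (fun w => x i t w k 0).
Proof.
have [iz _ _] := panel_ig i t k.
rewrite (_ : (fun w => _) = fun w => z i k t w + Ex P (fun w => x i t w k 0)); last first.
  by apply/funext => w; rewrite /z subrK.
by apply: igD => //; exact: ig_cst.
Qed.

Lemma Ex_z i t (k : 'I_K) : Ex P (z i k t) = 0.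
Proof. by rewrite /z ExB ?Ex_cst ?subrr//; [exact: ig_x|exact: ig_cst]. Qed.

Lemma Ex_zeps i t (k : 'I_K) : Ex P (fun w => z i k t w * eps i t w) = 0.
Proof.
have [iz ie ize] := panel_ig i t k.
have h : Ex P (fun w => x i t w k 0 * eps i t w) = 0.
  have := congr1 (fun v : 'cV[R]_K => v k 0) (Exeps i t); rewrite !mxE => h; rewrite -[RHS]h.
  by congr (Ex P _); apply/funext => w; rewrite !mxE mulrC.
have E : (fun w => x i t w k 0 * eps i t w) = (fun w => z i k t w * eps i t w + Ex P (fun w => x i t w k 0) * eps i t w).
  by apply/funext => w; rewrite /z; ring.
have := h; rewrite E ExD//; last exact: igZ.
by rewrite ExZ// Eeps mulr0 addr0.
Qed.

Lemma mixing_pow4 i (u : nat -> T -> R) M C : 0 <= C ->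
  (forall i t h X Y, (0 < h)%N -> smeas (sig i [set u | (u <= t)%N]) X ->
    smeas (sig i [set u | (t + h <= u)%N]) Y -> level_mix P X Y (C * h%:R `^ (- s))) ->
  (forall t (S : set nat), S t -> smeas (sig i S) (u t)) ->
  (forall t, mom_le (u t) M) -> (forall t, Ex P (u t) = 0) ->
  forall m, ig P (fun w => (\sum_(t < m) u t w) ^+ 4) /\
    Ex P (fun w => (\sum_(t < m) u t w) ^+ 4) <= 48 * D4 C M * m%:R ^+ 2.
Proof.
move=> C0 hm su mu Eu.
have sprod (S : set nat) a b c : S a -> S b -> S c -> smeas (sig i S) (fun w => u a w * u b w * u c w).
  by move=> Sa Sb Sc; apply: smeasM; [apply: smeasM|]; exact: su.
apply: (@sum_pow4 _ _ _ P u r s C M) => //.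
- have r20 : 0 < r - 2 by have := r2; lra.
  by have := s_gt; rewrite ltr_pdivrMr// => /ltW.
- by move=> t; have [] := mu t.
- by move=> t; have [] := mu t.
- by move=> t; have [] := mu t.
- move=> t h a b c h0 ta tb tc; apply: (hm i t) => //; last exact: sprod.
  by apply: su => /=.
(* The triple now lies in the past: mixing is applied at time t - h with the two variables
   exchanged. Truncated subtraction is harmless since a + h <= t forces h <= t. *)
- move=> t h a b c h0 ta tb tc; apply: level_mixC.
  have ht : (h <= t)%N by exact: leq_trans (leq_addl _ _) ta.
  apply: (hm i (t - h)%N) => //; first by apply: sprod; rewrite /= leq_subRL// addnC.
  by apply: su => /=; rewrite subnK.
Qed.

Lemma panel_pow4 : exists2 C : R, 0 <= C & forall i m (k : 'I_K),
  [/\ ig P (fun w => (\sum_(t < m) z i k t w) ^+ 4) /\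
        Ex P (fun w => (\sum_(t < m) z i k t w) ^+ 4) <= C * m%:R ^+ 2,
      ig P (fun w => (\sum_(t < m) eps i t w) ^+ 4) /\
        Ex P (fun w => (\sum_(t < m) eps i t w) ^+ 4) <= C * m%:R ^+ 2 &
      ig P (fun w => (\sum_(t < m) z i k t w * eps i t w) ^+ 4) /\
        Ex P (fun w => (\sum_(t < m) z i k t w * eps i t w) ^+ 4) <= C * m%:R ^+ 2].
Proof.
have [C C0 hC] := mix_level mix; have [M hM] := panel_mom.
exists `|48 * D4 C M| => // i m k.
have le1 : 48 * D4 C M * m%:R ^+ 2 <= `|48 * D4 C M| * m%:R ^+ 2 by rewrite ler_wpM2r ?sqr_ge0// ler_norm.
split.
- have [i1 e1] := @mixing_pow4 i (z i k) M C C0 hC (fun t S => @smeas_z i k t S)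
    (fun t => let: And3 h _ _ := hM i t k in h) (fun t => Ex_z i t k) m.
  by split=> //; exact: le_trans e1 le1.
- have [i1 e1] := @mixing_pow4 i (eps i) M C C0 hC (fun t S => @smeas_eps _ _ _ _ _ _ i t S)
    (fun t => let: And3 _ h _ := hM i t k in h) (fun t => Eeps i t) m.
  by split=> //; exact: le_trans e1 le1.
- have [i1 e1] := @mixing_pow4 i (fun t w => z i k t w * eps i t w) M C C0 hC (fun t S => @smeas_zeps i k t S)
    (fun t => let: And3 _ _ h := hM i t k in h) (fun t => Ex_zeps i t k) m.
  by split=> //; exact: le_trans e1 le1.
Qed.

Lemma panel_pow4_one : exists2 C : R, 0 <= C & forall i t (k : 'I_K),
  [/\ ig P (fun w => z i k t w ^+ 4) /\ Ex P (fun w => z i k t w ^+ 4) <= C,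
      ig P (fun w => eps i t w ^+ 4) /\ Ex P (fun w => eps i t w ^+ 4) <= C &
      ig P (fun w => (z i k t w * eps i t w) ^+ 4) /\ Ex P (fun w => (z i k t w * eps i t w) ^+ 4) <= C].
Proof.
have [M hM] := panel_mom; exists `|1 + M| => // i t k.
have H X : mom_le X M -> ig P (fun w => X w ^+ 4) /\ Ex P (fun w => X w ^+ 4) <= `|1 + M|.
  move=> [mX iX EX].
  have i1 : ig P (fun w => 1 + `|X w| `^ (2 * r)) by apply: igD => //; exact: ig_cst.
  have p4 : 4 <= 2 * r by have := r2; lra.
  have i2 : ig P (fun w => X w ^+ 4).
    apply: ig_le i1 _; first exact: measurable_funX.
    by move=> w; rewrite ger0_norm ?pow4_le// exprn_even_ge0.
  split=> //; apply: le_trans (ler_norm _).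
  apply: le_trans (Ex_le i2 i1 (fun w => pow4_le (X w) p4)) _.
  by rewrite ExD ?Ex_cst ?lerD2l//; exact: ig_cst.
by have [h1 h2 h3] := hM i t k; split; exact: H.
Qed.

(* In the notation of the header, [Dmat], [Vv], [rho] and [kap] are D, V, rho and kappa;
   [Az i m k] is the [k]-th coordinate of m zbar_i epsbar_i. *)
Definition Sz i m k w := \sum_(t < m) z i k t w.
Definition Se i m w := \sum_(t < m) eps i t w.
Definition Szz i m a b w := \sum_(t < m) z i a t w * z i b t w.
Definition Sze i m k w := \sum_(t < m) z i k t w * eps i t w.
Definition Az i m k w := m%:R^-1 * (Sz i m k w * Se i m w).
Definition Dmat n m w : 'M[R]_K := \matrix_(a, b)
  ((n * m)%:R^-1 * \sum_(i < n) (Szz i m a b w - m%:R^-1 * (Sz i m a w * Sz i m b w))).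
Definition Vv n m w : 'cV[R]_K := \col_k ((Num.sqrt (n * m)%:R)^-1 * \sum_(i < n) Sze i m k w).
Definition rho n m w : 'cV[R]_K :=
  \col_k (- (Num.sqrt (n * m)%:R)^-1 * \sum_(i < n) (Az i m k w - Ex P (Az i m k))).
Definition kap n m : R := Num.sqrt (n * m)%:R / m%:R.

Lemma sq_z i k t : ig P (fun w => z i k t w ^+ 2).
Proof.
have [C _ h] := panel_pow4_one; have [[i4 _] _ _] := h i t k.
exact: ig_pow2 (z_meas i k t) i4.
Qed.

Lemma sq_eps (k : 'I_K) i t : ig P (fun w => eps i t w ^+ 2).
Proof.
have [C _ h] := panel_pow4_one; have [_ [i4 _] _] := h i t k.
exact: ig_pow2 (me i t) i4.
Qed.

Lemma sq_zeps i k t : ig P (fun w => (z i k t w * eps i t w) ^+ 2).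
Proof.
have [C _ h] := panel_pow4_one; have [_ _ [i4 _]] := h i t k.
exact: ig_pow2 (zeps_meas i k t) i4.
Qed.

Lemma stat_shift i (a b : 'I_K) (f g : R * R -> R) : measurable_fun setT f -> measurable_fun setT g ->
  (forall t u, ig P (fun w => f (x i t w a 0, eps i t w) * g (x i u w b 0, eps i u w))) ->
  forall t u,
   Ex P (fun w => f (x i t w a 0, eps i t w) * g (x i (t + u)%N w b 0, eps i (t + u)%N w)) =
   Ex P (fun w => f (x i 0%N w a 0, eps i 0%N w) * g (x i u w b 0, eps i u w)) /\
   Ex P (fun w => f (x i (t + u)%N w a 0, eps i (t + u)%N w) * g (x i t w b 0, eps i t w)) =
   Ex P (fun w => f (x i u w a 0, eps i u w) * g (x i 0%N w b 0, eps i 0%N w)).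
Proof.
move=> mf mg ifg t u.
split.
- apply: (stat_law mx me (tau := u) (f := fun p => f p.1 * g p.2) (stat i)).
  + exact: (measurable_funM (measurableT_comp mf measurable_fst) (measurableT_comp mg measurable_snd)).
  + exact: (ifg t (t + u)%N).
  + exact: (ifg 0%N (0 + u)%N).
- apply: (stat_law mx me (tau := u) (f := fun p => f p.2 * g p.1) (stat i)).
  + exact: (measurable_funM (measurableT_comp mf measurable_snd) (measurableT_comp mg measurable_fst)).
  + exact: (ifg (t + u)%N t).
  + exact: (ifg (0 + u)%N 0%N).
Qed.

Lemma Ex_x0 i t (k : 'I_K) : Ex P (fun w => x i t w k 0) = Ex P (fun w => x i 0%N w k 0).
Proof.
have ix t' : ig P (fun w => x i t' w k 0) by exact: ig_x.
apply: (stat_law mx me (tau := 0%N) (a := k) (b := k) (f := fun p => p.1.1) (stat i)).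
- exact: (measurableT_comp measurable_fst measurable_fst).
- exact: (ix t).
- exact: (ix 0%N).
Qed.

(** By stationarity the centring constant does not depend on t. Hence x and z have the same
    deviations from time averages, and lagged moments of z are functions of x and eps that can be
    shifted in time. *)
Lemma z0 i k t w : z i k t w = x i t w k 0 - Ex P (fun w => x i 0%N w k 0).
Proof. by rewrite -[z i k t w]/(x i t w k 0 - _) Ex_x0. Qed.

Lemma Ex_mul_lag (X Y : nat -> T -> R) (p q : nat -> R) m :
  (forall t u, ig P (fun w => X t w * Y u w)) ->
  (forall t u, Ex P (fun w => X t w * Y (t + u)%N w) = p u) ->
  (forall t u, Ex P (fun w => X (t + u)%N w * Y t w) = q u) ->
  Ex P (fun w => (\sum_(t < m) X t w) * \sum_(u < m) Y u w) =
  m%:R * p 0%N + \sum_(1 <= u < m) (m - u)%:R * (p u + q u).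
Proof.
move=> iXY hp hq; rewrite -(@sum_lag _ (fun t u => Ex P (fun w => X t w * Y u w)) p q m hp hq).
rewrite (_ : (fun w => _) = fun w => \sum_(t < m) \sum_(u < m) X t w * Y u w); last first.
  by apply/funext => w; rewrite mulr_suml; apply: eq_bigr => t _; rewrite mulr_sumr.
rewrite Ex_sum => [|t _]; last exact: ig_sum.
by apply: eq_bigr => t _; rewrite Ex_sum.
Qed.

Let mfst c : measurable_fun setT (fun p : R * R => p.1 - c).
Proof. by apply: measurable_funB; [exact: measurable_fst|exact: measurable_cst]. Qed.

Lemma ig_z_eps i k t u : ig P (fun w => z i k t w * eps i u w).
Proof. by have [] := ig_mul (z_meas i k t) (me i u) (sq_z i k t) (sq_eps k i u). Qed.

Lemma ig_zeps2 i a b t u : ig P (fun w => (z i a t w * eps i t w) * (z i b u w * eps i u w)).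
Proof.
by have [] := ig_mul (zeps_meas i a t) (zeps_meas i b u) (sq_zeps i a t) (sq_zeps i b u).
Qed.

Lemma ig_zz i a b t u : ig P (fun w => z i a t w * z i b u w).
Proof. by have [] := ig_mul (z_meas i a t) (z_meas i b u) (sq_z i a t) (sq_z i b u). Qed.

Lemma shift_z_eps i k t u : Ex P (fun w => z i k t w * eps i (t + u)%N w) = Ex P (fun w => z i k 0%N w * eps i u w) /\
  Ex P (fun w => z i k (t + u)%N w * eps i t w) = Ex P (fun w => z i k u w * eps i 0%N w).
Proof.
pose c := Ex P (fun w => x i 0%N w k 0).
have E t' u' : (fun w => z i k t' w * eps i u' w) = (fun w => (x i t' w k 0 - c) * eps i u' w).
  by apply/funext => w; rewrite z0.
have := @stat_shift i k k (fun p => p.1 - c) (fun p => p.2) (mfst c) measurable_snd _ t u.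
rewrite /= -!E; apply=> t' u'; rewrite -E; exact: ig_z_eps.
Qed.

Lemma shift_zeps2 i a b t u :
  Ex P (fun w => (z i a t w * eps i t w) * (z i b (t + u)%N w * eps i (t + u)%N w)) =
  Ex P (fun w => (z i a 0%N w * eps i 0%N w) * (z i b u w * eps i u w)) /\
  Ex P (fun w => (z i a (t + u)%N w * eps i (t + u)%N w) * (z i b t w * eps i t w)) =
  Ex P (fun w => (z i a u w * eps i u w) * (z i b 0%N w * eps i 0%N w)).
Proof.
pose c k := Ex P (fun w => x i 0%N w k 0).
pose f k (p : R * R) := (p.1 - c k) * p.2.
have mf k : measurable_fun setT (f k) by apply: measurable_funM => //; exact: measurable_snd.
have E t' u' : (fun w => (z i a t' w * eps i t' w) * (z i b u' w * eps i u' w)) =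
    (fun w => f a (x i t' w a 0, eps i t' w) * f b (x i u' w b 0, eps i u' w)).
  by apply/funext => w; rewrite !z0.
have := @stat_shift i a b (f a) (f b) (mf a) (mf b) _ t u.
rewrite /= -!E; apply=> t' u'; rewrite -E; exact: ig_zeps2.
Qed.

(** The origin of the bias: m zbar_i epsbar_i is quadratic in the sums, so its mean collects all
    lagged cross moments, m - u pairs at lag u. Lag 0 drops out because E(z eps) = 0. *)
Lemma Ex_Az i m k : (0 < m)%N -> Ex P (Az i m k) = \sum_(1 <= u < m) ((m - u)%:R / m%:R) *
  (Ex P (fun w => z i k 0%N w * eps i u w) + Ex P (fun w => z i k u w * eps i 0%N w)).
Proof.
move=> m0; have m1 : m%:R != 0 :> R by rewrite pnatr_eq0 -lt0n.
have iS : ig P (fun w => Sz i m k w * Se i m w).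
  rewrite (_ : (fun w => _) = fun w => \sum_(t < m) \sum_(u < m) z i k t w * eps i u w); last first.
    by apply/funext => w; rewrite mulr_suml; apply: eq_bigr => t _; rewrite mulr_sumr.
  by apply: ig_sum => t _; apply: ig_sum => u _; exact: ig_z_eps.
rewrite /Az ExZ// (Ex_mul_lag _ (@ig_z_eps i k) (fun t u => proj1 (shift_z_eps i k t u))
  (fun t u => proj2 (shift_z_eps i k t u))).
rewrite Ex_zeps mulr0 add0r mulr_sumr.
by apply: eq_bigr => u _; ring.
Qed.

Lemma b_nmE n m k : (0 < m)%N -> b_nm P x eps n m k 0 = - (n%:R^-1 * \sum_(i < n) Ex P (Az i m k)).
Proof.
move=> m0; rewrite /b_nm !mxE summxE; congr (- (_ * _)); apply: eq_bigr => i _.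
rewrite Ex_Az// summxE; apply: eq_bigr => u _; rewrite !mxE; congr (_ * (_ + _)).
  by congr (Ex P _); apply/funext => w; rewrite mxE zcE mulrC.
by congr (Ex P _); apply/funext => w; rewrite mxE zcE mulrC.
Qed.

Lemma zcM i t u w a b : (zc P x i t w *m (zc P x i u w)^T) a b = z i a t w * z i b u w.
Proof. by rewrite mxE big_ord1 [X in _ * X]mxE !zcE. Qed.

Lemma Sigma_nmE n m a b : Sigma_nm P x n m a b = (n * m)%:R^-1 * \sum_(i < n) Ex P (Szz i m a b).
Proof.
rewrite /Sigma_nm mxE summxE; congr (_ * _); apply: eq_bigr => i _.
rewrite summxE /Szz Ex_sum => [|t _]; last exact: ig_zz.
apply: eq_bigr => t _; rewrite mxE; congr (Ex P _); apply/funext => w.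
exact: zcM.
Qed.

(** The triangular weights (m - u)/m count the pairs at lag u, so the definition is the normalised
    covariance of the score sums [Sze]. By stationarity each of the m summands over t equals the one
    at time 0. *)
Lemma Omega_nmE n m a b : (0 < m)%N -> Omega_nm P x eps n m a b =
  (n * m)%:R^-1 * \sum_(i < n) Ex P (fun w => Sze i m a w * Sze i m b w).
Proof.
move=> m0; have m1 : m%:R != 0 :> R by rewrite pnatr_eq0 -lt0n.
rewrite /Omega_nm mxE summxE; congr (_ * _); apply: eq_bigr => i _.
rewrite (Ex_mul_lag _ (@ig_zeps2 i a b) (fun t u => proj1 (shift_zeps2 i a b t u))
  (fun t u => proj2 (shift_zeps2 i a b t u))) summxE.
set p := fun u => Ex P (fun w => (z i a 0%N w * eps i 0%N w) * (z i b u w * eps i u w)).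
set q := fun u => Ex P (fun w => (z i a u w * eps i u w) * (z i b 0%N w * eps i 0%N w)).
transitivity (\sum_(t < m) (p 0%N + \sum_(1 <= u < m) (m - u)%:R / m%:R * (p u + q u))).
  apply: eq_bigr => t _; rewrite mxE summxE; congr (_ + _).
    rewrite mxE -[RHS](proj1 (shift_zeps2 i a b t 0)) addn0; congr (Ex P _); apply/funext => w.
    by rewrite mxE zcM; ring.
  apply: eq_bigr => u _; rewrite !mxE; congr (_ * _).
  rewrite /p /q -(proj1 (shift_zeps2 i a b t u)) -(proj2 (shift_zeps2 i a b t u)) -ExD; [|exact: ig_zeps2..].
  congr (Ex P _); apply/funext => w.
  by rewrite mxE [X in _ * X]mxE !zcM; ring.
rewrite sumr_const card_ord -[LHS]mulr_natl mulrDr; congr (_ + _).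
by rewrite mulr_sumr; apply: eq_bigr => u _; rewrite mulrA [m%:R * _]mulrC divfK.
Qed.

Lemma demean_sum m (f g : nat -> R) : (0 < m)%N ->
  \sum_(t < m) (f t - m%:R^-1 * \sum_(t < m) f t) * (g t - m%:R^-1 * \sum_(t < m) g t) =
  \sum_(t < m) f t * g t - m%:R^-1 * ((\sum_(t < m) f t) * \sum_(t < m) g t).
Proof.
move=> m0; have m1 : m%:R != 0 :> R by rewrite pnatr_eq0 -lt0n.
set F := \sum_(t < m) f t; set G := \sum_(t < m) g t.
rewrite (eq_bigr (fun t : 'I_m => f t * g t - m%:R^-1 * G * f t - m%:R^-1 * F * g t + m%:R^-1 * F * (m%:R^-1 * G))).
  rewrite !big_split/= !sumrN -!mulr_sumr -/F -/G sumr_const card_ord -[G *+ m]mulr_natl.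
  by field.
by move=> t _; ring.
Qed.

Lemma x_demean m i t w k : (0 < m)%N -> (x i t w - xbar x m i w) k 0 = z i k t w - m%:R^-1 * Sz i m k w.
Proof.
move=> m0; have m1 : m%:R != 0 :> R by rewrite pnatr_eq0 -lt0n.
have -> : Sz i m k w = \sum_(t < m) x i t w k 0 - m%:R * Ex P (fun w => x i 0%N w k 0).
  by rewrite /Sz; under eq_bigr do rewrite z0; rewrite sumrB sumr_const card_ord -[X in _ - X]mulr_natl.
by rewrite /xbar !mxE summxE z0; field.
Qed.

Lemma design n m w : (0 < n)%N -> (0 < m)%N ->
  \sum_(i < n) \sum_(t < m) ((x i t w - xbar x m i w) *m (x i t w - xbar x m i w)^T) = (n * m)%:R *: Dmat n m w.
Proof.
move=> n0 m0; have N1 : (n * m)%:R != 0 :> R by rewrite pnatr_eq0 -lt0n muln_gt0 n0.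
apply/matrixP => a b; rewrite !mxE mulrA mulfV// mul1r summxE; apply: eq_bigr => i _.
rewrite summxE -(demean_sum (fun t => z i a t w) (fun t => z i b t w) m0).
by apply: eq_bigr => t _; rewrite mxE big_ord1 [X in _ * X]mxE !x_demean.
Qed.

Lemma y_demean (alpha : nat -> R) (beta : 'cV[R]_K) m i t w : (0 < m)%N -> yv x eps alpha beta i t w - ybar x eps alpha beta m i w =
  ((x i t w - xbar x m i w)^T *m beta) 0 0 + (eps i t w - m%:R^-1 * Se i m w).
Proof.
move=> m0; have m1 : m%:R != 0 :> R by rewrite pnatr_eq0 -lt0n.
have L (A B : 'cV[R]_K) : ((A - B)^T *m beta) 0 0 = (A^T *m beta) 0 0 - (B^T *m beta) 0 0.
  by rewrite linearB/= mulmxBl mxE [X in _ + X]mxE.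
rewrite /ybar /yv !big_split/= sumr_const card_ord -[alpha i *+ m]mulr_natl L.
have -> : ((xbar x m i w)^T *m beta) 0 0 = m%:R^-1 * \sum_(t < m) ((x i t w)^T *m beta) 0 0.
  by rewrite /xbar linearZ/= -scalemxAl mxE linear_sum/= mulmx_suml summxE.
by rewrite /Se; field.
Qed.

(** An exact identity wherever D is invertible. The term kap b occurs once under D^-1, from the mean
    of the products [Az], and once under Sigma^-1, from the bias correction; only the difference of
    the two inverses acts on it. *)
Lemma stat_decomp (alpha : nat -> R) (beta : 'cV[R]_K) n m w : (0 < n)%N -> (0 < m)%N -> Dmat n m w \in unitmx ->
  stat_nm P x eps alpha beta n m w =
  invmx (Dmat n m w) *m (Vv n m w + kap n m *: b_nm P x eps n m + rho n m w)
  - invmx (Sigma_nm P x n m) *m (kap n m *: b_nm P x eps n m).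
Proof.
move=> n0 m0 uD; have N0 : 0 < (n * m)%:R :> R by rewrite ltr0n muln_gt0 n0.
have N1 : (n * m)%:R != 0 :> R by rewrite gt_eqF.
have m1 : m%:R != 0 :> R by rewrite pnatr_eq0 -lt0n.
have n1 : n%:R != 0 :> R by rewrite pnatr_eq0 -lt0n.
have sN : Num.sqrt (n * m)%:R != 0 :> R by rewrite gt_eqF// sqrtr_gt0.
have sN2 : Num.sqrt (n * m)%:R * Num.sqrt (n * m)%:R = n%:R * m%:R :> R by rewrite -expr2 sqr_sqrtr ?natrM// ltW.
(* The numerator of the estimator after removal of beta: within an individual, the demeaned cross
   product of x and eps is the score sum minus m zbar_i epsbar_i. *)
pose G : 'cV[R]_K := \col_k \sum_(i < n) (Sze i m k w - Az i m k w).
have GE : (Num.sqrt (n * m)%:R)^-1 *: G = Vv n m w + kap n m *: b_nm P x eps n m + rho n m w.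
  apply/matrixP => k j; rewrite ord1 mxE [RHS]mxE [X in _ = X + _]mxE [X in _ = _ + X + _]mxE b_nmE//.
  rewrite [G k 0]mxE [Vv _ _ _ _ _]mxE [rho _ _ _ _ _]mxE !sumrB /kap.
  have -> : Num.sqrt (n * m)%:R / m%:R * - (n%:R^-1 * \sum_(i < n) Ex P (Az i m k)) =
    - ((Num.sqrt (n * m)%:R)^-1 * \sum_(i < n) Ex P (Az i m k)).
    rewrite mulrN mulrA; congr (- (_ * _)); apply: (mulfI sN).
    by rewrite !mulrA sN2 mulfV//; field; rewrite ?n1 ?m1.
  ring.
have num : \sum_(i < n) \sum_(t < m) ((yv x eps alpha beta i t w - ybar x eps alpha beta m i w) *: (x i t w - xbar x m i w)) =
    ((n * m)%:R *: Dmat n m w) *m beta + G.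
  rewrite -design// mulmx_suml; apply/matrixP => k j; rewrite ord1 [in RHS]mxE !summxE [G k 0]mxE -big_split/=.
  apply: eq_bigr => i _; rewrite mulmx_suml !summxE.
  have -> : Sze i m k w - Az i m k w = \sum_(t < m) (z i k t w - m%:R^-1 * Sz i m k w) * (eps i t w - m%:R^-1 * Se i m w).
    by rewrite (demean_sum (fun t => z i k t w) (fun t => eps i t w) m0).
  rewrite -big_split/=; apply: eq_bigr => t _; rewrite y_demean// scalerDl mxE; congr (_ + _).
    by rewrite -mulmxA [X in _ = (_ *m X) _ _]mx11_scalar mul_mx_scalar.
  by rewrite [LHS]mxE mulrC x_demean.
have uND : (n * m)%:R *: Dmat n m w \in unitmx by rewrite unitmxZ// unitfE.
rewrite /stat_nm /betahat design// num mulmxDr mulKmx// [beta + _]addrC addrK.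
rewrite invmxZ// -scalemxAl scalerBr -GE.
have -> : Num.sqrt (n * m)%:R *: ((n * m)%:R^-1 *: (invmx (Dmat n m w) *m G)) =
   invmx (Dmat n m w) *m ((Num.sqrt (n * m)%:R)^-1 *: G).
  rewrite -scalemxAr scalerA; congr (_ *: _); apply: (mulfI sN).
  by rewrite mulrA sN2 -natrM !mulfV.
by congr (_ - _); rewrite scalerA -scalemxAr.
Qed.

Lemma smeas_Sz i m k : smeas (sig i setT) (Sz i m k).
Proof. by apply: smeas_sum => t; exact: smeas_z. Qed.

Lemma smeas_Se i m : smeas (sig i setT) (Se i m).
Proof. by apply: smeas_sum => t; exact: smeas_eps. Qed.

Lemma smeas_Szz i m a b : smeas (sig i setT) (Szz i m a b).
Proof. by apply: smeas_sum => t; apply: smeasM; exact: smeas_z. Qed.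

Lemma smeas_Sze i m k : smeas (sig i setT) (Sze i m k).
Proof. by apply: smeas_sum => t; exact: smeas_zeps. Qed.

Lemma smeas_Az i m k : smeas (sig i setT) (Az i m k).
Proof.
by apply: smeasM; [exact: smeas_cst|apply: smeasM; [exact: smeas_Sz|exact: smeas_Se]].
Qed.

Let mS i (X : T -> R) : smeas (sig i setT) X -> measurable_fun setT X.
Proof. exact: (smeas_meas mx me). Qed.
Let mSz i m k : measurable_fun setT (Sz i m k).
Proof. exact: mS (@smeas_Sz i m k). Qed.
Let mSe i m : measurable_fun setT (Se i m).
Proof. exact: mS (@smeas_Se i m). Qed.
Let mSzz i m a b : measurable_fun setT (Szz i m a b).
Proof. exact: mS (@smeas_Szz i m a b). Qed.
Let mSze i m k : measurable_fun setT (Sze i m k).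
Proof. exact: mS (@smeas_Sze i m k). Qed.
Let mAz i m k : measurable_fun setT (Az i m k).
Proof. exact: mS (@smeas_Az i m k). Qed.

Lemma panel_var n (X : nat -> T -> R) (A : R) : (forall i, smeas (sig i setT) (X i)) ->
  (forall i, ig P (fun w => X i w ^+ 2)) -> (forall i, Ex P (fun w => X i w ^+ 2) <= A) ->
  ig P (fun w => (\sum_(i < n) (X i w - Ex P (X i))) ^+ 2) /\
  Ex P (fun w => (\sum_(i < n) (X i w - Ex P (X i))) ^+ 2) <= n%:R * A.
Proof.
move=> sX iX EX.
have mX i : measurable_fun setT (X i) by exact: mS (sX i).
have [i j ij|i1 e1] := var_sum n mX iX.
  exact: (indep_L2 (mX i) (mX j) (indep_level2 ind ij (sX i) (sX j)) (iX i) (iX j)).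
split=> //; apply: le_trans e1 _.
rewrite mulr_natl -[n in leRHS]card_ord -sumr_const; apply: ler_sum => i _; exact: EX.
Qed.

(** [Az] is of order 1 because (Sz Se)^2 <= (Sz^4 + Se^4)/2 is of order m^2 in mean. For [Szz] the
    crude Cauchy-Schwarz order m^2 suffices, since averaging over independent individuals supplies a
    factor 1/n. *)
Lemma panel_bounds : exists2 C : R, 0 < C & forall i m (k a b : 'I_K), (0 < m)%N ->
  [/\ [/\ ig P (fun w => Sz i m k w ^+ 2), Ex P (fun w => Sz i m k w ^+ 2) <= C * m%:R,
          ig P (fun w => Sze i m k w ^+ 4) & Ex P (fun w => Sze i m k w ^+ 4) <= C * m%:R ^+ 2],
      [/\ ig P (fun w => Sze i m k w ^+ 2), Ex P (fun w => Sze i m k w ^+ 2) <= C * m%:R,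
          ig P (fun w => Szz i m a b w ^+ 2) & Ex P (fun w => Szz i m a b w ^+ 2) <= C * m%:R ^+ 2],
      [/\ ig P (fun w => Az i m k w ^+ 2), Ex P (fun w => Az i m k w ^+ 2) <= C &
          Ex P (fun w => `|Az i m k w|) <= C] &
      ig P (fun w => Sz i m a w * Sz i m b w) /\ Ex P (fun w => `|Sz i m a w * Sz i m b w|) <= C * m%:R].
Proof.
have [C C0 h] := panel_pow4.
have [C1 C10 h1] := panel_pow4_one.
exists (C + C1 + 1) => [|i m k a b m0]; first by rewrite ltr_wpDl// addr_ge0.
have m1 : 0 < m%:R :> R by rewrite ltr0n.
have m1' := ltW m1.
have hz k' : [/\ ig P (fun w => Sz i m k' w ^+ 4), Ex P (fun w => Sz i m k' w ^+ 4) <= C * m%:R ^+ 2,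
    ig P (fun w => Sz i m k' w ^+ 2) & Ex P (fun w => Sz i m k' w ^+ 2) <= (C + 1) * m%:R].
  have [[i4 e4] _ _] := h i m k'; split=> //; first exact: ig_pow2 (mSz i m k') i4.
  exact: (@Ex_sq_le _ _ _ P (Sz i m k')).
have [e_i4 e_e4] : ig P (fun w => Se i m w ^+ 4) /\ Ex P (fun w => Se i m w ^+ 4) <= C * m%:R ^+ 2.
  by have [_ [? ?] _] := h i m k.
have [ze_i4 ze_e4] : ig P (fun w => Sze i m k w ^+ 4) /\ Ex P (fun w => Sze i m k w ^+ 4) <= C * m%:R ^+ 2.
  by have [_ _ [? ?]] := h i m k.
have ze2 : Ex P (fun w => Sze i m k w ^+ 2) <= (C + 1) * m%:R by exact: (@Ex_sq_le _ _ _ P (Sze i m k)).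
have up (A B : R) : A <= B -> forall c, 0 <= c -> A * c <= B * c by move=> AB c c0; rewrite ler_wpM2r.
have [i4k e4k i2k e2k] := hz k; have [_ _ i2a e2a] := hz a; have [_ _ i2b e2b] := hz b.
have [zz_i zz2] : ig P (fun w => Szz i m a b w ^+ 2) /\ Ex P (fun w => Szz i m a b w ^+ 2) <= C1 * m%:R ^+ 2.
  have i2 t : ig P (fun w => (z i a t w * z i b t w) ^+ 2) /\ Ex P (fun w => (z i a t w * z i b t w) ^+ 2) <= C1.
    have [[ia ea] _ _] := h1 i t a; have [[ib eb] _ _] := h1 i t b.
    have [ii ee] := ig_sq_of_mul (z_meas i a t) (z_meas i b t) ia ib.
    split=> //; lra.
  have i3 : ig P (fun w => m%:R * \sum_(t < m) (z i a t w * z i b t w) ^+ 2).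
    by apply: igZ; apply: ig_sum => t _; have [] := i2 t.
  have le w : Szz i m a b w ^+ 2 <= m%:R * \sum_(t < m) (z i a t w * z i b t w) ^+ 2.
    exact: (sq_sum_le (fun t : 'I_m => z i a t w * z i b t w)).
  have i4 : ig P (fun w => Szz i m a b w ^+ 2).
    by apply: ig_le i3 _ => [|w]; [exact: measurable_funX|rewrite ger0_norm ?sqr_ge0].
  split=> //; apply: le_trans (Ex_le i4 i3 le) _.
  rewrite ExZ; last by apply: ig_sum => t _; have [] := i2 t.
  rewrite Ex_sum => [|t _]; last by have [] := i2 t.
  rewrite expr2 [leRHS]mulrCA ler_wpM2l// mulr_natr -[m in leRHS]card_ord -sumr_const.
  by apply: ler_sum => t _; have [] := i2 t.
have [az_i az_e] : ig P (fun w => Az i m k w ^+ 2) /\ Ex P (fun w => Az i m k w ^+ 2) <= C.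
  have [ii ee] := ig_sq_of_mul (mSz i m k) (mSe i m) i4k e_i4.
  have E : (fun w => Az i m k w ^+ 2) = fun w => (m%:R ^+ 2)^-1 * (Sz i m k w * Se i m w) ^+ 2.
    by apply/funext => w; rewrite -[Az i m k w]/(m%:R^-1 * _) exprMn exprVn.
  rewrite E; split; first exact: igZ.
  rewrite ExZ// mulrC ler_pdivrMr ?exprn_gt0//; lra.
split.
- split=> //; first by apply: le_trans e2k _; apply: up => //; lra.
  by apply: le_trans ze_e4 _; apply: up; [lra|rewrite sqr_ge0].
- split=> //; first exact: ig_pow2 (mSze i m k) ze_i4.
  + by apply: le_trans ze2 _; apply: up => //; lra.
  apply: le_trans zz2 _; apply: up; [lra|exact: sqr_ge0].
- split=> //; [lra|].
  have := @Ex_norm_le_sq _ _ _ P (Az i m k) 1 C (mAz i m k) ltr01 az_i.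
  rewrite expr1n !mul1r => /(_ az_e); lra.
- have [ii ee] := ig_mul (mSz i m a) (mSz i m b) i2a i2b.
  split=> //; apply: le_trans ee _.
  have : C1 * m%:R >= 0 by rewrite mulr_ge0.
  move: e2a e2b; rewrite !mulrDl mul1r; lra.
Qed.

Lemma Dmat_meas n m : mxmeas (Dmat n m).
Proof.
move=> a b; under eq_fun do rewrite mxE; apply: measurable_funM; first exact: measurable_cst.
apply: measurable_sum => i; apply: measurable_funB; first exact: mSzz.
apply: measurable_funM; first exact: measurable_cst.
by apply: measurable_funM; exact: mSz.
Qed.

Lemma Vv_meas n m : rvec (Vv n m).
Proof.
move=> k; under eq_fun do rewrite mxE; apply: measurable_funM; first exact: measurable_cst.
by apply: measurable_sum => i; exact: mSze.
Qed.

Lemma rho_meas n m : rvec (rho n m).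
Proof.
move=> k; under eq_fun do rewrite mxE; apply: measurable_funM; first exact: measurable_cst.
apply: measurable_sum => i; apply: measurable_funB; last exact: measurable_cst.
exact: mAz.
Qed.

Lemma stat_meas (alpha : nat -> R) (beta : 'cV[R]_K) n m : rvec (stat_nm P x eps alpha beta n m).
Proof.
have mX i t : mxmeas (fun w => x i t w - xbar x m i w).
  apply: subx_meas => [a b|]; first by rewrite ord1; exact: mx.
  apply: scalemx_meas; first exact: measurable_cst.
  by apply: summx_meas => u a b; rewrite ord1; exact: mx.
have mXT i t : mxmeas (fun w => (x i t w - xbar x m i w)^T).
  by move=> a b; under eq_fun do rewrite mxE; exact: mX.
have my i t : measurable_fun setT (yv x eps alpha beta i t).
  apply: measurable_funD; last exact: me.
  apply: measurable_funD; first exact: measurable_cst.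
  under eq_fun do rewrite mxE; apply: measurable_sum => k.
  by apply: measurable_funM; [under eq_fun do rewrite mxE; exact: mx|exact: measurable_cst].
have mst : mxmeas (stat_nm P x eps alpha beta n m).
  apply: scalemx_meas; first exact: measurable_cst.
  apply: subx_meas; last by move=> a b; exact: measurable_cst.
  apply: subx_meas; last by move=> a b; exact: measurable_cst.
  apply: mulmx_meas.
    apply: invmx_meas; apply: summx_meas => i; apply: summx_meas => t.
    by apply: mulmx_meas; [exact: mX|exact: mXT].
  apply: summx_meas => i; apply: summx_meas => t; apply: scalemx_meas; last exact: mX.
  apply: measurable_funB; first exact: my.
  by apply: measurable_funM; [exact: measurable_cst|apply: measurable_sum => u; exact: my].
by move=> j; exact: mst.
Qed.

Lemma panel_tails : exists2 B : R, 0 < B & forall n m, (0 < n)%N -> (0 < m)%N ->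
  [/\ forall k, ig P (fun w => Vv n m w k 0 ^+ 2) /\ Ex P (fun w => Vv n m w k 0 ^+ 2) <= B,
     forall k, ig P (fun w => rho n m w k 0 ^+ 2) /\ Ex P (fun w => rho n m w k 0 ^+ 2) <= B / m%:R,
     forall k, `|b_nm P x eps n m k 0| <= B,
     forall a b (dl : R), 0 < dl -> prb P [set w | dl < `|(Dmat n m w - Sigma_nm P x n m) a b|] <=
       B / n%:R / dl ^+ 2 + B / m%:R / dl &
     forall a b, `|Sigma_nm P x n m a b| <= B].
Proof.
have [C C0 h] := panel_bounds.
exists (4 * C + 1) => [|n m n0 m0]; first by rewrite addr_gt0// mulr_gt0.
have m1 : 0 < m%:R :> R by rewrite ltr0n.
have n1 : 0 < n%:R :> R by rewrite ltr0n.
have mu : m%:R != 0 :> R by rewrite gt_eqF.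
have nu : n%:R != 0 :> R by rewrite gt_eqF.
have N1 : 0 < (n * m)%:R :> R by rewrite ltr0n muln_gt0 n0.
have sN : (Num.sqrt (n * m)%:R)^-1 ^+ 2 = (n%:R * m%:R)^-1 :> R.
  by rewrite exprVn sqr_sqrtr ?natrM// ltW// -natrM.
have Ni : 0 <= (n%:R * m%:R)^-1 :> R by rewrite invr_ge0 mulr_ge0// ltW.
have avg (F : nat -> R) A : (forall i, `|F i| <= A) -> `|\sum_(i < n) F i| <= n%:R * A.
  move=> FA; apply: le_trans (ler_norm_sum _ _ _) _.
  rewrite mulr_natl -[n in leRHS]card_ord -sumr_const; apply: ler_sum => i _; exact: FA.
split.
- move=> k; have hk i := h i m k k k m0.
  have [i1 e1] := @panel_var n (fun i => Sze i m k) (C * m%:R)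
    (fun i => @smeas_Sze i m k)
    (fun i => let: And4 _ (And4 a _ _ _) _ _ := hk i in a) (fun i => let: And4 _ (And4 _ a _ _) _ _ := hk i in a).
  have E0 i : Ex P (Sze i m k) = 0.
    have -> : Ex P (Sze i m k) = \sum_(t < m) Ex P (fun w => z i k t w * eps i t w).
      by apply: Ex_sum => t _; have [] := panel_ig i t k.
    by rewrite big1// => t _; exact: Ex_zeps.
  have E : (fun w => Vv n m w k 0 ^+ 2) = fun w => (n%:R * m%:R)^-1 * (\sum_(i < n) (Sze i m k w - Ex P (Sze i m k))) ^+ 2.
    apply/funext => w; rewrite mxE exprMn sN; congr (_ * _ ^+ 2).
    by apply: eq_bigr => i _; rewrite E0 subr0.
  rewrite E; split; first exact: igZ.
  rewrite ExZ//; apply: (@le_trans _ _ ((n%:R * m%:R)^-1 * (n%:R * (C * m%:R)))); first by rewrite ler_wpM2l.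
  have -> : (n%:R * m%:R)^-1 * (n%:R * (C * m%:R)) = C by field; rewrite nu mu.
  by have := C0; lra.
- move=> k; have hk i := h i m k k k m0.
  have [i1 e1] := @panel_var n (fun i => Az i m k) C
    (fun i => @smeas_Az i m k)
    (fun i => let: And4 _ _ (And3 a _ _) _ := hk i in a) (fun i => let: And4 _ _ (And3 _ a _) _ := hk i in a).
  have E : (fun w => rho n m w k 0 ^+ 2) = fun w => (n%:R * m%:R)^-1 * (\sum_(i < n) (Az i m k w - Ex P (Az i m k))) ^+ 2.
    by apply/funext => w; rewrite mxE exprMn sqrrN sN.
  rewrite E; split; first exact: igZ.
  rewrite ExZ//; apply: (@le_trans _ _ ((n%:R * m%:R)^-1 * (n%:R * C))); first by rewrite ler_wpM2l.
  have -> : (n%:R * m%:R)^-1 * (n%:R * C) = C / m%:R by field; rewrite nu mu.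
  by rewrite ler_wpM2r ?invr_ge0 ?(ltW m1)//; lra.
- move=> k; rewrite b_nmE// normrN normrM ger0_norm ?invr_ge0 ?(ltW n1)//.
  rewrite mulrC ler_pdivrMr// mulrC; apply: (avg (fun i => Ex P (Az i m k))) => i.
  have [_ _ [i2 _ e] _] := h i m k k k m0.
  have [i1 _] := ig_sq_cst_sub 0 (mAz i m k) i2.
  by apply: le_trans (Ex_norm i1) _; lra.
- move=> a b dl dl0; have hk i := h i m a a b m0.
  have [i1 e1] := @panel_var n (fun i => Szz i m a b) (C * m%:R ^+ 2)
    (fun i => @smeas_Szz i m a b)
    (fun i => let: And4 _ (And4 _ _ a _) _ _ := hk i in a) (fun i => let: And4 _ (And4 _ _ _ a) _ _ := hk i in a).
  (* D - Sigma = X - Y. X averages centred independent terms and has variance O(1/n); Y is the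
     contribution of the squared time means and has first absolute moment O(1/m). *)
  pose X w := (n%:R * m%:R)^-1 * \sum_(i < n) (Szz i m a b w - Ex P (Szz i m a b)).
  pose Y w := (n%:R * m%:R)^-1 * \sum_(i < n) (m%:R^-1 * (Sz i m a w * Sz i m b w)).
  have XY w : (Dmat n m w - Sigma_nm P x n m) a b = X w - Y w.
    rewrite mxE [X in _ + X]mxE Sigma_nmE mxE !natrM /X /Y -!mulrBr -!sumrB.
    by congr (_ * _); apply: eq_bigr => i _; ring.
  have d2 : 0 < dl / 2 by rewrite divr_gt0.
  have mX : measurable_fun setT X.
    apply: measurable_funM; first exact: measurable_cst.
    apply: measurable_sum => i; apply: measurable_funB; last exact: measurable_cst.
    exact: mSzz.
  have iX : ig P (fun w => X w ^+ 2).
    by under eq_fun do rewrite exprMn; exact: igZ.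
  have eX : Ex P (fun w => X w ^+ 2) <= C / n%:R.
    under eq_fun do rewrite exprMn.
    rewrite ExZ//; apply: (@le_trans _ _ ((n%:R * m%:R)^-1 ^+ 2 * (n%:R * (C * m%:R ^+ 2)))).
      by rewrite ler_wpM2l// sqr_ge0.
    by rewrite le_eqVlt; apply/orP; left; apply/eqP; field; rewrite nu mu.
  have iZZ i : ig P (fun w => m%:R^-1 * (Sz i m a w * Sz i m b w)) by have [_ _ _ [? _]] := hk i; exact: igZ.
  have iY : ig P Y by apply: igZ; apply: ig_sum => i _.
  have eY : Ex P (fun w => `|Y w|) <= C / m%:R.
    have i2 : ig P (fun w => (n%:R * m%:R)^-1 * \sum_(i < n) (m%:R^-1 * `|Sz i m a w * Sz i m b w|)).
      by apply: igZ; apply: ig_sum => i _; apply: igZ; apply: ig_norm; have [_ _ _ []] := hk i.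
    apply: (@le_trans _ _ (Ex P (fun w => (n%:R * m%:R)^-1 * \sum_(i < n) (m%:R^-1 * `|Sz i m a w * Sz i m b w|)))).
      apply: Ex_le => //; first exact: ig_norm.
      move=> w; rewrite /Y normrM (ger0_norm Ni) ler_wpM2l//.
      apply: le_trans (ler_norm_sum _ _ _) _; apply: ler_sum => i _.
      by rewrite normrM ger0_norm ?invr_ge0 ?(ltW m1).
    rewrite ExZ; last by apply: ig_sum => i _; apply: igZ; apply: ig_norm; have [_ _ _ []] := hk i.
    rewrite Ex_sum => [|i _]; last by apply: igZ; apply: ig_norm; have [_ _ _ []] := hk i.
    apply: (@le_trans _ _ ((n%:R * m%:R)^-1 * (n%:R * C))).
      rewrite ler_wpM2l// mulr_natl -[n in leRHS]card_ord -sumr_const; apply: ler_sum => i _.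
      have [_ _ _ [? e]] := hk i; rewrite ExZ; last exact: ig_norm.
      by rewrite mulrC ler_pdivrMr.
    by rewrite le_eqVlt; apply/orP; left; apply/eqP; field; rewrite nu mu.
  have p1 := cheb2 mX d2 iX eX; have p2 := cheb1 d2 iY eY.
  have mAX : measurable [set w | dl / 2 < `|X w|].
    by apply: (@levset_meas _ _ _ (fun w => `|X w|)); exact: measurableT_comp.
  have mAY : measurable [set w | dl / 2 < `|Y w|].
    by apply: (@levset_meas _ _ _ (fun w => `|Y w|)); apply: measurableT_comp => //; exact: ig_meas iY.
  apply: (@le_trans _ _ (prb P ([set w | dl / 2 < `|X w|] `|` [set w | dl / 2 < `|Y w|]))).
    apply: prb_le; [|exact: measurableU|].
      under eq_set do rewrite XY.
      apply: (@levset_meas _ _ _ (fun w => `|X w - Y w|)); apply: measurableT_comp => //.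
      by apply: measurable_funB => //; exact: ig_meas iY.
    move=> w /=; rewrite XY => hw; have [|h1] := ltP (dl / 2) `|X w|; [by left|right].
    by rewrite ltNge; apply/negP => h2; have := ler_normB (X w) (Y w); lra.
  apply: le_trans (prb_U P mAX mAY) _; apply: lerD; [apply: le_trans p1 _|apply: le_trans p2 _].
    rewrite expr_div_n invf_div mulrA ler_wpM2r ?invr_ge0 ?sqr_ge0//.
    by rewrite mulrAC ler_wpM2r ?invr_ge0 ?(ltW n1)//; lra.
  rewrite invf_div mulrA ler_wpM2r ?invr_ge0 ?(ltW dl0)//.
  by rewrite mulrAC ler_wpM2r ?invr_ge0 ?(ltW m1)//; lra.
- move=> a b; rewrite Sigma_nmE normrM natrM (ger0_norm Ni) mulrC ler_pdivrMr ?mulr_gt0// mulrC -mulrA.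
  apply: (avg (fun i => Ex P (Szz i m a b))) => i; have [_ [_ _ i2 e2] _ _] := h i m a a b m0.
  have mzz := mSzz i m a b.
  have [iz _] := ig_sq_cst_sub 0 mzz i2.
  apply: le_trans (Ex_norm iz) _.
  have e3 : Ex P (fun w => Szz i m a b w ^+ 2) <= m%:R ^+ 2 * C by rewrite mulrC.
  apply: le_trans (Ex_norm_le_sq mzz m1 i2 e3) _; rewrite ler_wpM2l ?(ltW m1)//; lra.
Qed.

Lemma nsq_bd (v : 'cV[R]_K) (c : R) : (forall k, `|v k 0| <= c) -> nsq v <= K%:R * c ^+ 2.
Proof.
move=> vc; rewrite mulr_natl -[K in leRHS]card_ord -sumr_const; apply: ler_sum => k _.
rewrite -[leLHS]ger0_norm ?sqr_ge0// normrX ler_pXn2r ?nnegrE//; exact: le_trans (vc k).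
Qed.

(** On the event that D is near Sigma, V is bounded by L and rho is small, [perturb_solve] bounds
    the distance to Sigma^-1 V deterministically. The term [eta] pays for large V, which is bounded
    in probability but not small; the terms with [A] pay for D and rho. *)
Lemma stat_close (alpha : nat -> R) (beta : 'cV[R]_K) (lam e eta k0 : R) :
  0 < lam -> 0 < e -> 0 < eta -> 0 <= k0 ->
  exists A : R, forall n m, (0 < n)%N -> (0 < m)%N -> coercive lam (Sigma_nm P x n m) -> kap n m <= k0 ->
  forall j, prb P [set w | e < `|(stat_nm P x eps alpha beta n m w - invmx (Sigma_nm P x n m) *m Vv n m w) j 0|] <=
    eta + A / n%:R + A / m%:R.
Proof.
move=> lam0 e0 eta0 k00; have [B B0 hB] := panel_tails.
(* Chebyshev bounds the probability of a large V by K B / L^2, which is at most [eta] because K B <=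
   eta L and L >= 1. *)
pose L : R := 1 + K%:R * B / eta.
have KB : 0 <= K%:R * B / eta by rewrite divr_ge0 ?mulr_ge0 ?(ltW B0)// ltW.
have L1 : 1 <= L by rewrite /L lerDl.
(* The coefficient of dl^2 in the bound of [perturb_solve], once every coordinate of V + kap b + rho
   is at most L + k0 B + 1. *)
pose Cst : R := (lam ^+ 2)^-1 * (2 * (K%:R ^+ 2 * (((lam / 2) ^+ 2)^-1 * (K%:R * (L + k0 * B + 1) ^+ 2))) + 2 * K%:R).
have C0 : 0 <= Cst.
  have c1 : 0 <= K%:R * (L + k0 * B + 1) ^+ 2 by rewrite mulr_ge0// sqr_ge0.
  have c2 : 0 <= ((lam / 2) ^+ 2)^-1 * (K%:R * (L + k0 * B + 1) ^+ 2) by rewrite mulr_ge0// invr_ge0 sqr_ge0.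
  apply: mulr_ge0; first by rewrite invr_ge0 sqr_ge0.
  apply: addr_ge0; last by rewrite mulr_ge0.
  by apply: mulr_ge0 => //; apply: mulr_ge0; rewrite ?sqr_ge0.
(* The level 1 bounds rho inside that estimate, the second keeps D coercive, and the third makes Cst
   dl^2 at most e^2. *)
pose dl : R := Num.min 1 (Num.min (lam / (2 * (K%:R + 1))) (e / (Cst + 1))).
have K1 : 0 < K%:R + 1 :> R by rewrite ltr_wpDl.
have dl0 : 0 < dl by rewrite /dl !lt_min ltr01 !divr_gt0 ?mulr_gt0//= ltr_wpDl.
have dl1 : dl <= 1 by rewrite /dl ge_min lexx.
have dlK : K%:R * dl <= lam / 2.
  have h : dl <= lam / (2 * (K%:R + 1)) by rewrite /dl !ge_min lexx orbT.
  have : (K%:R + 1) * dl <= (K%:R + 1) * (lam / (2 * (K%:R + 1))) by rewrite ler_wpM2l// ltW.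
  rewrite (_ : (K%:R + 1) * (lam / _) = lam / 2); last by field; rewrite gt_eqF.
  lra.
have dlC : Cst * dl ^+ 2 <= e ^+ 2.
  have C1 : 0 < Cst + 1 by rewrite ltr_wpDl.
  have h : dl * (Cst + 1) <= e by rewrite -ler_pdivlMr// /dl !ge_min lexx !orbT.
  have h2 : (dl * (Cst + 1)) ^+ 2 <= e ^+ 2 by rewrite ler_pXn2r ?nnegrE ?mulr_ge0 ?(ltW C1) ?(ltW dl0) ?(ltW e0).
  apply: le_trans h2; rewrite exprMn mulrC ler_wpM2l ?sqr_ge0//; nra.
exists (K%:R ^+ 2 * (B / dl ^+ 2) + K%:R ^+ 2 * (B / dl) + K%:R * (B / dl ^+ 2)) => n m n0 m0 cS kk j.
have [hV hr hb hD _] := hB n m n0 m0.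
have m1 : 0 < m%:R :> R by rewrite ltr0n.
have n1 : 0 < n%:R :> R by rewrite ltr0n.
set S := Sigma_nm P x n m; set W := fun w => invmx S *m Vv n m w.
have kap0 : 0 <= kap n m :> R by rewrite divr_ge0 ?sqrtr_ge0.
have good w : (forall a b, `|(Dmat n m w - S) a b| <= dl) -> (forall k, `|Vv n m w k 0| <= L) ->
    (forall k, `|rho n m w k 0| <= dl) -> `|(stat_nm P x eps alpha beta n m w - W w) j 0| <= e.
  move=> g1 g2 g3; set b := b_nm P x eps n m.
  pose Q0 := Vv n m w + kap n m *: b; pose Q := Q0 + rho n m w.
  have [uD hq] := perturb_solve Q Q0 cS g1 dlK (ltW dl0) lam0.
  rewrite stat_decomp//.
  have -> : invmx (Dmat n m w) *m (Vv n m w + kap n m *: b + rho n m w) - invmx S *m (kap n m *: b) - W w =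
      invmx (Dmat n m w) *m Q - invmx S *m Q0.
    by rewrite /W -addrA -opprD -mulmxDr [kap _ _ *: b + _]addrC.
  have qr : Q - Q0 = rho n m w by rewrite /Q addrC addKr.
  rewrite qr in hq.
  have nQ : nsq Q <= K%:R * (L + k0 * B + 1) ^+ 2.
    apply: nsq_bd => k; rewrite /Q /Q0 !mxE.
    have h1 := g2 k; have h2 := hb k; have h3 := g3 k.
    have h4 : `|kap n m * b k 0| <= k0 * B by rewrite normrM ger0_norm// ler_pM.
    have t1 := ler_normD (Vv n m w k 0 + kap n m * b k 0) (rho n m w k 0).
    have t2 := ler_normD (Vv n m w k 0) (kap n m * b k 0).
    by move: t1 t2 h1 h3 h4; rewrite /Vv /rho !mxE; lra.
  have nr := nsq_bd g3.
  rewrite -(@ler_pXn2r _ 2)// ?nnegrE ?(ltW e0)// -normrX ger0_norm ?sqr_ge0//.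
  apply: le_trans (nsq_coord _ _) _; apply: le_trans hq _; apply: le_trans dlC.
  rewrite /Cst -[leRHS]mulrA ler_wpM2l ?invr_ge0 ?sqr_ge0//.
  have h5 : (K%:R * dl) ^+ 2 * (((lam / 2) ^+ 2)^-1 * nsq Q) <=
      (K%:R * dl) ^+ 2 * (((lam / 2) ^+ 2)^-1 * (K%:R * (L + k0 * B + 1) ^+ 2)).
    by rewrite ler_wpM2l ?sqr_ge0// ler_wpM2l// invr_ge0 sqr_ge0.
  have -> : (2 * (K%:R ^+ 2 * (((lam / 2) ^+ 2)^-1 * (K%:R * (L + k0 * B + 1) ^+ 2))) + 2 * K%:R) * dl ^+ 2 =
    2 * ((K%:R * dl) ^+ 2 * (((lam / 2) ^+ 2)^-1 * (K%:R * (L + k0 * B + 1) ^+ 2))) + 2 * (K%:R * dl ^+ 2).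
    by rewrite exprMn; ring.
  by lra.
pose bad (i : ('I_K * 'I_K) + ('I_K + 'I_K)) : set T := match i with
  | inl ab => [set w | dl < `|(Dmat n m w - S) ab.1 ab.2|]
  | inr (inl k) => [set w | L < `|Vv n m w k 0|]
  | inr (inr k) => [set w | dl < `|rho n m w k 0|] end.
have mW : rvec W.
  move=> k; under eq_fun do rewrite mxE; apply: measurable_sum => l.
  by apply: measurable_funM; [exact: measurable_cst|exact: Vv_meas].
have mA : measurable [set w | e < `|(stat_nm P x eps alpha beta n m w - W w) j 0|].
  apply: (@levset_meas _ _ _ (fun w => `|(stat_nm P x eps alpha beta n m w - W w) j 0|)).
  by apply: measurableT_comp => //; apply: rvecB => //; exact: stat_meas.
have mbad i : measurable (bad i).
  case: i => [[a b]|[k|k]] /=.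
  - apply: (@levset_meas _ _ _ (fun w => `|(Dmat n m w - S) a b|)); apply: measurableT_comp => //.
    by apply: subx_meas; [exact: Dmat_meas|move=> ? ?; exact: measurable_cst].
  - apply: (@levset_meas _ _ _ (fun w => `|Vv n m w k 0|)); apply: measurableT_comp => //; exact: Vv_meas.
  - apply: (@levset_meas _ _ _ (fun w => `|rho n m w k 0|)); apply: measurableT_comp => //; exact: rho_meas.
apply: le_trans (prb_union P mA mbad _) _.
  move=> w /= hw; apply: contrapT => nb.
  suff : `|(stat_nm P x eps alpha beta n m w - W w) j 0| <= e by rewrite leNgt hw.
  apply: good => [a b|k|k]; rewrite leNgt; apply/negP => h; apply: nb.
  - by exists (inl (a, b)).
  - by exists (inr (inl k)).
  - by exists (inr (inr k)).
rewrite !big_sumType/=.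
have s1 : \sum_(p : 'I_K * 'I_K) prb P [set w | dl < `|(Dmat n m w - S) p.1 p.2|] <=
    K%:R ^+ 2 * (B / n%:R / dl ^+ 2 + B / m%:R / dl).
  apply: (@le_trans _ _ (\sum_(p : 'I_K * 'I_K) (B / n%:R / dl ^+ 2 + B / m%:R / dl))).
    by apply: ler_sum => -[a b] _ /=; exact: hD.
  by rewrite sumr_const card_prod !card_ord -[leLHS]mulr_natl natrM expr2.
have s2 : \sum_(k : 'I_K) prb P [set w | L < `|Vv n m w k 0|] <= eta.
  have L0 : 0 < L by exact: lt_le_trans ltr01 L1.
  apply: (@le_trans _ _ (\sum_(k : 'I_K) B / L ^+ 2)).
    by apply: ler_sum => k _; have [i1 e1] := hV k; exact: cheb2 (Vv_meas n m k) L0 i1 e1.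
  rewrite sumr_const card_ord -[leLHS]mulr_natl mulrA ler_pdivrMr ?exprn_gt0//.
  have h1 : K%:R * B <= eta * L by rewrite /L mulrDr mulr1 [eta * (_ / _)]mulrC divfK ?gt_eqF// lerDr ltW.
  apply: le_trans h1 _; rewrite ler_wpM2l ?(ltW eta0)// expr2 ler_peMr// ltW//.
have s3 : \sum_(k : 'I_K) prb P [set w | dl < `|rho n m w k 0|] <= K%:R * (B / m%:R / dl ^+ 2).
  apply: (@le_trans _ _ (\sum_(k : 'I_K) B / m%:R / dl ^+ 2)).
    by apply: ler_sum => k _; have [i1 e1] := hr k; exact: cheb2 (rho_meas n m k) dl0 i1 e1.
  by rewrite sumr_const card_ord -[leLHS]mulr_natl.
apply: (@le_trans _ _ (K%:R ^+ 2 * (B / n%:R / dl ^+ 2 + B / m%:R / dl) + (eta + K%:R * (B / m%:R / dl ^+ 2)))).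
  by apply: lerD s1 (lerD s2 s3).
set A1 := K%:R ^+ 2 * (B / dl ^+ 2); set A2 := K%:R ^+ 2 * (B / dl); set A3 := K%:R * (B / dl ^+ 2).
have A10 : 0 <= A1 by rewrite mulr_ge0 ?sqr_ge0// divr_ge0 ?sqr_ge0// ltW.
have A20 : 0 <= A2 by rewrite mulr_ge0 ?sqr_ge0// divr_ge0//; exact: ltW.
have A30 : 0 <= A3 by rewrite mulr_ge0// divr_ge0 ?sqr_ge0// ltW.
have -> : K%:R ^+ 2 * (B / n%:R / dl ^+ 2 + B / m%:R / dl) + (eta + K%:R * (B / m%:R / dl ^+ 2)) =
  eta + A1 / n%:R + (A2 + A3) / m%:R by rewrite /A1 /A2 /A3; ring.
have q1 : A1 / n%:R <= (A1 + A2 + A3) / n%:R.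
  by rewrite ler_wpM2r ?invr_ge0 ?(ltW n1)//; lra.
have q2 : (A2 + A3) / m%:R <= (A1 + A2 + A3) / m%:R.
  by rewrite ler_wpM2r ?invr_ge0 ?(ltW m1)//; lra.
by lra.
Qed.

Lemma Ex_Sze i m k : Ex P (Sze i m k) = 0.
Proof.
have -> : Ex P (Sze i m k) = \sum_(t < m) Ex P (fun w => z i k t w * eps i t w).
  by apply: Ex_sum => t _; have [] := panel_ig i t k.
by rewrite big1// => t _; exact: Ex_zeps.
Qed.

(* Scores of different individuals are independent, so the Lindeberg-type estimate [trig_clt] applies
   with summands of fourth moment O(n^-2). *)
Lemma panel_clt : exists2 C : R, 0 <= C & forall n m (v : 'rV[R]_K) (B : R), (0 < n)%N -> (0 < m)%N ->
  (forall l, `|v 0 l| <= B) -> forall th,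
  `|Ex P (fun w => cos (th + (v *m Vv n m w) 0 0)) - expR (- ((v *m Omega_nm P x eps n m *m v^T) 0 0 / 2)) * cos th| <=
  2 * (C * B ^+ 4) / n%:R + (1 + C * B ^+ 4) / Num.sqrt n%:R.
Proof.
have [C C0 h] := panel_bounds.
exists (K%:R ^+ 4 * C) => [|n m v B n0 m0 vB th]; first by rewrite mulr_ge0 ?exprn_ge0// ltW.
have m1 : 0 < m%:R :> R by rewrite ltr0n.
have n1 : 0 < n%:R :> R by rewrite ltr0n.
have mu : m%:R != 0 :> R by rewrite gt_eqF.
have nu : n%:R != 0 :> R by rewrite gt_eqF.
have N1 : 0 < (n * m)%:R :> R by rewrite ltr0n muln_gt0 n0.
have sN : (Num.sqrt (n * m)%:R)^-1 ^+ 2 = (n%:R * m%:R)^-1 :> R.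
  by rewrite exprVn sqr_sqrtr ?natrM// ltW// -natrM.
have Ni : 0 <= (n%:R * m%:R)^-1 :> R by rewrite invr_ge0 mulr_ge0// ltW.
have i4S i l : ig P (fun w => Sze i m l w ^+ 4) by have [[_ _ ? _] _ _ _] := h i m l l l m0.
have e4S i l : Ex P (fun w => Sze i m l w ^+ 4) <= C * m%:R ^+ 2 by have [[_ _ _ ?] _ _ _] := h i m l l l m0.
have i2S i l : ig P (fun w => Sze i m l w ^+ 2) by exact: ig_pow2 (mSze i m l) (i4S i l).
have i1S i l : ig P (Sze i m l) by exact: ig_pow1 (mSze i m l) (i4S i l).
have i11S i a b : ig P (fun w => Sze i m a w * Sze i m b w).
  by have [] := ig_mul (mSze i m a) (mSze i m b) (i2S i a) (i2S i b).
pose cN := (Num.sqrt (n * m)%:R)^-1 : R.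
pose X i w := cN * \sum_l v 0 l * Sze i m l w.
have sX i : smeas (sig i setT) (X i).
  apply: smeasM; first exact: smeas_cst.
  by apply: smeas_sum => l; apply: smeasM; [exact: smeas_cst|exact: smeas_Sze].
have mX i : measurable_fun setT (X i) by exact: mS (sX i).
set C' := K%:R ^+ 4 * C * B ^+ 4.
have C'0 : 0 <= C'.
  by rewrite mulr_ge0 ?exprn_even_ge0// mulr_ge0 ?exprn_ge0// ltW.
have i4b i : ig P (fun w => cN ^+ 4 * (K%:R ^+ 3 * \sum_l (B ^+ 4 * Sze i m l w ^+ 4))).
  by apply: igZ; apply: igZ; apply: ig_sum => l _; exact: igZ.
have le4 i w : X i w ^+ 4 <= cN ^+ 4 * (K%:R ^+ 3 * \sum_l (B ^+ 4 * Sze i m l w ^+ 4)).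
  rewrite /X exprMn ler_wpM2l ?exprn_even_ge0//.
  apply: le_trans (pow4_sum_le _) _; rewrite ler_wpM2l ?exprn_ge0//; apply: ler_sum => l _.
  rewrite exprMn ler_wpM2r ?exprn_even_ge0//.
  rewrite -[leLHS]ger0_norm ?exprn_even_ge0// normrX ler_pXn2r ?nnegrE//; exact: le_trans (vB l).
have iX4 i : ig P (fun w => X i w ^+ 4).
  by apply: ig_le (i4b i) _ => [|w]; [exact: measurable_funX|rewrite ger0_norm ?exprn_even_ge0].
(* The factor (n m)^-2 cancels the order m^2 of the fourth moment of a score sum and leaves n^-2 per
   individual. *)
have cN4 : cN ^+ 4 = (n%:R ^+ 2 * m%:R ^+ 2)^-1 by rewrite (exprM _ 2 2) sN -exprMn -exprVn.
have eX4 i : Ex P (fun w => X i w ^+ 4) <= C' / n%:R ^+ 2.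
  apply: le_trans (Ex_le (iX4 i) (i4b i) (le4 i)) _.
  rewrite ExZ; last by apply: igZ; apply: ig_sum => l _; exact: igZ.
  rewrite ExZ; last by apply: ig_sum => l _; exact: igZ.
  rewrite Ex_sum => [|l _]; last exact: igZ.
  apply: (@le_trans _ _ (cN ^+ 4 * (K%:R ^+ 3 * \sum_(l < K) B ^+ 4 * (C * m%:R ^+ 2)))).
    rewrite ler_wpM2l ?exprn_even_ge0// ler_wpM2l ?exprn_ge0//; apply: ler_sum => l _.
    by rewrite ExZ// ler_wpM2l ?exprn_even_ge0.
  rewrite sumr_const card_ord -[_ *+ K]mulr_natl cN4 /C'.
  by rewrite le_eqVlt; apply/orP; left; apply/eqP; field; rewrite nu mu.
have EX0 i : Ex P (X i) = 0.
  rewrite ExZ; last by apply: ig_sum => l _; exact: igZ.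
  rewrite Ex_sum => [|l _]; last exact: igZ.
  by rewrite big1 ?mulr0// => l _; rewrite ExZ// Ex_Sze mulr0.
have sL (f : R -> R) j th' : measurable_fun setT f ->
    smeas (sig_lt x eps j) (fun w => f (th' + \sum_(i < j) X i w)).
  move=> mf; apply: smeas_comp => //; apply: smeasD; first exact: smeas_cst.
  by apply: smeas_sum => i; exact: smeas_sig_lt (ltn_ord i) (sX i).
have mcos : measurable_fun setT (@cos R) by apply: continuous_measurable_fun; exact: continuous_cos.
have msin : measurable_fun setT (@sin R) by apply: continuous_measurable_fun; exact: continuous_sin.
have mSX j th' : measurable_fun setT (fun w => th' + \sum_(i < j) X i w).
  by apply: measurable_funD; [exact: measurable_cst|exact: measurable_sum].
(* Applied with the cosine and the sine, this is the weak independence required by [trig_clt]: the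
   j-th score against the partial sum over earlier individuals. *)
have fac (f : R -> R) j th' : measurable_fun setT f -> (forall y, `|f y| <= 1) ->
  Ex P (fun w => cos (th' + \sum_(i < j) X i w) * f (X j w)) =
  Ex P (fun w => cos (th' + \sum_(i < j) X i w)) * Ex P (fun w => f (X j w)).
  move=> mf f1; apply: (@indep_bd _ _ _ P (fun w => cos (th' + \sum_(i < j) X i w)) (fun w => f (X j w)) 1 1) => //.
  - exact: cos_meas.
  - exact: measurableT_comp.
  - apply: (indep_level_lt mx me ind (j := j)); first exact: sL.
    by apply: (smeas_comp mf); exact: sX.
  - by move=> w; exact: cos_max.
have main := @trig_clt _ _ _ P X n mX iX4 EX0 (fun j th' _ => fac cos j th' mcos (@cos_max R))
  (fun j th' _ => fac sin j th' msin (@sin_max R)) th.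
have EV w : (v *m Vv n m w) 0 0 = \sum_(i < n) X i w.
  rewrite mxE /X -mulr_sumr exchange_big/= mulr_sumr; apply: eq_bigr => l _.
  by rewrite mxE mulrCA mulr_sumr.
have EQ : \sum_(j < n) Ex P (fun w => X j w ^+ 2) / 2 = (v *m Omega_nm P x eps n m *m v^T) 0 0 / 2.
  rewrite -mulr_suml; congr (_ / 2).
  have E2 i : Ex P (fun w => X i w ^+ 2) = (n%:R * m%:R)^-1 * \sum_b \sum_a (v 0 a * v 0 b * Ex P (fun w => Sze i m a w * Sze i m b w)).
    rewrite (_ : (fun w => _) = fun w => (n%:R * m%:R)^-1 * \sum_b \sum_a (v 0 a * v 0 b * (Sze i m a w * Sze i m b w))); last first.
      apply/funext => w; rewrite /X exprMn sN; congr (_ * _); rewrite expr2 mulr_sumr; apply: eq_bigr => b _.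
      by rewrite mulr_suml; apply: eq_bigr => a _; ring.
    rewrite ExZ; last by apply: ig_sum => b _; apply: ig_sum => a _; exact: igZ.
    rewrite Ex_sum => [|b _]; last by apply: ig_sum => a _; exact: igZ.
    congr (_ * _); apply: eq_bigr => b _.
    rewrite Ex_sum => [|a _]; last exact: igZ.
    by apply: eq_bigr => a _; rewrite ExZ.
  rewrite mxE; under eq_bigr do rewrite E2.
  rewrite -mulr_sumr exchange_big/= mulr_sumr; apply: eq_bigr => b _.
  rewrite exchange_big/= [(v *m _) 0 b]mxE mxE mulr_suml mulr_sumr; apply: eq_bigr => a _.
  rewrite Omega_nmE// -mulr_sumr natrM; ring.
under eq_fun do rewrite EV.
rewrite -EQ; apply: le_trans main _.
have q0 : 0 < Num.sqrt n%:R :> R by rewrite sqrtr_gt0.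
have q2 : Num.sqrt n%:R ^+ 2 = n%:R :> R by rewrite sqr_sqrtr// ltW.
move: (Num.sqrt n%:R) q0 q2 => q q0 q2.
have qu : q != 0 by rewrite gt_eqF.
have e3 i : Ex P (fun w => `|X i w| ^+ 3) <= (1 + C') / q / n%:R.
  (* The inequality p^3 <= 1 + p^4 at p = q |X i| with q = sqrt n. This scaling makes n^2 E X^4 of
     order 1, so the third moment is O(n^(-3/2)) and n of them sum to O(n^(-1/2)). *)
  have le3 w : `|X i w| ^+ 3 <= (q * n%:R)^-1 * (1 + n%:R ^+ 2 * X i w ^+ 4).
    have -> : X i w ^+ 4 = `|X i w| ^+ 4 by rewrite -normrX ger0_norm// exprn_even_ge0.
    have y0 := normr_ge0 (X i w); move: (`|X i w|) y0 => y y0.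
    rewrite mulrC ler_pdivlMr ?mulr_gt0// -q2.
    have p0 : 0 <= q * y by rewrite mulr_ge0// ltW.
    have : (q * y) ^+ 3 <= 1 + (q * y) ^+ 4.
      move: (q * y) p0 => p p0.
      have [p1|p1] := leP p 1.
        have : p ^+ 3 <= 1 by rewrite exprn_ile1.
        have : 0 <= p ^+ 4 by rewrite exprn_ge0.
        lra.
      have : p ^+ 3 <= p ^+ 4 by rewrite ler_weXn2l// ltW.
      lra.
    rewrite (_ : (q * y) ^+ 3 = y ^+ 3 * (q * q ^+ 2)); last by ring.
    by rewrite (_ : (q * y) ^+ 4 = (q ^+ 2) ^+ 2 * y ^+ 4)//; ring.
  have i3 : ig P (fun w => (q * n%:R)^-1 * (1 + n%:R ^+ 2 * X i w ^+ 4)).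
    by apply: igZ; apply: igD; [exact: ig_cst|exact: igZ].
  apply: le_trans (Ex_le (ig_pow3 (mX i) (iX4 i)) i3 le3) _.
  rewrite ExZ; last by apply: igD; [exact: ig_cst|exact: igZ].
  rewrite ExD ?ExZ ?Ex_cst//; [|exact: ig_cst|exact: igZ].
  have h2 : n%:R ^+ 2 * Ex P (fun w => X i w ^+ 4) <= C' by rewrite mulrC -ler_pdivlMr ?exprn_gt0.
  rewrite invfM mulrC mulrA ler_wpM2r ?invr_ge0 ?(ltW n1)// ler_wpM2r ?invr_ge0 ?(ltW q0)//.
  by rewrite lerD2l.
apply: (@le_trans _ _ (\sum_(j < n) (2 * (C' / n%:R ^+ 2) + (1 + C') / q / n%:R))).
  by apply: ler_sum => j _; apply: lerD; [rewrite ler_wpM2l|].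
rewrite sumr_const card_ord -[leLHS]mulr_natl -/C' le_eqVlt; apply/orP; left; apply/eqP.
by field; rewrite nu qu.
Qed.

Lemma Sigma_sym n m : (Sigma_nm P x n m)^T = Sigma_nm P x n m.
Proof.
apply/matrixP => a b; rewrite mxE !Sigma_nmE; congr (_ * _).
apply: eq_bigr => i _; congr (Ex P _); apply/funext => w.
by apply: eq_bigr => t _; rewrite mulrC.
Qed.

Lemma Omega_sym n m : (0 < m)%N -> (Omega_nm P x eps n m)^T = Omega_nm P x eps n m.
Proof.
move=> m0; apply/matrixP => a b; rewrite mxE !Omega_nmE//; congr (_ * _).
by apply: eq_bigr => i _; congr (Ex P _); apply/funext => w; rewrite mulrC.
Qed.

End WithinGroup.

(** * Passage to the limit along the sample sizes *)

Lemma norm_le_sq {R : realType} (y : R) : `|y| <= 1 + y ^+ 2.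
Proof.
have : y ^+ 2 = `|y| ^+ 2 by rewrite real_normK ?num_real.
by have := sqr_ge0 (`|y| - 1); have := normr_ge0 y; nra.
Qed.

Lemma quad_cvg {R : realType} K (A : nat -> 'M[R]_K) (A0 : 'M[R]_K) (u : 'rV[R]_K) (v : 'cV[R]_K) :
  (forall a b, A k a b @[k --> \oo] --> A0 a b) ->
  (u *m A k *m v) 0 0 @[k --> \oo] --> (u *m A0 *m v) 0 0.
Proof.
move=> hA; rewrite mxE; under eq_fun do rewrite mxE.
apply: cvg_sumR => b _; apply: cvgM; last exact: cvg_cst.
rewrite mxE; under eq_fun do rewrite mxE.
by apply: cvg_sumR => a _; apply: cvgM; [exact: cvg_cst|exact: hA].
Qed.

Lemma near_inv_le {R : realType} (nk : nat -> nat) (A e : R) : 0 < e ->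
  (forall N, \forall k \near \oo, (N <= nk k)%N) -> \forall k \near \oo, A / (nk k)%:R <= e.
Proof.
move=> e0 h; apply: filterS (h (Num.truncn (`|A| / e)).+1) => k hk.
have n0 : (0 < (nk k))%N by exact: leq_trans hk.
rewrite ler_pdivrMr ?ltr0n// mulrC -ler_pdivrMr//.
apply: (@le_trans _ _ (`|A| / e)); first by rewrite ler_wpM2r ?invr_ge0 ?(ltW e0)// ler_norm.
by apply: ltW; apply: lt_le_trans (truncnS_gt _) _; rewrite ler_nat.
Qed.

Theorem theorem1 (d : measure_display) (T : measurableType d) (R : realType)
  (P : probability T R) (K : nat)
  (x : nat -> nat -> T -> 'cV[R]_K) (eps : nat -> nat -> T -> R)
  (alpha : nat -> R) (beta : 'cV[R]_K) (r s : R) :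
  (* measurability of the data *)
  (forall i t (k : 'I_K), measurable_fun setT (fun w => x i t w k 0)) ->
  (forall i t, measurable_fun setT (eps i t)) ->
  (* model moment conditions: E eps_{it} = 0, E (x_{it} eps_{it}) = 0 *)
  (forall i t, Ex P (eps i t) = 0) ->
  (forall i t, Evec P (fun w => eps i t w *: x i t w) = 0) ->
  (* A1 (i) *)
  2 < r ->
  (exists C : R, forall i t (k : 'I_K),
     ('E_P[fun w => (`|x i t w k ord0| `^ (2 * r))%R] <= C%:E)%E /\
     ('E_P[fun w => (`|eps i t w| `^ (2 * r))%R] <= C%:E)%E) ->
  (* A1 (ii) *)
  (exists C : R, forall i t (k : 'I_K),
     ('E_P[fun w => (`|x i t w k ord0 * eps i t w| `^ (3 * r))%R] <= C%:E)%E) ->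
  (* A1 (iii) *)
  indep_across_i P x eps ->
  (* A1 (iv) *)
  (forall i, stationary_i P x eps i) ->
  4 * r / (r - 2) < s ->
  strong_mixing_rate P x eps s ->
  (* A2 *)
  (exists lam : R, 0 < lam /\ forall n m, (0 < n)%N -> (0 < m)%N ->
     forall v : 'cV[R]_K,
       lam * (v^T *m v) 0 0 <= (v^T *m Sigma_nm P x n m *m v) 0 0 /\
       lam * (v^T *m v) 0 0 <= (v^T *m Omega_nm P x eps n m *m v) 0 0) ->
  (* existence of Upsilon = lim_{n,m -> oo} Upsilon_{n,m} *)
  forall U : 'M[R]_K,
  (forall e : R, 0 < e -> exists N : nat, forall n m, (N <= n)%N -> (N <= m)%N ->
     forall a b, `|Upsilon_nm P x eps n m a b - U a b| < e) ->
  (* A3: n, m -> oo with n/m -> c in [0, oo), along any such sequence *)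
  forall (c : R) (nk mk : nat -> nat), 0 <= c ->
  (forall N : nat, \forall k \near \oo, (N <= nk k)%N /\ (N <= mk k)%N) ->
  (fun k => (nk k)%:R / (mk k)%:R : R) @ \oo --> c ->
  conv_law_normal P (fun k => stat_nm P x eps alpha beta (nk k) (mk k)) U.
Proof.
move=> mx me Eeps Exeps r2 mom1 mom2 ind stat s_gt mix [lam [lam0 A2]] U hU c nk mk c0 hk hc.
have nk_oo N : \forall k \near \oo, (N <= nk k)%N by apply: filterS (hk N) => k [].
have mk_oo N : \forall k \near \oo, (N <= mk k)%N by apply: filterS (hk N) => k [].
pose Sg k := Sigma_nm P x (nk k) (mk k); pose Om k := Omega_nm P x eps (nk k) (mk k).
pose Up k := Upsilon_nm P x eps (nk k) (mk k).
have cS k : (0 < nk k)%N -> (0 < mk k)%N -> coercive lam (Sg k).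
  by move=> n0 m0 v; rewrite -nsqE; have [] := A2 _ _ n0 m0 v.
have cO k : (0 < nk k)%N -> (0 < mk k)%N -> coercive lam (Om k).
  by move=> n0 m0 v; rewrite -nsqE; have [] := A2 _ _ n0 m0 v.
have sS k : (Sg k)^T = Sg k by exact: (Sigma_sym mx me r2 mom1 mom2).
have sO k : (0 < mk k)%N -> (Om k)^T = Om k by exact: (Omega_sym mx me r2 mom1 mom2 stat).
have Up_cvg a b : Up k a b @[k --> \oo] --> U a b.
  apply/cvgrPdist_lt => e e0; have [N hN] := hU e e0.
  apply: filterS (hk N) => k [n0 m0]; rewrite distrC; exact: hN.
have sUp k : (0 < mk k)%N -> (Up k)^T = Up k.
  by move=> m0; rewrite /Up /Upsilon_nm !trmx_mul trmx_inv sS sO// mulmxA.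
have sU : U^T = U.
  apply/matrixP => a b; rewrite mxE; apply/eqP; rewrite -subr_eq0; apply/eqP.
  have h1 : Up k b a - Up k a b @[k --> \oo] --> U b a - U a b by apply: cvgB; exact: Up_cvg.
  have h2 : Up k b a - Up k a b @[k --> \oo] --> (0 : R).
    apply: cvg_near_cst; apply: filterS (mk_oo 1%N) => k m0.
    by have /matrixP/(_ a b) := sUp k m0; rewrite mxE => ->; rewrite subrr.
  exact: (cvg_unique _ h1 h2).
have [B B0 hB] := panel_tails mx me Eeps Exeps r2 mom1 mom2 ind stat s_gt mix.
(* With q = Sigma^-1 v the form v.Upsilon v equals q.Omega q >= lam |q|^2, and |v|^2 = |Sigma q|^2
   <= (K B)^2 |q|^2 because the entries of Sigma are at most B. The constant [g] does not depend on
   k, so the lower bound survives in the limit. *)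
have pU : posdef U.
  pose g := lam / ((K%:R * B) ^+ 2 + 1).
  have d0 : 0 < (K%:R * B) ^+ 2 + 1 by rewrite ltr_wpDl// sqr_ge0.
  have g0 : 0 < g by rewrite divr_gt0.
  have low k (v : 'cV[R]_K) : (0 < nk k)%N -> (0 < mk k)%N -> g * nsq v <= (v^T *m Up k *m v) 0 0.
    move=> n0 m0; have uS := posdef_unit (coercive_posdef lam0 (cS k n0 m0)).
    pose q := invmx (Sg k) *m v.
    have -> : v^T *m Up k *m v = q^T *m Om k *m q.
      by rewrite /q /Up /Upsilon_nm trmx_mul trmx_inv sS !mulmxA.
    apply: le_trans (cO k n0 m0 q); rewrite /g mulrAC ler_pdivrMr// -mulrA ler_wpM2l ?(ltW lam0)//.
    have [_ _ _ _ hSB] := hB _ _ n0 m0.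
    have := nsq_mul q hSB; rewrite mulmxA mulmxV// mul1mx => h1.
    apply: le_trans h1 _; rewrite mulrC ler_wpM2l ?nsq_ge0//; lra.
  move=> v v0; apply: (@lt_le_trans _ _ (g * nsq v)); first by rewrite mulr_gt0// nsq_gt0.
  have h := @quad_cvg R K Up U v^T v Up_cvg.
  rewrite -(cvg_lim _ h)//; apply: limr_ge; first by apply/cvg_ex; eexists; exact: h.
  near=> k; apply: low; near: k; [exact: nk_oo|exact: mk_oo].
pose S k := stat_nm P x eps alpha beta (nk k) (mk k).
pose W k w := invmx (Sg k) *m Vv P x eps (nk k) (mk k) w.
have mS k : rvec (S k) by exact: (stat_meas P mx me).
have mV k : rvec (Vv P x eps (nk k) (mk k)) by exact: (Vv_meas P mx me).
have mW k : rvec (W k).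
  move=> j; rewrite /W; under eq_fun do rewrite mxE; apply: measurable_sum => l.
  by apply: measurable_funM; [exact: measurable_cst|exact: mV].
(* The square of [kap] is n/m, eventually at most c + 1, and |y| <= 1 + y^2 gives c + 2. *)
have kap_le : \forall k \near \oo, kap (nk k) (mk k) <= c + 2 :> R.
  have : \forall k \near \oo, ((nk k)%:R / (mk k)%:R : R) <= c + 1.
    move/cvgrPdist_le : hc => /(_ 1 ltr01); apply: filterS => k.
    by rewrite ler_norml => /andP[? ?]; lra.
  move=> h; near=> k.
  have m0 : (0 < mk k)%N by near: k; exact: mk_oo.
  have h1 : ((nk k)%:R / (mk k)%:R : R) <= c + 1 by near: k.
  have m1 : (mk k)%:R != 0 :> R by rewrite pnatr_eq0 -lt0n.
  have h2 : (kap (nk k) (mk k) : R) ^+ 2 = (nk k)%:R / (mk k)%:R.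
    by rewrite /kap exprMn sqr_sqrtr// exprVn natrM; field.
  apply: le_trans (ler_norm _) _; have := norm_le_sq (kap (nk k) (mk k) : R).
  by rewrite h2; clear - h1; lra.
apply: (@conv_law_normal_cos _ _ _ P K S W mS mW _ _ U sU pU).
- move=> j e e0; apply/cvgrPdist_le => eta eta0.
  have e3 : 0 < eta / 3 by rewrite divr_gt0.
  have c2 : 0 <= c + 2 by rewrite addr_ge0.
  have [A hA] := stat_close mx me Eeps Exeps r2 mom1 mom2 ind stat s_gt mix alpha beta lam0 e0 e3 c2.
  near=> k.
  have n0 : (0 < nk k)%N by near: k; exact: nk_oo.
  have m0 : (0 < mk k)%N by near: k; exact: mk_oo.
  have hk1 : kap (nk k) (mk k) <= c + 2 :> R by near: k.
  have q1 : A / (nk k)%:R <= eta / 3 by near: k; exact: near_inv_le.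
  have q2 : A / (mk k)%:R <= eta / 3 by near: k; exact: near_inv_le.
  rewrite sub0r normrN ger0_norm ?prb_ge0//.
  apply: le_trans (hA _ _ n0 m0 (cS k n0 m0) hk1 j) _; clear - q1 q2; lra.
(* Tightness of Sigma^-1 V from second moments: coercivity bounds |Sigma^-1 V|^2 by |V|^2 / lam^2,
   whose mean is at most D for every sample size. *)
- move=> e e0; pose D := (lam ^+ 2)^-1 * (K%:R * B).
  have D0 : 0 <= D by rewrite mulr_ge0 ?invr_ge0 ?sqr_ge0// mulr_ge0// ltW.
  have De : 0 <= D / e by rewrite divr_ge0// ltW.
  pose L := 1 + D / e; have L0 : 0 < L by rewrite /L ltr_pwDl.
  exists L => //; near=> k => j.
  have n0 : (0 < nk k)%N by near: k; exact: nk_oo.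
  have m0 : (0 < mk k)%N by near: k; exact: mk_oo.
  have [hV _ _ _ _] := hB _ _ n0 m0.
  have uS := posdef_unit (coercive_posdef lam0 (cS k n0 m0)).
  have le1 w : W k w j 0 ^+ 2 <= (lam ^+ 2)^-1 * nsq (Vv P x eps (nk k) (mk k) w).
    apply: le_trans (nsq_coord _ _) _; apply: le_trans (coercive_solve _ lam0 (cS k n0 m0)) _.
    by rewrite /W mulmxA mulmxV// mul1mx.
  have iN : ig P (fun w => nsq (Vv P x eps (nk k) (mk k) w)) by apply: ig_sum => l _; have [] := hV l.
  have i2 : ig P (fun w => (lam ^+ 2)^-1 * nsq (Vv P x eps (nk k) (mk k) w)) by exact: igZ.
  have iW : ig P (fun w => W k w j 0 ^+ 2).
    by apply: ig_le i2 _ => [|w]; [apply: measurable_funX; exact: mW|rewrite ger0_norm ?sqr_ge0].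
  have eW : Ex P (fun w => W k w j 0 ^+ 2) <= D.
    apply: le_trans (Ex_le iW i2 le1) _; rewrite ExZ// /D ler_wpM2l ?invr_ge0 ?sqr_ge0//.
    rewrite Ex_sum => [|l _]; last by have [] := hV l.
    rewrite mulr_natl -[K in leRHS]card_ord -sumr_const; apply: ler_sum => l _.
    by have [] := hV l.
  apply: le_trans (cheb2 (mW k j) L0 iW eW) _; rewrite ler_pdivrMr ?exprn_gt0//.
  have h1 : D <= e * L by rewrite /L mulrDr mulr1 [e * (_ / _)]mulrC divfK ?gt_eqF// lerDr ltW.
  by apply: le_trans h1 _; rewrite ler_wpM2l ?(ltW e0)// expr2 ler_peMr ?(ltW L0)// /L lerDl.
- move=> a th.
  have [C C0 hC] := panel_clt mx me Eeps Exeps r2 mom1 mom2 ind stat s_gt mix.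
  (* A bound on the coordinates of a Sigma^-1 valid for all sample sizes, which is what [panel_clt]
     needs to be applied with a moving coefficient vector. *)
  pose Ba := 1 + (lam ^+ 2)^-1 * nsq a^T.
  have Ba0 : 0 <= Ba by rewrite addr_ge0// mulr_ge0 ?invr_ge0 ?sqr_ge0// nsq_ge0.
  have lim1 : expR (- ((a *m Up k *m a^T) 0 0 / 2)) * cos th @[k --> \oo] -->
      expR (- (a *m U *m a^T) 0 0 / 2) * cos th.
    apply: cvgM; last exact: cvg_cst.
    rewrite mulNr; apply: (@cvg_comp _ _ _ (fun k => - ((a *m Up k *m a^T) 0 0 / 2)) expR); last exact: continuous_expR.
    by apply: cvgN; apply: cvgM; [exact: quad_cvg|exact: cvg_cst].
  apply/cvgrPdist_le => e e0.
  have e3 : 0 < e / 3 by rewrite divr_gt0.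
  (* The n^(-1/2) error is brought below e/3 by bounding its square, which has rate 1/n. *)
  have e9 : 0 < e ^+ 2 / 9 by rewrite divr_gt0// exprn_gt0.
  move/cvgrPdist_le : lim1 => /(_ _ e3) lim1.
  pose A := C * Ba ^+ 4.
  have A0 : 0 <= A by rewrite mulr_ge0// exprn_ge0.
  near=> k.
  have n0 : (0 < nk k)%N by near: k; exact: nk_oo.
  have m0 : (0 < mk k)%N by near: k; exact: mk_oo.
  have n1 : 0 < (nk k)%:R :> R by rewrite ltr0n.
  have l1 : `|expR (- (a *m U *m a^T) 0 0 / 2) * cos th - expR (- ((a *m Up k *m a^T) 0 0 / 2)) * cos th| <= e / 3.
    by near: k.
  have q1 : 2 * A / (nk k)%:R <= e / 3 by near: k; exact: near_inv_le.
  have q2 : (1 + A) ^+ 2 / (nk k)%:R <= e ^+ 2 / 9 by near: k; exact: near_inv_le.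
  have q3 : (1 + A) / Num.sqrt (nk k)%:R <= e / 3.
    rewrite -(@ler_pXn2r _ 2)// ?nnegrE ?divr_ge0 ?addr_ge0 ?sqrtr_ge0 ?(ltW e0)//.
    rewrite expr_div_n sqr_sqrtr ?(ltW n1)//; apply: le_trans q2 _.
    by rewrite le_eqVlt; apply/orP; left; apply/eqP; field.
  have uS := posdef_unit (coercive_posdef lam0 (cS k n0 m0)).
  have vB l : `|(a *m invmx (Sg k)) 0 l| <= Ba.
    have E : (a *m invmx (Sg k)) 0 l = (invmx (Sg k) *m a^T) l 0.
      have -> : invmx (Sg k) *m a^T = (a *m invmx (Sg k))^T by rewrite trmx_mul trmx_inv sS.
      by rewrite [RHS]mxE.
    have h1 := coercive_solve (invmx (Sg k) *m a^T) lam0 (cS k n0 m0).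
    rewrite mulmxA mulmxV// mul1mx in h1.
    have h2 := nsq_coord (invmx (Sg k) *m a^T) l.
    rewrite E /Ba; move: ((invmx (Sg k) *m a^T) l 0) h2 => y h2.
    by have := norm_le_sq y; clear - h1 h2; lra.
  have := hC _ _ _ _ n0 m0 vB th; rewrite -/A.
  have -> : a *m invmx (Sg k) *m Omega_nm P x eps (nk k) (mk k) *m (a *m invmx (Sg k))^T = a *m Up k *m a^T.
    by rewrite trmx_mul trmx_inv sS /Up /Upsilon_nm !mulmxA.
  have -> : (fun w => cos (th + (a *m invmx (Sg k) *m Vv P x eps (nk k) (mk k) w) 0 0)) =
      (fun w => cos (th + (a *m W k w) 0 0)) by apply/funext => w; rewrite /W mulmxA.
  move: l1; rewrite !ler_norml => /andP[u1 u2] /andP[u3 u4].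
  by clear - u1 u2 u3 u4 q1 q3; apply/andP; split; lra.
Unshelve. all: by end_near.
Qed.
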